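(* Let $\mathcal{H}_0$ be an infinite-dimensional separable Hilbert space. Let $X=(X_t)_{t\in\mathbb{Z}}$ be a process defined on $(\Omega,\mathcal{F},\mathbb{P})$ and valued in $\mathcal{H}_0$ which is stationary and ergodic, and which is weakly stationary. Let $(\Theta,\Delta)$ be a compact metric space and let $L$ and $R$ be in $\mathcal{C}(\Theta\times\mathbb{T},\mathcal{L}_b(\mathcal{H}_0))$. Let $s=(s_k)_{k\in\mathbb{N}}\in[1,\infty)^{\mathbb{N}}$ and let $(\phi_k)_{k\in\mathbb{N}}$ be an orthonormal sequence of $\mathcal{H}_0$. Define the Hilbert space $$\mathcal{H}_0^s=\Big\{x\in\overline{\mathrm{Span}}(\phi_k,k\in\mathbb{N}):\ \sum_{k\in\mathbb{N}}s_k^2|\langle x,\phi_k\rangle_{\mathcal{H}_0}|^2<\infty\Big\},\qquad\langle x,y\rangle_{\mathcal{H}_0^s}=\sum_{k\in\mathbb{N}}s_k^2\langle x,\phi_k\rangle_{\mathcal{H}_0}\overline{\langle y,\phi_k\rangle_{\mathcal{H}_0}} .$$ Suppose that the three following assertions hold. (i) The sequence $s$ is non-decreasing and goes to $\infty$. (ii) $X_0\in\mathcal{H}_0^s$ $\mathbb{P}$-a.s. with $\mathbb{E}\big[\|X_0\|_{\mathcal{H}_0^s}^2\big]<\infty$. (iii) Defining $L_s$ and $R_s$ by $L_s(\theta,\lambda)=L(\theta,\lambda)_{|\mathcal{H}_0^s}$ and $R_s(\theta,\lambda)=R(\theta,\lambda)_{|\mathcal{H}_0^s}$ for all $(\theta,\lambda)\in\Theta\times\mathbb{T}$,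 $L_s$ and $R_s$ belong to $\mathcal{C}(\Theta\times\mathbb{T},\mathcal{L}_b(\mathcal{H}_0^s))$. Then $$\lim_{n\to\infty}\tilde{\mathcal{Q}}^{(L,R)}_{I_n^{X^c_n}}=\tilde{\mathcal{Q}}^{(L,R)}_{\nu_X}\quad\text{uniformly in }\mathcal{C}(\Theta,\mathcal{S}_1(\mathcal{H}_0)),\quad\mathbb{P}\text{-a.s.}$$
   Context: Hilbert spaces are complex. $\mathcal{L}_b(\mathcal{H}_0)$: bounded operators with the operator norm; $\mathcal{S}_1$: trace-class operators with trace norm $\|\cdot\|_1$; $\mathcal{S}_1^+$: positive semidefinite ones; $\mathrm{P}^{\mathsf{H}}$: adjoint; $x\otimes y:z\mapsto\langle z,y\rangle x$; $\mathbb{T}=\mathbb{R}/2\pi\mathbb{Z}$; $\mathrm{Leb}_{\mathbb{T}}$ is Lebesgue measure on $\mathbb{T}$ divided by $2\pi$; the closed span is taken in $\mathcal{H}_0$. $\mathcal{C}(\mathcal{E}_1,\mathcal{E}_2)$ is the set of continuous functions between metric spaces, and $F_n\to F$ uniformly in $\mathcal{C}(\mathcal{E}_1,\mathcal{E}_2)$ means $\sup_{x\in\mathcal{E}_1}d_2(F_n(x),F(x))\to0$. Stationary means strictly stationary and ergodic refers to the shift on $\mathcal{H}_0^{\mathbb{Z}}$ under the law of $X$. Weakly stationary means $X_t\in L^2(\Omega,\mathcal{F},\mathcal{H}_0,\mathbb{P})$, constant mean (not necessarily zero), and $\mathrm{Cov}(X_{t+h},X_t)=\mathrm{Cov}(X_h,X_0)$,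 where $\langle\mathrm{Cov}(X,Y)y,x\rangle=\mathrm{Cov}(\langle X,x\rangle,\langle Y,y\rangle)$. The spectral operator measure $\nu_X:\mathcal{B}(\mathbb{T})\to\mathcal{S}_1^+(\mathcal{H}_0)$ is the $\|\cdot\|_1$-$\sigma$-additive measure such that $\mathrm{Cov}(X_h,X_0)=\int e^{ih\lambda}\nu_X(\mathrm{d}\lambda)$ for all $h\in\mathbb{Z}$; it has a density $f_X$ with respect to the finite measure $\|\nu_X\|_1:A\mapsto\|\nu_X(A)\|_1$. Centered periodogram: $X^c_{n,k}=X_k-\frac1n\sum_{j=1}^nX_j$, $d_n^{X^c_n}(\lambda)=n^{-1/2}\sum_{k=1}^nX^c_{n,k}e^{-i\lambda k}$, $I_n^{X^c_n}(\lambda)=d_n^{X^c_n}(\lambda)\otimes d_n^{X^c_n}(\lambda)$. Quadratic functionals: for $\theta\in\Theta$, $$\tilde{\mathcal{Q}}^{(L,R)}_{I_n^{X^c_n}}(\theta)=\int L(\theta,\lambda)\,I_n^{X^c_n}(\lambda)\,R(\theta,\lambda)^{\mathsf{H}}\,\mathrm{Leb}_{\mathbb{T}}(\mathrm{d}\lambda),$$ $$\tilde{\mathcal{Q}}^{(L,R)}_{\nu_X}(\theta)=\int L(\theta,\lambda)\,\nu_X(\mathrm{d}\lambda)\,R(\theta,\lambda)^{\mathsf{H}}=\int L(\theta,\lambda)f_X(\lambda)R(\theta,\lambda)^{\mathsf{H}}\,\|\nu_X\|_1(\mathrm{d}\lambda).$$ *)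

(* Defs.v *)
From HB Require Import structures.
From mathcomp Require Import all_boot all_order all_algebra.
From mathcomp Require Import all_classical all_reals all_analysis.
From mathcomp Require Import complex.

Set Implicit Arguments.
Unset Strict Implicit.
Unset Printing Implicit Defensive.

Import Order.TTheory GRing.Theory Num.Theory.
Import numFieldNormedType.Exports.

Local Open Scope classical_set_scope.
Local Open Scope ring_scope.
Local Open Scope complex_scope.

HB.mixin Record CompleteNormedModule_isHilbert (K : realType) H
    & CompleteNormedModule K[i] H := {
  hdot : H -> H -> K[i] ;
  hdotDZl : forall (a : K[i]) (x y z : H),
    hdot (a *: x + y) z = a * hdot x z + hdot y z ;
  hdotC : forall x y : H, hdot y x = (hdot x y)^* ;
  hdot_norm : forall x : H, `|x| ^+ 2 = hdot x x
}.

#[short(type="hilbertType")]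
HB.structure Definition Hilbert (K : realType) :=
  { H of CompleteNormedModule K[i] H & CompleteNormedModule_isHilbert K H }.

Section linear_structure.
Context {K : realType} {H : hilbertType K}.
Implicit Types (x y z : H) (A B D : set H) (dot : H -> H -> K[i])
  (S T : H -> H).

Definition lin_span A : set H :=
  [set x | exists n (c : 'I_n -> K[i]) (v : 'I_n -> H),
     (forall i, A (v i)) /\ x = \sum_(i < n) c i *: v i].

Definition closed_span A : set H := closure (lin_span A).

Definition infinite_dimensional : Prop :=
  forall n (v : 'I_n -> H), lin_span (range v) <> setT.

Definition separable : Prop := exists A : set H, countable A /\ dense A.

Definition orthonormal_set B : Prop :=
  forall x y, B x -> B y -> hdot x y = (x == y)%:R.

Definition orthonormal_seq (phi : nat -> H) : Prop :=
  forall j k, hdot (phi j) (phi k) = (j == k)%:R.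

Definition hilbert_basis B : Prop :=
  orthonormal_set B /\ closed_span B = setT.

Definition dot_norm dot x : K := Num.sqrt (complex.Re (dot x x)).

Definition linear_on D T : Prop :=
  forall (a : K[i]) x y, D x -> D y -> T (a *: x + y) = a *: T x + T y.

(* Operator norm of the restriction of T to the Hilbert space with carrier D
   and inner product dot. It is +oo unless that restriction is a bounded
   operator of this space, so that L_b(D, dot) is {T | opnorm_on D dot T < +oo}. *)
Definition opnorm_on D dot T : \bar K :=
  if `[< linear_on D T /\ (forall x, D x -> D (T x)) >] then
    ereal_sup [set (dot_norm dot (T x))%:E
              | x in [set x | D x /\ dot_norm dot x <= 1]]
  else +oo%E.

Definition opnorm T : \bar K := opnorm_on setT hdot T.

Definition bounded_op T : Prop := (opnorm T < +oo)%E.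

Definition positive_op T : Prop := forall x, 0 <= hdot (T x) x.

Definition adjoint T : H -> H :=
  xget 0 [set S | forall x y, hdot (T x) y = hdot x (S y)].

Definition abs_op T : H -> H :=
  xget 0 [set S | [/\ bounded_op S, positive_op S & S \o S = adjoint T \o T]].

(* The basis is obtained by choice; the trace of a positive operator does not
   depend on it. *)
Definition positive_trace T : \bar K :=
  (\esum_(x in xget set0 hilbert_basis) (complex.Re (hdot (T x) x))%:E)%E.

(* Extended by +oo outside S_1(H), hence S_1(H) is {T | trace_norm T < +oo}. *)
Definition trace_norm T : \bar K :=
  if `[< bounded_op T >] then positive_trace (abs_op T) else +oo%E.

Definition tensor x y : H -> H := fun z => hdot z y *: x.

End linear_structure.

Arguments infinite_dimensional {K} H.
Arguments separable {K} H.

Section weighted_space.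
Context {K : realType} {H : hilbertType K}.
Variables (s : nat -> K) (phi : nat -> H).

Definition weighted_space : set H :=
  [set x | closed_span (range phi) x /\
    (\sum_(0 <= k <oo)
       (s k ^+ 2 * (complex.Re `|hdot x (phi k)|) ^+ 2)%:E < +oo)%E].

Definition weighted_dot (x y : H) : K[i] :=
  limn (series (fun k =>
    (s k ^+ 2)%:C * hdot x (phi k) * (hdot y (phi k))^* : K[i]^o)).

Definition weighted_opnorm : (H -> H) -> \bar K :=
  opnorm_on weighted_space weighted_dot.

End weighted_space.

(* In the next two sections a normed space is encoded by an ambient vector
   space V and an extended norm N : V -> \bar K: its elements are the vectors
   where N is finite. *)

Section continuous_functions.
Context {K : realType} {V : zmodType}.
Variable N : V -> \bar K.

Definition in_C {E : topologicalType} (F : E -> V) : Prop :=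
  (forall p, (N (F p) < +oo)%E) /\
  (forall p (eps : K), 0 < eps -> \forall q \near p, (N (F q - F p) < eps%:E)%E).

Definition unif_cvg_in_C {E : topologicalType} (Fn : nat -> E -> V) (F : E -> V) :
    Prop :=
  [/\ forall n, in_C (Fn n), in_C F &
    forall eps : K, 0 < eps ->
      \forall n \near \oo, forall x, (N (Fn n x - F x) < eps%:E)%E].

End continuous_functions.

(* The measure mu is a bare set function so that A |-> trace_norm (nu A) can be
   used directly; only its values on measurable sets matter.  The condition
   N (s n x) < +oo makes f almost everywhere valued in the normed space. *)
Section bochner.
Context {d : measure_display} {T : measurableType d} {K : realType}.
Context {V : lmodType K[i]}.
Variables (mu : set T -> \bar K) (N : V -> \bar K).
Implicit Types (f s : T -> V) (I : V).

Definition simple_fun s : Prop :=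
  finite_set (range s) /\
  forall v, [/\ measurable (s @^-1` [set v]),
    v != 0 -> (mu (s @^-1` [set v]) < +oo)%E & range s v -> (N v < +oo)%E].

Definition simple_integral s : V :=
  \sum_(v \in range s) (fine (mu (s @^-1` [set v])))%:C *: v.

Definition is_bochner_integral f I : Prop :=
  exists s : nat -> T -> V,
    [/\ forall n, simple_fun (s n),
        {ae mu, forall x, (fun n => N (f x - s n x)) @ \oo --> 0%E},
        (fun n => \int[mu]_x N (f x - s n x))%E @ \oo --> 0%E &
        (fun n => N (simple_integral (s n) - I)) @ \oo --> 0%E].

Definition bochner_integral f : V := xget 0 [set I | is_bochner_integral f I].

End bochner.

Section torus.
Variable K : realType.

Definition torus_rel (x y : K) : bool :=
  `[< exists k : int, x - y = k%:~R * (2 * pi) >].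

Lemma torus_rel_equiv : equiv_class_of torus_rel.
Proof.
split=> [x|x y|y x z].
- by apply/asboolP; exists 0; rewrite subrr mul0r.
- by apply/asboolP/asboolP => -[k xy]; exists (- k);
    rewrite -opprB xy mulrNz mulNr.
- move=> /asboolP[k xy] /asboolP[l yz]; apply/asboolP; exists (k + l).
  by rewrite intrD mulrDl -xy -yz addrA subrK.
Qed.

Canonical torus_equiv := EquivRelPack torus_rel_equiv.

Definition torus : Type := quotient_topology {eq_quot torus_equiv}%qT.

HB.instance Definition _ := Pointed.on torus.
HB.instance Definition _ := Topological.on torus.

Definition torus_pi (x : K) : torus := \pi_({eq_quot torus_equiv})%qT x.

(* An arbitrary representative; only 2 pi-periodic functions are applied to it. *)
Definition torus_repr (l : torus) : K := repr (l : {eq_quot torus_equiv}%qT).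

Definition torus_exp (h : int) (l : torus) : K[i] :=
  cos (h%:~R * torus_repr l) +i* sin (h%:~R * torus_repr l).

End torus.

Notation torusB K := (g_sigma_algebraType (@open (torus K))).

Definition leb_torus {K : realType} (A : set (torusB K)) : \bar K :=
  (((2 * pi)^-1)%R%:E * lebesgue_measure (`[0%R, (2 * pi)%R[ `&` @torus_pi K @^-1` A))%E.

Section processes.
Context {d : measure_display} {Omega : measurableType d} {K : realType}.
Context {H : hilbertType K}.
Variable P : probability Omega K.
Implicit Types (X : int -> Omega -> H) (Y Z : Omega -> H) (U W : Omega -> K[i]).

Definition is_process X : Prop :=
  forall t, measurable_fun setT (X t : Omega -> g_sigma_algebraType (@open H)).

Definition path_measurable : set_system (int -> H) :=
  <<s [set C | exists (t : int) (A : set H),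
         <<s @open H >> A /\ C = [set x | A (x t)]] >>.

Definition law X (A : set (int -> H)) : \bar K := P [set w | A (X ^~ w)].

Definition shift (h : int) (x : int -> H) : int -> H := fun t => x (t + h).

Definition stationary X : Prop :=
  forall h A, path_measurable A -> law X (shift h @^-1` A) = law X A.

Definition ergodic X : Prop :=
  forall A, path_measurable A -> shift 1 @^-1` A = A ->
    law X A = 0%E \/ law X A = 1%E.

Definition square_integrable Y : Prop :=
  (\int[P]_w ((dot_norm hdot (Y w)) ^+ 2)%:E < +oo)%E.

Definition mean Y : H := bochner_integral P (fun x : H => (dot_norm hdot x)%:E) Y.

Definition cexp U : K[i] :=
  Rintegral P setT (fun w => complex.Re (U w)) +i*
  Rintegral P setT (fun w => complex.Im (U w)).

Definition ccov U W : K[i] := cexp (fun w => (U w - cexp U) * (W w - cexp W)^*).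

Definition cov_op Y Z : H -> H :=
  xget 0 [set C | bounded_op C /\ forall x y,
    hdot (C y) x = ccov (fun w => hdot (Y w) x) (fun w => hdot (Z w) y)].

Definition weakly_stationary X : Prop :=
  [/\ forall t, square_integrable (X t),
      forall t, mean (X t) = mean (X 0) &
      forall t h, cov_op (X (t + h)) (X t) = cov_op (X h) (X 0)].

End processes.

Section operator_measures.
Context {K : realType} {H : hilbertType K}.
Implicit Types (nu : set (torusB K) -> H -> H) (f : torusB K -> H -> H).

Definition trace_class_measure nu : Prop :=
  (forall A, measurable A -> (trace_norm (nu A) < +oo)%E /\ positive_op (nu A)) /\
  (forall A : nat -> set (torusB K), (forall k, measurable (A k)) ->
     trivIset setT A ->
     (fun n => trace_norm (nu (\bigcup_k A k) - \sum_(k < n) nu (A k)))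
       @ \oo --> 0%E).

Definition norm_measure nu (A : set (torusB K)) : \bar K := trace_norm (nu A).

(* Integrals against nu are integrals of the density f against the trace-norm
   measure. *)
Definition trace_norm_density nu f : Prop :=
  forall A, measurable A ->
    is_bochner_integral (norm_measure nu) trace_norm
      (fun l => (\1_A l : K[i]) *: f l) (nu A).

Definition spectral_measure {d : measure_display} {Omega : measurableType d}
    (P : probability Omega K) (X : int -> Omega -> H) nu f : Prop :=
  [/\ trace_class_measure nu, trace_norm_density nu f &
      forall h : int, cov_op P (X h) (X 0) =
        bochner_integral (norm_measure nu) trace_norm
          (fun l => torus_exp h l *: f l)].

End operator_measures.

Section periodogram.
Context {K : realType} {H : hilbertType K}.

(* The data Y_1, ..., Y_n are the values of Y : nat -> H at 1, ..., n. *)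

Definition centered (n : nat) (Y : nat -> H) (k : nat) : H :=
  Y k - n%:R^-1 *: \sum_(1 <= j < n.+1) Y j.

Definition dft (n : nat) (Y : nat -> H) (l : torus K) : H :=
  (Num.sqrt n%:R)^-1%:C *:
    \sum_(1 <= k < n.+1) torus_exp (- k%:Z) l *: Y k.

Definition periodogram (n : nat) (Y : nat -> H) (l : torus K) : H -> H :=
  tensor (dft n Y l) (dft n Y l).

Definition sandwich {Theta : Type} (L R : Theta * torus K -> H -> H)
    (f : torus K -> H -> H) (theta : Theta) (l : torusB K) : H -> H :=
  L (theta, l) \o f l \o adjoint (R (theta, l)).

Definition Q_periodogram {Theta : Type} (L R : Theta * torus K -> H -> H)
    (n : nat) (Y : nat -> H) (theta : Theta) : H -> H :=
  bochner_integral leb_torus trace_norm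
    (sandwich L R (periodogram n (centered n Y)) theta).

Definition Q_spectral {Theta : Type} (L R : Theta * torus K -> H -> H)
    (nu : set (torusB K) -> H -> H) (f : torusB K -> H -> H)
    (theta : Theta) : H -> H :=
  bochner_integral (norm_measure nu) trace_norm (sandwich L R f theta).

End periodogram.

(* Main.v *)
(* Let P_N be the orthogonal projection onto the span of phi_0, ..., phi_(N-1),
   and Y the centered data.  Replacing Y by P_N Y in an empirical autocovariance
   n^-1 sum_k Y_(k+h) (x) Y_k moves it in trace norm by at most
   t n^-1 sum_k |Y_k|^2 + t^-1 n^-1 sum_k |Y_k - P_N Y_k|^2, for every t > 0.
   By Birkhoff's theorem these averages are asymptotically at most E|X_0|^2 and
   E|X_0 - P_N X_0|^2, and the latter tends to 0 with N because X_0 lies in the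
   closed span of phi; the finitely many matrix entries that remain converge by
   Birkhoff's theorem as well.  So, almost surely, all empirical autocovariances
   converge in trace norm to the autocovariances of X, the Fourier coefficients
   of nu_X.

   Fejer's kernel on equispaced nodes approximates L and R uniformly by operator
   valued trigonometric polynomials, for which the quadratic functional is a
   finite combination of autocovariances.  The error is uniform in n and theta:
   if |L| <= a and |R| <= b, the functional has trace norm at most
   a b n^-1 sum_k |Y_k|^2 for the periodogram (discrete Parseval identity), and
   at most a b times the mass of |nu_X|_1 for the spectral measure. *)
Require Import Defs.
From HB Require Import structures.
From mathcomp Require Import all_boot all_order all_algebra.
From mathcomp Require Import all_classical all_reals all_analysis.
From mathcomp Require Import complex.
From mathcomp Require Import measurable_realfun.
From mathcomp Require Import ring lra zify.

Set Implicit Arguments.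
Unset Strict Implicit.
Unset Printing Implicit Defensive.

Import Order.TTheory GRing.Theory Num.Theory.
Import numFieldNormedType.Exports.

Local Open Scope classical_set_scope.
Local Open Scope ring_scope.
Local Open Scope complex_scope.

(** The trace norm is defined through a chosen square root of T^H T and a chosen basis, from which
    not even the triangle inequality can be read off. The predicate [tnle] replaces it by its dual
    description, a supremum of Re tr (T W) over finite rank contractions W; polar decomposition
    shows that the two agree ([trace_normP]), and this is what square roots, Riesz representation
    and Hilbert bases are for. Bochner integrals pose another obstacle: N (f - s) need not be
    measurable, so errors are bounded by measurable majorants ([approx_integral]). The limit of the
    autocovariances is not given beforehand as a trace class operator. The entries of the truncated
    limits are deterministic, so a single good sample path shows that these truncations are Cauchy
    in trace norm; the scalar covariances then identify the limit. The modulus of continuity e + C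
    |e^{i l} - e^{i l'}|^2 is chosen for Fejer's kernel, whose product with the squared chord is at
    most a multiple of 1 / m^2. Periodogram and spectral density share the interface
    [integrable_form], so that one perturbation estimate serves both. *)

Notation normc := Normc.normc.
Notation rn := (dot_norm hdot).

(** * Complex Hilbert spaces and bounded operators *)

Section complex_facts.
Context {K : realType}.
Implicit Types a b : K[i].

Lemma ReD a b : complex.Re (a + b) = complex.Re a + complex.Re b.
Proof. by case: a; case: b. Qed.

Lemma ReN a : complex.Re (- a) = - complex.Re a.
Proof. by case: a. Qed.

Lemma ReB a b : complex.Re (a - b) = complex.Re a - complex.Re b.
Proof. by rewrite ReD ReN. Qed.

Lemma ReJ a : complex.Re (conjc a) = complex.Re a.
Proof. by case: a. Qed.

Lemma Re_sum I (r : seq I) (P : pred I) (F : I -> K[i]) :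
  complex.Re (\sum_(i <- r | P i) F i) = \sum_(i <- r | P i) complex.Re (F i).
Proof. by elim/big_rec2 : _ => //= i x y _ <-; rewrite ReD. Qed.

Lemma ReZ (c : K) a : complex.Re (c%:C * a) = c * complex.Re a.
Proof. by case: a => a b /=; rewrite mul0r subr0. Qed.

Lemma ReZJ (c : K) a : complex.Re (conjc (c%:C) * a) = c * complex.Re a.
Proof. by case: a => a b /=; rewrite oppr0 mul0r subr0. Qed.

Lemma conjcR (c : K) : conjc (c%:C) = c%:C :> K[i].
Proof. by rewrite /= oppr0. Qed.

Lemma normcE_norm a : `|a| = (normc a)%:C.
Proof. by []. Qed.

Lemma normc_ge0 a : 0 <= normc a.
Proof. by case: a => x y /=; rewrite sqrtr_ge0. Qed.

Lemma normc_sqr a : normc a ^+ 2 = complex.Re a ^+ 2 + complex.Im a ^+ 2.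
Proof. by case: a => x y /=; rewrite sqr_sqrtr// addr_ge0 ?sqr_ge0. Qed.

Lemma normc_real (c : K) : normc c%:C = `|c|.
Proof. by rewrite /= expr0n addr0 sqrtr_sqr. Qed.

Lemma Re_le_normc a : complex.Re a <= normc a.
Proof.
case: a => x y /=; apply: (le_trans (ler_norm _)); rewrite -sqrtr_sqr.
by rewrite ler_wsqrtr// lerDl sqr_ge0.
Qed.

Lemma ImRe_le_normc a : `|complex.Im a| <= normc a.
Proof.
case: a => x y /=; rewrite -sqrtr_sqr.
by rewrite ler_wsqrtr// lerDr sqr_ge0.
Qed.

Lemma absRe_le_normc a : `|complex.Re a| <= normc a.
Proof.
case: a => x y /=; rewrite -sqrtr_sqr.
by rewrite ler_wsqrtr// lerDl sqr_ge0.
Qed.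

Lemma normcJ_ a : normc (conjc a) = normc a.
Proof. by case: a => x y /=; rewrite sqrrN. Qed.

Lemma normcN a : normc (- a) = normc a.
Proof. by case: a => x y /=; rewrite !sqrrN. Qed.

Lemma normcD_le a b : normc (a + b) <= normc a + normc b.
Proof. by rewrite -lecR rmorphD/= -!normcE_norm ler_normD. Qed.

Lemma normc_le_ReIm a : normc a <= `|complex.Re a| + `|complex.Im a|.
Proof.
rewrite -(@ler_pXn2r _ 2)// ?nnegrE ?normc_ge0 ?addr_ge0//.
have := normr_ge0 (complex.Re a); have := normr_ge0 (complex.Im a).
rewrite normc_sqr -(real_normK (num_real (complex.Re a))).
by rewrite -(real_normK (num_real (complex.Im a))); nra.
Qed.

End complex_facts.

Section hilbert_basics.
Context {K : realType} {H : hilbertType K}.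
Implicit Types (x y z : H) (a b : K[i]).

Definition rdot x y : K := complex.Re (hdot x y).

Lemma hdotDl x y z : hdot (x + y) z = hdot x z + hdot y z.
Proof. by have := hdotDZl 1 x y z; rewrite scale1r mul1r. Qed.

Lemma hdot0l x : hdot 0 x = 0.
Proof. by have := hdotDl 0 0 x; rewrite addr0 -[X in X = _]addr0 => /addrI. Qed.

Lemma hdotZl a x y : hdot (a *: x) y = a * hdot x y.
Proof. by have := hdotDZl a x 0 y; rewrite addr0 hdot0l addr0. Qed.

Lemma hdotNl x y : hdot (- x) y = - hdot x y.
Proof. by rewrite -scaleN1r hdotZl mulN1r. Qed.

Lemma hdotBl x y z : hdot (x - y) z = hdot x z - hdot y z.
Proof. by rewrite hdotDl hdotNl. Qed.

Lemma hdotDr x y z : hdot z (x + y) = hdot z x + hdot z y.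
Proof. by rewrite hdotC hdotDl rmorphD/= -!hdotC. Qed.

Lemma hdot0r x : hdot x 0 = 0.
Proof. by rewrite hdotC hdot0l conjc0. Qed.

Lemma hdotZr a x y : hdot y (a *: x) = conjc a * hdot y x.
Proof. by rewrite hdotC hdotZl rmorphM/= -hdotC. Qed.

Lemma hdotNr x y : hdot x (- y) = - hdot x y.
Proof. by rewrite hdotC hdotNl rmorphN/= -hdotC. Qed.

Lemma hdotBr x y z : hdot z (x - y) = hdot z x - hdot z y.
Proof. by rewrite hdotDr hdotNr. Qed.

Lemma hdot_suml I (r : seq I) (P : pred I) (F : I -> H) y :
  hdot (\sum_(i <- r | P i) F i) y = \sum_(i <- r | P i) hdot (F i) y.
Proof. by elim/big_rec2 : _ => [|i u v _ <-]; rewrite ?hdot0l ?hdotDl. Qed.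

Lemma hdot_sumr I (r : seq I) (P : pred I) (F : I -> H) y :
  hdot y (\sum_(i <- r | P i) F i) = \sum_(i <- r | P i) hdot y (F i).
Proof. by elim/big_rec2 : _ => [|i u v _ <-]; rewrite ?hdot0r ?hdotDr. Qed.

Lemma hdot_ge0 x : 0 <= hdot x x.
Proof. by rewrite -hdot_norm exprn_ge0. Qed.

Lemma rn_ge0 x : 0 <= rn x.
Proof. exact: sqrtr_ge0. Qed.

Lemma rn_sqr x : rn x ^+ 2 = rdot x x.
Proof.
rewrite /dot_norm sqr_sqrtr//; have := hdot_ge0 x.
by rewrite lecE => /andP[].
Qed.

Lemma hdotxx x : hdot x x = (rn x ^+ 2)%:C.
Proof.
rewrite rn_sqr /rdot; have := hdot_ge0 x; move: (hdot x x) => [a b].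
by rewrite lecE /= => /andP[/eqP-> _].
Qed.

Lemma norm_rn x : `|x| = (rn x)%:C.
Proof.
apply/eqP; rewrite -(@eqrXn2 _ 2)// ?ler0c ?rn_ge0//.
by rewrite hdot_norm hdotxx rmorphXn.
Qed.

Lemma rn0 : rn (0 : H) = 0.
Proof. by apply: complexI; rewrite -norm_rn normr0. Qed.

Lemma rn_eq0 x : rn x = 0 -> x = 0.
Proof. by move=> x0; apply/eqP; rewrite -normr_eq0 norm_rn x0. Qed.

Lemma rnZ a x : rn (a *: x) = normc a * rn x.
Proof. by apply: complexI; rewrite rmorphM -norm_rn normrZ norm_rn. Qed.

Lemma rnN x : rn (- x) = rn x.
Proof. by apply: complexI; rewrite -!norm_rn normrN. Qed.

Lemma rnB x y : rn (x - y) = rn (y - x).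
Proof. by rewrite -rnN opprB. Qed.

Lemma rnD x y : rn (x + y) <= rn x + rn y.
Proof. by rewrite -lecR rmorphD/= -!norm_rn ler_normD. Qed.

Lemma rnBD x y z : rn (x - z) <= rn (x - y) + rn (y - z).
Proof.
have -> : x - z = (x - y) + (y - z) by rewrite addrA subrK.
exact: rnD.
Qed.

(* The discriminant argument for t |-> B (x + t (B x y) y, x + t (B x y) y). *)
Lemma cauchy_schwarz_form (B : H -> H -> K[i]) :
  (forall a x y z, B (a *: x + y) z = a * B x z + B y z) ->
  (forall x y, B y x = conjc (B x y)) -> (forall x, 0 <= complex.Re (B x x)) ->
  forall x y, normc (B x y) ^+ 2 <= complex.Re (B x x) * complex.Re (B y y).
Proof.
move=> Bl BC Bp x y.
have BlZ a u v : B (a *: u) v = a * B u v.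
  have := Bl 1 0 0 v; rewrite scale1r mul1r addr0 -[X in X = _]addr0 => /addrI h.
  by have := Bl a u 0 v; rewrite -h !addr0.
have BlD u v w : B (u + v) w = B u w + B v w.
  by have := Bl 1 u v w; rewrite scale1r mul1r.
have BrD u v w : B w (u + v) = B w u + B w v by rewrite BC BlD rmorphD/= -!BC.
have BrZ a u v : B v (a *: u) = conjc a * B v u by rewrite BC BlZ rmorphM/= -BC.
set c := B x y.
have e t : complex.Re (B (x + (t%:C * c) *: y) (x + (t%:C * c) *: y)) =
    complex.Re (B x x) + 2 * t * normc c ^+ 2
     + t ^+ 2 * normc c ^+ 2 * complex.Re (B y y).
  rewrite BlD !BrD !BlZ !BrZ -/c (BC x y) -/c normc_sqr.
  case: (B x x) => p p'; case: c => q q'; have := BC y y.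
  case: (B y y) => r r' [h]; have -> : r' = 0 by lra.
  by simpl; ring.
set b := normc c ^+ 2; set p := complex.Re (B x x); set d := complex.Re (B y y).
have b0 : 0 <= b by rewrite exprn_ge0 ?normc_ge0.
have d0 : 0 <= d := Bp y.
have q t : 0 <= p + 2 * t * b + t ^+ 2 * b * d by rewrite -e Bp.
have [d00|dp] := eqVneq d 0.
  have [->|bp] := eqVneq b 0; first by rewrite mulr_ge0// Bp.
  have := q (- (p + 1) / (2 * b)); rewrite d00 mulr0 addr0.
  have -> : 2 * (- (p + 1) / (2 * b)) * b = - (p + 1) by field.
  by lra.
have := q (- d^-1).
have -> : p + 2 * - d^-1 * b + (- d^-1) ^+ 2 * b * d = p - b / d by field.
rewrite subr_ge0 ler_pdivrMr//; first by rewrite lt_neqAle eq_sym dp.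
Qed.

Lemma cauchy_schwarz x y : normc (hdot x y) <= rn x * rn y.
Proof.
rewrite -(@ler_pXn2r _ 2)// ?nnegrE ?normc_ge0 ?mulr_ge0 ?rn_ge0//.
rewrite exprMn !rn_sqr; apply: cauchy_schwarz_form => //.
- by move=> a u v w; exact: hdotDZl.
- by move=> u v; exact: hdotC.
- by move=> u; rewrite -/(rdot u u) -rn_sqr exprn_ge0// rn_ge0.
Qed.

Lemma rdot_le x y : rdot x y <= rn x * rn y.
Proof. exact: le_trans (Re_le_normc _) (cauchy_schwarz x y). Qed.

Lemma rdotC x y : rdot x y = rdot y x.
Proof. by rewrite /rdot hdotC ReJ. Qed.

Lemma rn_sqrD x y : rn (x + y) ^+ 2 = rn x ^+ 2 + 2 * rdot x y + rn y ^+ 2.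
Proof.
rewrite !rn_sqr /rdot hdotDl !hdotDr !ReD -/(rdot y x) rdotC /rdot.
by ring.
Qed.

Lemma rn_sqrB x y : rn (x - y) ^+ 2 = rn x ^+ 2 - 2 * rdot x y + rn y ^+ 2.
Proof. by rewrite rn_sqrD rnN /rdot hdotNr ReN; ring. Qed.

Lemma hdot_inj x y : (forall z, hdot x z = hdot y z) -> x = y.
Proof.
move=> h; apply/subr0_eq/rn_eq0/eqP; rewrite -sqrf_eq0.
by rewrite rn_sqr /rdot hdotBl h subrr.
Qed.

Lemma hdot_injr x y : (forall z, hdot z x = hdot z y) -> x = y.
Proof. by move=> h; apply: hdot_inj => z; rewrite hdotC h -hdotC. Qed.

Lemma rn_le_dual x (c : K) : 0 <= c -> (forall y, rdot x y <= c * rn y) -> rn x <= c.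
Proof.
move=> c0 h; have [->//|x0] := eqVneq (rn x) 0.
have xp : 0 < rn x by rewrite lt_neqAle eq_sym x0 rn_ge0.
by have := h x; rewrite -rn_sqr expr2 ler_pM2r.
Qed.

Lemma rn_cauchy_cvg (x : nat -> H) :
  (forall e : K, 0 < e -> exists N, forall m n, (N <= m)%N -> (N <= n)%N ->
     rn (x m - x n) <= e) ->
  exists l, forall e : K, 0 < e -> exists N, forall n, (N <= n)%N -> rn (x n - l) <= e.
Proof.
move=> xc; have xcv : cvgn x.
  apply: cauchy_cvg; apply/cauchy_ballP => e; rewrite ltcE => /andP[/eqP/= ei er].
  have [N hN] := xc (complex.Re e / 2) (divr_gt0 er (ltr0Sn _ 1)).
  exists (x @` [set n | (N <= n)%N], x @` [set n | (N <= n)%N]).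
    by split; exists N => // n Nn; exists n.
  move=> [_ _] [[m/= Nm <-] [n/= Nn <-]]/=.
  rewrite -ball_normE /= norm_rn ltcE /= ei eqxx /=.
  by rewrite (le_lt_trans (hN _ _ Nm Nn))// ltr_pdivrMr// ltr_pMr// ltrDl.
exists (limn x) => e e0; have eC : 0 < e%:C :> K[i] by rewrite ltcR.
have := xcv => /cvgrPdist_le/(_ _ eC)[N _ hN].
exists N => n Nn; have := hN n Nn; rewrite /= norm_rn lecR rnB.
exact.
Qed.

End hilbert_basics.
Section limits.
Context {K : realType} {H : hilbertType K}.
Implicit Types (x y z : H) (a b : K[i]) (u v : nat -> H).

Lemma squeeze0 (f g : nat -> K) :
  (forall n, 0 <= f n) -> (\forall n \near \oo, f n <= g n) ->
  g @ \oo --> 0 -> f @ \oo --> 0.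
Proof.
move=> f0 fg g0; apply: (@squeeze_cvgr _ _ _ _ (cst 0) g) => //.
- by near=> n; rewrite f0 /=; near: n; exact: fg.
- exact: cvg_cst.
Unshelve. all: by end_near. Qed.

Lemma cvg_sum_seq I (r : seq I) (F : I -> nat -> K) (l : I -> K) :
  (forall i, F i @ \oo --> l i) ->
  (fun n => \sum_(i <- r) F i n) @ \oo --> \sum_(i <- r) l i.
Proof.
move=> h; elim: r => [|i r IH].
  by rewrite big_nil; under eq_fun do rewrite big_nil; exact: cvg_cst.
by rewrite big_cons; under eq_fun do rewrite big_cons; exact: cvgD.
Qed.

(** Norm convergence stated for the real number [rn], since the norm of a complex normed module
    takes its values in K[i]. *)
Definition rcvg u x := (fun n => rn (u n - x)) @ \oo --> (0 : K).

Lemma rcvg_le u x (g : nat -> K) :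
  (forall n, rn (u n - x) <= g n) -> g @ \oo --> 0 -> rcvg u x.
Proof. by move=> h; apply: squeeze0 => [n|]; [exact: rn_ge0|exact: nearW]. Qed.

Lemma rcvg_uniq u x y : rcvg u x -> rcvg u y -> x = y.
Proof.
move=> ux uy; apply/subr0_eq/rn_eq0.
suff : (fun=> rn (x - y)) @ \oo --> (0 : K).
  by move=> h; apply: (cvg_unique _ (cvg_cst (rn (x - y))) h).
apply: (@squeeze0 _ (fun n => rn (u n - x) + rn (u n - y))).
- by move=> n; exact: rn_ge0.
- by apply: nearW => n; rewrite (rnB (u n)) rnBD.
- by rewrite -[X in _ --> X]addr0; exact: cvgD.
Qed.

Lemma rcvg_cst x : rcvg (fun=> x) x.
Proof. by apply: (@rcvg_le _ _ (fun=> 0)) => [n|]; [rewrite subrr rn0|exact: cvg_cst]. Qed.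

Lemma rcvgDZ a u v x y : rcvg u x -> rcvg v y ->
  rcvg (fun n => a *: u n + v n) (a *: x + y).
Proof.
move=> ux vy; apply: (@rcvg_le _ _ (fun n => normc a * rn (u n - x) + rn (v n - y))).
  by move=> n; rewrite opprD addrACA -scalerBr (le_trans (rnD _ _))// rnZ.
rewrite -[X in _ --> X]addr0; apply: cvgD => //.
by rewrite -[X in _ --> X](mulr0 (normc a)); apply: cvgMr.
Qed.

Lemma rcvg_rdot u x y : rcvg u x -> (fun n => rdot (u n) y) @ \oo --> rdot x y.
Proof.
move=> ux; apply/cvgrPdist_lt => e e0.
suff : (fun n => rn (u n - x) * rn y) @ \oo --> 0.
  move=> /cvgrPdist_lt /(_ _ e0); apply: filterS => n /=.
  rewrite sub0r normrN => /(le_lt_trans _); apply; rewrite -ReB -hdotBl.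
  rewrite (le_trans (absRe_le_normc _))// (le_trans (cauchy_schwarz _ _))// rnB.
  exact: ler_norm.
by rewrite -[X in _ --> X](mul0r (rn y)); apply: cvgMl.
Qed.

(** Since <x, i y> = - i <x, y>, real parts determine the inner product, and limits need checking
    only for [rdot]. *)
Lemma hdotE x y : hdot x y = rdot x y +i* rdot x ('i *: y).
Proof.
rewrite /rdot hdotZr; case: (hdot x y) => p q /=.
by rewrite mul0r mulN1r opprK add0r.
Qed.

Lemma rcvg_bnd u x (c : K) : (forall n, rn (u n) <= c) -> rcvg u x -> rn x <= c.
Proof.
move=> uc ux; apply/ler_addgt0Pr => e e0.
move/cvgrPdist_lt : ux => /(_ _ e0)[N _ /(_ N (leqnn N))]/=.
rewrite sub0r normrN ger0_norm ?rn_ge0// => /ltW h.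
rewrite -[x](subrK (u N)) (le_trans (rnD _ _))// addrC lerD//.
by rewrite rnB.
Qed.

Lemma rn_cauchy_rcvg u (g : nat -> K) :
  (forall m n, (m <= n)%N -> rn (u n - u m) <= g m) -> g @ \oo --> 0 ->
  exists x, rcvg u x /\ forall n, rn (u n - x) <= g n.
Proof.
move=> ug g0; have [e e0|x hx] := @rn_cauchy_cvg _ _ u.
  have e20 : 0 < e / 2 by rewrite divr_gt0.
  move/cvgrPdist_lt : g0 => /(_ _ e20)[N _ hN].
  have {}hN : g N <= e / 2.
    by have := hN N (leqnn N); rewrite /= sub0r normrN => /ltW; apply: le_trans (ler_norm _).
  exists N => m n Nm Nn; rewrite (le_trans (rnBD _ (u N) _))//.
  by rewrite [e]splitr lerD// ?[rn (u N - _)]rnB (le_trans (ug _ _ _)).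
have ux : rcvg u x.
  apply/cvgrPdist_le => e e0; have [N hN] := hx _ e0.
  by exists N => // n /= Nn; rewrite sub0r normrN ger0_norm ?rn_ge0// hN.
exists x; split=> // n; rewrite rnB.
apply: (@rcvg_bnd (fun k => u (n + k)%N - u n)).
  by move=> k; exact: ug (leq_addr _ _).
apply/cvgrPdist_le => e e0; have [N hN] := hx _ e0.
exists N => // k /= Nk; rewrite sub0r normrN ger0_norm ?rn_ge0//.
by rewrite opprB addrA subrK hN// (leq_trans Nk)// leq_addl.
Qed.

End limits.

(** * Bounded operators with explicit constants *)

Section bounded_operators.
Context {K : realType} {H : hilbertType K}.
Implicit Types (x y z : H) (a b : K[i]) (S T : H -> H) (c : K).

Definition lin T := forall a x y, T (a *: x + y) = a *: T x + T y.
Definition bnd T c := lin T /\ forall x, rn (T x) <= c * rn x.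

Lemma lin0 T : lin T -> T 0 = 0.
Proof. by move=> /(_ (-1) 0 0); rewrite scaler0 addr0 scaleN1r addNr. Qed.
Lemma linD T x y : lin T -> T (x + y) = T x + T y.
Proof. by move=> /(_ 1 x y); rewrite !scale1r. Qed.
Lemma linZ T a x : lin T -> T (a *: x) = a *: T x.
Proof. by move=> l; have := l a x 0; rewrite (lin0 l) !addr0. Qed.
Lemma linN T x : lin T -> T (- x) = - T x.
Proof. by move=> l; rewrite -scaleN1r (linZ _ _ l) scaleN1r. Qed.
Lemma linB T x y : lin T -> T (x - y) = T x - T y.
Proof. by move=> l; rewrite (linD _ _ l) (linN _ l). Qed.
Lemma lin_sum T I (r : seq I) (P : pred I) (F : I -> H) : lin T ->
  T (\sum_(i <- r | P i) F i) = \sum_(i <- r | P i) T (F i).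
Proof. by move=> l; elim/big_rec2 : _ => [|i u v _ <-]; rewrite ?(lin0 l) ?(linD _ _ l). Qed.

Lemma opnorm_le T c : 0 <= c -> (opnorm T <= c%:E)%E <-> bnd T c.
Proof.
move=> c0; rewrite /opnorm /opnorm_on; case: asboolP => [[Tl _]|Tl]; last first.
  split=> // -[l _]; exfalso; apply: Tl; split=> // a x y _ _; exact: l.
split=> [h|[_ h]]; last first.
  apply: ge_ereal_sup => _ /= [x [_ x1] <-]; rewrite lee_fin (le_trans (h _))//.
  by rewrite ler_piMr.
have l : lin T by move=> a x y; exact: Tl.
split=> // x; have [x0|x0] := eqVneq (rn x) 0.
  by rewrite (rn_eq0 x0) (lin0 l) rn0 mulr0.
have xp : 0 < rn x by rewrite lt_neqAle eq_sym x0 rn_ge0.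
have nx : normc ((rn x)^-1%:C) = (rn x)^-1.
  by rewrite normc_real ger0_norm// invr_ge0 rn_ge0.
have : ((rn (T ((rn x)^-1%:C *: x)))%:E <= c%:E)%E.
  apply: le_trans h; apply: ereal_sup_ubound; exists ((rn x)^-1%:C *: x) => //.
  by split=> //; rewrite rnZ nx mulVf.
by rewrite lee_fin (linZ _ _ l) rnZ nx mulrC ler_pdivrMr.
Qed.

Lemma opnorm_ge0 T : (0 <= opnorm T)%E.
Proof.
rewrite /opnorm /opnorm_on; case: asboolP => // _.
apply: (@le_trans _ _ (rn (T 0))%:E); first by rewrite lee_fin rn_ge0.
by apply: ereal_sup_ubound; exists 0 => //; split=> //; rewrite rn0.
Qed.

Lemma opnorm_lt T c : (opnorm T < c%:E)%E -> 0 <= c /\ bnd T c.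
Proof.
move=> h; have c0 : 0 <= c by rewrite -lee_fin (le_trans (opnorm_ge0 T))// ltW.
by split=> //; apply/opnorm_le => //; exact: ltW.
Qed.

Lemma bounded_opP T : bounded_op T <-> exists2 c, 0 <= c & bnd T c.
Proof.
split=> [h|[c c0 /opnorm_le h]]; last by rewrite /bounded_op (le_lt_trans (h c0))// ltry.
have f : opnorm T \is a fin_num by rewrite ge0_fin_numE// opnorm_ge0.
exists (fine (opnorm T)); first by rewrite fine_ge0// opnorm_ge0.
by apply/opnorm_le; rewrite ?fine_ge0 ?opnorm_ge0// fineK.
Qed.

Lemma bnd_le T c c' : bnd T c -> c <= c' -> bnd T c'.
Proof.
by move=> [l h] cc; split=> // x; rewrite (le_trans (h x))// ler_wpM2r// rn_ge0.
Qed.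

Lemma bnd_comp S T c c' : 0 <= c -> bnd S c -> bnd T c' -> bnd (S \o T) (c * c').
Proof.
move=> c0 [lS hS] [lT hT]; split=> [a x y|x] /=; first by rewrite lT lS.
by rewrite (le_trans (hS _))// -mulrA ler_wpM2l.
Qed.

Lemma bndDZ S T a c c' : bnd S c -> bnd T c' ->
  bnd (fun x => a *: S x + T x) (normc a * c + c').
Proof.
move=> [lS hS] [lT hT]; split=> [b x y|x].
  rewrite lS lT !scalerDr !scalerA [a * b]mulrC -!addrA; congr (_ + _).
  by rewrite addrCA.
rewrite (le_trans (rnD _ _))// mulrDl lerD// rnZ -mulrA.
by rewrite ler_wpM2l// normc_ge0.
Qed.

Lemma bnd_id : bnd (fun x => x) 1.
Proof. by split=> // x; rewrite mul1r. Qed.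

(** The Cauchy rate is relative to |x|, so pointwise limits exist by completeness; linearity and the
    bound c pass to them. *)
Lemma op_limit (Tn : nat -> H -> H) c (g : nat -> K) :
  (forall n, bnd (Tn n) c) -> g @ \oo --> 0 ->
  (forall m n x, (m <= n)%N -> rn (Tn n x - Tn m x) <= g m * rn x) ->
  exists T, bnd T c /\ forall x, rcvg (Tn ^~ x) (T x).
Proof.
move=> Tc g0 Tg.
have /choice[T hT] : forall x, exists y, rcvg (Tn ^~ x) y.
  move=> x; have [||y [h _]] := @rn_cauchy_rcvg _ _ (Tn ^~ x) (fun m => g m * rn x).
  - by move=> m n mn; exact: Tg.
  - by rewrite -[X in _ --> X](mul0r (rn x)); exact: cvgMl.
  - by exists y.
exists T; split=> //; split=> [a x y|x].
  apply: rcvg_uniq (hT _) _.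
  by under [X in rcvg X]eq_fun do rewrite (Tc _).1; exact: rcvgDZ.
by apply: rcvg_bnd (hT x) => n; exact: (Tc n).2.
Qed.

End bounded_operators.

(** * Riesz representation, adjoints and positive operators *)

Section riesz.
Context {K : realType} {H : hilbertType K}.
Implicit Types (x y z : H) (a b : K[i]) (S T : H -> H) (c : K).

(* For S = id this is the Riesz representation theorem.  The general form also
   provides the partial isometry of a polar decomposition: a functional
   dominated by |S x| factors through S.  Minimise |S x|^2 - 2 Re (phi x). *)
Lemma riesz_range (D : set H) S (phi : H -> K[i]) c : lin S -> D 0 ->
  (forall a x y, D x -> D y -> D (a *: x + y)) ->
  (forall a x y, D x -> D y -> phi (a *: x + y) = a * phi x + phi y) -> 0 <= c ->
  (forall x, D x -> normc (phi x) <= c * rn (S x)) ->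
  exists w, [/\ forall x, D x -> phi x = hdot (S x) w, rn w <= c &
    exists u : nat -> H, (forall n, D (u n)) /\ rcvg (S \o u) w].
Proof.
move=> Sl D0 Dl phil c0 phic.
have DZ a x : D x -> D (a *: x) by move=> Dx; rewrite -[a *: x]addr0; exact: Dl.
have DD x y : D x -> D y -> D (x + y) by move=> Dx; rewrite -[x]scale1r; exact: Dl.
have phiZ a x : D x -> phi (a *: x) = a * phi x.
  move=> Dx; have p0 : phi 0 = 0.
    by have := phil (-1) 0 0 D0 D0; rewrite scaler0 addr0 mulN1r addNr.
  by have := phil a x 0 Dx D0; rewrite p0 !addr0.
have phiD x y : D x -> D y -> phi (x + y) = phi x + phi y.
  by move=> Dx Dy; have := phil 1 x y Dx Dy; rewrite scale1r mul1r.
(* Here r' - 2 v' stands for J (u n), m for the infimum of J, i for 1/(n+1), and r, v, qq for the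
   terms created by adding t z to u n. *)
have aux (r' r v v' m i qq t : K) : r' - 2 * v' <= m + i ->
    m <= r' + 2 * (t * r) + qq - 2 * (v' + t * v) ->
    0 <= i + 2 * t * (r - v) + qq by move=> *; nra.
pose f x := complex.Re (phi x).
have fD x y : D x -> D y -> f (x + y) = f x + f y.
  by move=> Dx Dy; rewrite /f phiD// ReD.
have fZ (t : K) x : D x -> f (t%:C *: x) = t * f x.
  by move=> Dx; rewrite /f phiZ// ReZ.
pose J x := rn (S x) ^+ 2 - 2 * f x.
have Jlb x : D x -> - c ^+ 2 <= J x.
  move=> Dx.
  have := sqr_ge0 (rn (S x) - c); have := phic x Dx; have := Re_le_normc (phi x).
  by rewrite /J -/(f x); nra.
have Jinf : has_inf (J @` D).
  by split; [exists (J 0), 0 | exists (- c ^+ 2) => _ [x Dx <-]; exact: Jlb].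
pose m := inf (J @` D).
have mJ x : D x -> m <= J x by move=> Dx; apply: ge_inf; [case: Jinf|exists x].
have /choice[u hu] : forall n : nat, exists x, D x /\ J x <= m + n.+1%:R^-1.
  move=> n; have n0 : 0 < n.+1%:R^-1 :> K by rewrite invr_gt0.
  have [_ [x Dx <-] h] := inf_adherent n0 Jinf.
  by exists x; split=> //; exact: ltW.
(* The parallelogram law for J: two points within 1/(k+1) of the infimum have a midpoint not below
   it, so their images under S are at distance at most 2 / sqrt (k+1). *)
have par x y : D x -> D y -> rn (S x - S y) ^+ 2 = 2 * J x + 2 * J y
     - 4 * J ((2^-1)%:C *: (x + y)).
  move=> Dx Dy.
  rewrite /J (linZ _ _ Sl) rnZ normc_real ger0_norm ?invr_ge0 ?ler0n//.
  rewrite fZ; last exact: DD.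
  rewrite fD// (linD _ _ Sl) exprMn rn_sqrB rn_sqrD.
  by field.
have inv0 : (fun n => n.+1%:R^-1 : K) @ \oo --> (0 : K) by exact: cvg_harmonic.
have ucau k n : (k <= n)%N -> rn (S (u n) - S (u k)) <= 2 * Num.sqrt (k.+1%:R^-1).
  move=> kn; rewrite -(@ler_pXn2r _ 2)// ?nnegrE ?rn_ge0 ?mulr_ge0 ?sqrtr_ge0//.
  have [Dn Jn] := hu n; have [Dk Jk] := hu k.
  rewrite exprMn (@sqr_sqrtr _ k.+1%:R^-1) ?invr_ge0// par//.
  have := mJ _ (DZ (2^-1)%:C _ (DD _ _ Dn Dk)); move: Jn Jk.
  have : n.+1%:R^-1 <= k.+1%:R^-1 :> K by rewrite lef_pV2 ?posrE ?ltr0n// ler_nat.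
  move: n.+1%:R^-1 k.+1%:R^-1 (J (u n)) (J (u k)) (J _) => p q r r' r''.
  by rewrite expr2; lra.
have [||w [wl _]] := @rn_cauchy_rcvg _ _ (S \o u) (fun k => 2 * Num.sqrt (k.+1%:R^-1)).
- by move=> k n kn; exact: ucau.
- rewrite -[X in _ --> X](mulr0 2); apply: cvgMr.
  rewrite -[X in _ --> X]sqrtr0; apply: (continuous_cvg _ _ inv0).
  exact: sqrt_continuous.
have fw z : D z -> f z = rdot (S z) w.
  move=> Dz; pose p := rdot (S z) w - f z; pose q := rn (S z) ^+ 2.
  have h (t : K) : 0 <= 2 * t * p + t ^+ 2 * q.
    have lim : (fun n => n.+1%:R^-1 + 2 * t * (rdot (S (u n)) (S z) - f z)
         + t ^+ 2 * q) @ \oo --> 0 + 2 * t * (rdot w (S z) - f z) + t ^+ 2 * q.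
      apply: cvgD; last exact: cvg_cst.
      apply: cvgD => //; apply: cvgMr; apply: cvgB; last exact: cvg_cst.
      exact: rcvg_rdot.
    have := lim; rewrite add0r rdotC -/p => {}lim.
    rewrite -(cvg_lim _ lim)//; apply: limr_ge; first by apply/cvg_ex; eexists; exact: lim.
    apply: nearW => n; have [Dn] := hu n.
    have := mJ _ (DD _ _ Dn (DZ t%:C _ Dz)).
    rewrite /J fD ?fZ//; last exact: DZ.
    rewrite (linD _ _ Sl) (linZ _ _ Sl) rn_sqrD rnZ normc_real exprMn.
    rewrite real_normK ?num_real// -/q /rdot hdotZr ReZJ.
    by move=> h1 h2; exact: aux h2 h1.
  suff : p = 0 by rewrite /p; lra.
  have q0 : 0 <= q := sqr_ge0 _.
  (* The quadratic 2 t p + t^2 q is nonnegative for all t; the value t = - p / (q + 1) forces p = 0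
     also when q = 0. *)
  have := h (- p / (q + 1)).
  have -> : 2 * (- p / (q + 1)) * p + (- p / (q + 1)) ^+ 2 * q =
      - (p ^+ 2 * ((q + 2) / (q + 1) ^+ 2)) by field; lra.
  rewrite oppr_ge0 pmulr_lle0 ?divr_gt0 ?exprn_gt0 //; [|lra|lra].
  by move=> p2; apply/eqP; rewrite -sqrf_eq0 eq_le p2 sqr_ge0.
(* The identity of real parts at - i x gives the imaginary parts at x. *)
have pw x : D x -> phi x = hdot (S x) w.
  move=> Dx; have e := fw x Dx; have := fw (- 'i *: x) (DZ _ _ Dx).
  rewrite /f /rdot phiZ// (linZ _ _ Sl) hdotZl => e'; move: e e'; rewrite /f /rdot.
  case: (phi x) => p q; case: (hdot (S x) w) => p' q' /= -> e'.
  by congr (_ +i* _); move: e'; rewrite !oppr0 !mul0r !sub0r; lra.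
exists w; split=> //; last by exists u; split=> // n; case: (hu n).
apply/ler_addgt0Pr => e e0.
have [w0|w0] := eqVneq (rn w) 0; first by rewrite w0; lra.
have wp : 0 < rn w by rewrite lt_neqAle eq_sym w0 rn_ge0.
have := @rcvg_rdot _ _ _ _ w wl; rewrite -rn_sqr => lim.
have lim2 : (fun n => c * (rn (S (u n) - w) + rn w)) @ \oo --> c * (0 + rn w).
  by apply: cvgMr; apply: cvgD => //; exact: cvg_cst.
have := ler_cvg_to lim lim2; rewrite add0r expr2 ler_pM2r// => h.
apply: (@le_trans _ _ c); last by lra.
apply: h; apply: nearW => n; have [Dn _] := hu n; rewrite /= -fw//.
rewrite (le_trans (Re_le_normc _))// (le_trans (phic _ Dn))// ler_wpM2l//.
by rewrite -{1}(subrK w (S (u n))) rnD.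
Qed.

Lemma adjoint_exists T c : bnd T c ->
  exists S, forall x y, hdot (T x) y = hdot x (S y).
Proof.
move=> [Tl Tc].
suff /choice[S hS] : forall y, exists w, forall x, hdot (T x) y = hdot x w.
  by exists S => x y.
move=> y; have [//|//|//||||w [h _ _]] :=
    @riesz_range setT id (fun x => hdot (T x) y) (`|c| * rn y).
- by move=> a u v _ _; rewrite Tl hdotDZl.
- by rewrite mulr_ge0 ?rn_ge0.
- move=> x _; rewrite (le_trans (cauchy_schwarz _ _))// mulrAC ler_wpM2r ?rn_ge0//.
  by rewrite (le_trans (Tc _))// ler_wpM2r ?rn_ge0// ler_norm.
- by exists w => x; exact: h.
Qed.

Lemma adjointP T c : bnd T c -> forall x y, hdot (T x) y = hdot x (adjoint T y).
Proof. by move=> /adjoint_exists; exact: xgetPex. Qed.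

Lemma adjointPr T c : bnd T c -> forall x y, hdot (adjoint T x) y = hdot x (T y).
Proof. by move=> Tc x y; rewrite hdotC -(adjointP Tc) -hdotC. Qed.

Lemma adjoint_uniq T S c : bnd T c ->
  (forall x y, hdot (T x) y = hdot x (S y)) -> adjoint T = S.
Proof.
move=> Tc h; apply/funext => y; apply: hdot_injr => x.
by rewrite -(adjointP Tc) h.
Qed.

Lemma bnd_adjoint T c : 0 <= c -> bnd T c -> bnd (adjoint T) c.
Proof.
move=> c0 Tc; split=> [a x y|x].
  apply: hdot_injr => z.
  by rewrite -(adjointP Tc) !hdotDr !hdotZr -!(adjointP Tc).
apply: rn_le_dual => [|y]; first by rewrite mulr_ge0 ?rn_ge0.
rewrite /rdot (adjointPr Tc) (le_trans (rdot_le _ _))//.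
by rewrite -mulrA mulrCA ler_wpM2l ?rn_ge0// Tc.2.
Qed.

Definition selfadj T := forall x y, hdot (T x) y = hdot x (T y).

Lemma selfadj_adjoint T c : bnd T c -> selfadj T -> adjoint T = T.
Proof. by move=> Tc Ts; exact: adjoint_uniq Tc _. Qed.

(** Positivity makes <T x, x> real; polarising at x + y and at i x + y turns this into symmetry. *)
Lemma positive_selfadj T : lin T -> positive_op T -> selfadj T.
Proof.
move=> Tl Tp.
have r x : complex.Im (hdot (T x) x) = 0 by have := Tp x; rewrite lecE => /andP[/eqP].
have s x y : complex.Im (hdot (T x) y) = - complex.Im (hdot (T y) x).
  have := r (x + y); rewrite (linD _ _ Tl) hdotDl !hdotDr.
  have := r x; have := r y.
  case: (hdot (T x) x) => ? ?; case: (hdot (T y) y) => ? ?.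
  by case: (hdot (T x) y) => ? ?; case: (hdot (T y) x) => ? ? /=; lra.
move=> x y; rewrite (hdotC (T y) x).
have := s x y; have := s ('i *: x) y; rewrite (linZ _ _ Tl) hdotZl hdotZr.
case: (hdot (T x) y) => ? ?; case: (hdot (T y) x) => ? ? /=.
by move=> ? ?; congr (_ +i* _); lra.
Qed.

Lemma positive_cauchy_schwarz T : lin T -> positive_op T ->
  forall x y, normc (hdot (T x) y) ^+ 2 <= rdot (T x) x * rdot (T y) y.
Proof.
move=> Tl Tp; apply: cauchy_schwarz_form.
- by move=> a x y z; rewrite Tl hdotDZl.
- by move=> x y; rewrite (positive_selfadj Tl Tp) hdotC.
- by move=> x; have := Tp x; rewrite lecE => /andP[].
Qed.

End riesz.

(** * Square roots of positive operators *)

Section square_root.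
Context {K : realType} {H : hilbertType K}.
Implicit Types (x y z : H) (a b : K[i]) (S T : H -> H) (c : K).

Lemma rcvg_shift (u : nat -> H) x : rcvg u x -> rcvg (fun n => u n.+1) x.
Proof. by rewrite /rcvg => h; rewrite (@cvg_shiftS _ (fun n => rn (u n - x))). Qed.

Fixpoint root_bound n : K :=
  if n is m.+1 then (1 + root_bound m ^+ 2) / 2 else 0.

Lemma root_bound01 n : 0 <= root_bound n <= 1.
Proof. by elim: n => /= [|n /andP[h1 h2]]; rewrite ?lexx ?ler01//; nra. Qed.

Lemma root_boundS n : root_bound n <= root_bound n.+1.
Proof. by have /andP[] := root_bound01 n; move=> /=; nra. Qed.

Variable B : H -> H.
Hypothesis B1 : bnd B 1.
Hypothesis Bs : selfadj B.

(* The iteration for 1 - sqrt (1 - t) = sup_n p_n, p_{n+1} = (t + p_n^2) / 2: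
   differences of the iterates at B are dominated by those at t = 1. *)
Fixpoint root_iter n x : H :=
  if n is m.+1 then (2^-1)%:C *: (B x + root_iter m (root_iter m x)) else 0.

Lemma root_iterE n x :
  root_iter n.+1 x = (2^-1)%:C *: (B x + root_iter n (root_iter n x)).
Proof. by []. Qed.

Lemma bnd_root_iter n : bnd (root_iter n) (root_bound n).
Proof.
elim: n => [|n [IHl IHb]] /=.
  by split=> [a x y|x]; rewrite ?scaler0 ?addr0 ?rn0 ?mul0r.
have [Bl Bb] := B1; split=> [a x y|x].
  by rewrite Bl !IHl addrACA -scalerDr !scalerDr !scalerA [_ * a]mulrC.
rewrite rnZ normc_real ger0_norm ?invr_ge0// mulrC mulrAC ler_wpM2r ?invr_ge0//.
rewrite mulrDl (le_trans (rnD _ _))// lerD// (le_trans (IHb _))// expr2 -mulrA.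
by rewrite ler_wpM2l//; case/andP: (root_bound01 n).
Qed.

Lemma selfadj_root_iter n : selfadj (root_iter n).
Proof.
elim: n => [|n IH] x y; first by rewrite hdot0l hdot0r.
rewrite !root_iterE hdotZl hdotZr. rewrite conjcR hdotDl hdotDr Bs; congr (_ * (_ + _)).
by rewrite !IH.
Qed.

(** With p_n the n-th iterate, p_{n+1}^2 - p_n^2 = p_{n+1} (p_{n+1} - p_n) + (p_{n+1} - p_n) p_n
    holds without commutation, and the same factorisation for [root_bound] closes the induction. *)
Lemma root_iterS n x :
  rn (root_iter n.+1 x - root_iter n x) <= (root_bound n.+1 - root_bound n) * rn x.
Proof.
elim: n x => [|n IH] x.
  rewrite /= !addr0 !subr0 expr0n addr0 rnZ normc_real ger0_norm ?invr_ge0//.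
  by rewrite mul1r ler_wpM2l ?invr_ge0// -[leRHS]mul1r B1.2.
have [l1 b1] := bnd_root_iter n.+1; have [l0 b0] := bnd_root_iter n.
have -> : root_iter n.+2 x - root_iter n.+1 x = (2^-1)%:C *:
   (root_iter n.+1 (root_iter n.+1 x - root_iter n x) +
    (root_iter n.+1 (root_iter n x) - root_iter n (root_iter n x))).
  rewrite (linB _ _ l1) addrA subrK.
  rewrite [root_iter n.+2 x]/= -/(root_iter n.+1).
  rewrite [X in _ - X]/= -scalerBr opprD addrACA subrr add0r.
  by [].
have /andP[h1 _] := root_bound01 n.+1.
have hh := root_boundS n.
rewrite rnZ normc_real ger0_norm ?invr_ge0//.
have i1 := le_trans (b1 (root_iter n.+1 x - root_iter n x)) (ler_wpM2l h1 (IH x)).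
have d0 : 0 <= root_bound n.+1 - root_bound n by rewrite subr_ge0.
have i2 := le_trans (IH (root_iter n x)) (ler_wpM2l d0 (b0 x)).
have e : root_bound n.+2 - root_bound n.+1 =
   2^-1 * ((root_bound n.+1 - root_bound n) * (root_bound n.+1 + root_bound n)).
  by rewrite [root_bound n.+2]/= -/(root_bound n.+1) {2}[root_bound n.+1]/=; field.
rewrite e -mulrA ler_wpM2l ?invr_ge0// (le_trans (rnD _ _))//.
rewrite (le_trans (lerD i1 i2))//.
by move: (root_bound n.+1) (root_bound n) (rn x) => p q r; nra.
Qed.

Lemma root_iter_le m n x : (m <= n)%N ->
  rn (root_iter n x - root_iter m x) <= (root_bound n - root_bound m) * rn x.
Proof.
elim: n => [|n IH]; first by rewrite leqn0 => /eqP->; rewrite !subrr rn0 mul0r.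
rewrite leq_eqVlt ltnS => /orP[/eqP->|/IH h]; first by rewrite !subrr rn0 mul0r.
rewrite (le_trans (rnBD _ (root_iter n x) _))//.
rewrite (le_trans (lerD (root_iterS n x) h))//.
by rewrite -mulrDl addrA subrK.
Qed.

(** Y is 1 - sqrt (1 - B): the equation reads (1 - Y)^2 = 1 - B. The rate of convergence is the
    remaining increase of the bounded monotone sequence [root_bound]. *)
Lemma root_fixpoint : exists Y, [/\ bnd Y 1, selfadj Y &
  forall x, Y x = (2^-1)%:C *: (B x + Y (Y x))].
Proof.
have cv : cvgn root_bound.
  apply: nondecreasing_is_cvgn; first exact/nondecreasing_seqP/root_boundS.
  by exists 1 => _ [n _ <-]; case/andP: (root_bound01 n).
have b1 n : bnd (root_iter n) 1.
  by apply: bnd_le (bnd_root_iter n) _; case/andP: (root_bound01 n).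
have bl n : root_bound n <= limn root_bound.
  by apply: nondecreasing_cvgn_le => //; exact/nondecreasing_seqP/root_boundS.
have [||Y [Y1 Yl]] := @op_limit _ _ root_iter 1 (fun m => limn root_bound - root_bound m) b1.
- rewrite -[X in _ --> X](subrr (limn root_bound)); apply: cvgB => //; exact: cvg_cst.
- move=> m n x mn; rewrite (le_trans (root_iter_le _ mn))// ler_wpM2r ?rn_ge0//.
  by rewrite lerB.
have Ys : selfadj Y.
  have r x y : rdot (Y x) y = rdot x (Y y).
    have h1 := @rcvg_rdot _ _ _ _ y (Yl x).
    have h2 : (fun n => rdot (root_iter n x) y) @ \oo --> rdot x (Y y).
      rewrite rdotC; have := @rcvg_rdot _ _ _ _ x (Yl y); apply: cvg_trans.
      apply: near_eq_cvg; apply: nearW => n.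
      by rewrite rdotC /rdot -selfadj_root_iter.
    exact: (cvg_unique _ h1 h2).
  move=> x y; rewrite hdotE [RHS]hdotE !r (linZ _ _ Y1.1) //.
exists Y; split=> // x; apply: rcvg_uniq (rcvg_shift (Yl x)) _ => /=.
have hYY : rcvg (fun n => root_iter n (root_iter n x)) (Y (Y x)).
  apply: (@rcvg_le _ _ _ _ (fun n => rn (root_iter n x - Y x) +
      rn (root_iter n (Y x) - Y (Y x)))).
    move=> n; rewrite (le_trans (rnBD _ (root_iter n (Y x)) _))// lerD2r.
    by rewrite -(linB _ _ (b1 n).1) (le_trans ((b1 n).2 _))// mul1r.
  by rewrite -[X in _ --> X]addr0; apply: cvgD; exact: Yl.
have := rcvgDZ (2^-1)%:C hYY (rcvg_cst ((2^-1)%:C *: B x)).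
by under [X in rcvg X]eq_fun do rewrite -scalerDr addrC; rewrite -scalerDr addrC.
Qed.

End square_root.

Section positive_operators.
Context {K : realType} {H : hilbertType K}.
Implicit Types (x y z : H) (a b : K[i]) (S T : H -> H) (c : K).

(** Cauchy-Schwarz for the form <A x, y> at x and A x gives |A x|^4 <= <A x, x> <A (A x), A x>, and
    the last factor is at most c |A x|^2. *)
Lemma positive_sqr_le A c x : 0 <= c -> bnd A c -> positive_op A ->
  rn (A x) ^+ 2 <= c * rdot (A x) x.
Proof.
move=> c0 [Al Ac] Ap; have := positive_cauchy_schwarz Al Ap x (A x).
have p0 : 0 <= rdot (A x) x by have := Ap x; rewrite lecE => /andP[].
rewrite hdotxx normc_real ger0_norm ?sqr_ge0// => h.
have := le_trans h (ler_wpM2l p0 (le_trans (rdot_le _ _) (ler_wpM2r (rn_ge0 _) (Ac _)))).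
have [->|n0] := eqVneq (rn (A x)) 0; first by rewrite expr0n /= mulr_ge0.
have np : 0 < rn (A x) ^+ 2 by rewrite exprn_even_gt0.
by rewrite -mulrA -expr2 mulrA [_ ^+ 2 ^+ 2]expr2 ler_pM2r// mulrC.
Qed.

(** With d = c + 1, positive even for c = 0, B = 1 - A / d has norm at most 1 by [positive_sqr_le],
    and sqrt d (1 - Y) squares to d (1 - B) = A. It is positive because Y is self-adjoint of norm at
    most 1. *)
Lemma positive_sqrt A c : 0 <= c -> bnd A c -> positive_op A ->
  exists Q c', [/\ 0 <= c', bnd Q c', positive_op Q & forall x, Q (Q x) = A x].
Proof.
move=> c0 Ac Ap; have [Al Ab] := Ac.
have As := positive_selfadj Al Ap.
pose d := c + 1; have d0 : 0 < d by rewrite ltr_wpDl.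
have dn0 : d != 0 by rewrite gt_eqF.
pose B x := - (d^-1)%:C *: A x + x.
have Bl : lin B.
  move=> a x y; rewrite /B Al !scalerDr !scalerA [_ * a]mulrC -!addrA; congr (_ + _).
  by rewrite addrCA.
have B1 : bnd B 1.
  split=> // x; rewrite mul1r -(@ler_pXn2r _ 2)// ?nnegrE ?rn_ge0//.
  rewrite /B scaleNr addrC rn_sqrB rnZ normc_real exprMn real_normK ?num_real//.
  rewrite /rdot hdotZr ReZJ -/(rdot x (A x)) rdotC.
  have := positive_sqr_le x c0 Ac Ap.
  have p0 : 0 <= rdot (A x) x by have := Ap x; rewrite lecE => /andP[].
  move=> h; have h2 : d^-1 ^+ 2 * rn (A x) ^+ 2 <= d^-1 * rdot (A x) x.
    rewrite expr2 -mulrA ler_wpM2l ?invr_ge0 ?(ltW d0)//.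
    rewrite mulrC ler_pdivrMr// mulrC (le_trans h)// ler_wpM2r//.
    by rewrite /d; lra.
  have : 0 <= d^-1 * rdot (A x) x by rewrite mulr_ge0// invr_ge0 ltW.
  by move: h2; move: (_ * rdot _ _) (_ * rn (A x) ^+ 2) (rn x ^+ 2) => p q r; lra.
have Bs : selfadj B.
  by move=> x y; rewrite /B hdotDl hdotDr hdotZl hdotZr As -rmorphN conjcR.
have [Y [Y1 Ys Ye]] := root_fixpoint B1 Bs.
pose e : K[i] := (Num.sqrt d)%:C.
have ee : e * e = d%:C by rewrite /e -rmorphM -expr2 sqr_sqrtr// ltW.
exists (fun x => e *: (- 1 *: Y x + x)), (normc e * (normc (-1 : K[i]) * 1 + 1)).
split.
- by rewrite mulr_ge0 ?addr_ge0 ?mulr_ge0 ?normc_ge0.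
- have [l b] := bndDZ (-1) Y1 (bnd_id (H := H)); split=> [a x y|x].
    by rewrite l !scalerDr !scalerA [e * a]mulrC.
  by rewrite rnZ -mulrA ler_wpM2l ?normc_ge0.
- move=> x; rewrite hdotZl hdotDl hdotZl mulN1r hdotxx mulr_ge0//.
    by rewrite ler0c sqrtr_ge0.
  have i0 : complex.Im (hdot (Y x) x) = 0.
    have := Ys x x; rewrite (hdotC (Y x) x); case: (hdot (Y x) x) => p q [] /=.
    by lra.
  rewrite lecE; apply/andP; split.
    by move: i0; case: (hdot (Y x) x) => p q /= ->; rewrite oppr0 addr0.
  rewrite ReD ReN /= addrC subr_ge0 -/(rdot (Y x) x) (le_trans (rdot_le _ _))//.
  by rewrite expr2 ler_wpM2r ?rn_ge0// -[leRHS]mul1r Y1.2.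
- move=> x; rewrite (linZ _ _ Y1.1) (linD _ _ Y1.1) (linZ _ _ Y1.1).
  rewrite scalerA mulN1r scaleNr -scalerN -scalerDr scalerA ee.
  have h : Y (Y x) = Y x + Y x - B x.
    have -> : Y x + Y x = B x + Y (Y x).
      rewrite [in LHS](Ye x) -scalerDl -rmorphD (_ : 2^-1 + 2^-1 = 1 :> K); last by field.
      by rewrite rmorph1 scale1r.
    by rewrite addrC addKr.
  rewrite !scaleN1r opprD opprK h /B scaleNr opprD opprK.
  have -> : Y x + Y x + ((d^-1)%:C *: A x - x) - Y x + (- Y x + x) = (d^-1)%:C *: A x.
    by rewrite (addrC (Y x + Y x)) [X in X - _ + _]addrA addrK addrA addrK subrK.
  by rewrite scalerA -rmorphM mulfV// scale1r.
Qed.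

End positive_operators.

(** * Orthonormal systems and Hilbert bases *)

Section orthonormal_systems.
Context {K : realType} {H : hilbertType K}.
Implicit Types (x y z : H) (a b : K[i]) (S T : H -> H) (c : K) (r : seq H).

Definition span_proj r x : H := \sum_(e <- r) hdot x e *: e.

Definition ons r := uniq r /\ {in r &, forall x y, hdot x y = (x == y)%:R}.

Lemma lin_proj r : lin (span_proj r).
Proof.
move=> a x y; rewrite /span_proj scaler_sumr -big_split/=; apply: eq_bigr => e _.
by rewrite hdotDZl scalerDl scalerA.
Qed.

Lemma ons_nil : ons [::].
Proof. by split. Qed.

Lemma proj_id r e : ons r -> e \in r -> span_proj r e = e.
Proof.
move=> [ru ro] er; rewrite /span_proj (bigD1_seq e)//= ro// eqxx scale1r big1_seq ?addr0//.
by move=> f /andP[fe fr]; rewrite ro// eq_sym (negbTE fe) scale0r.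
Qed.

Lemma proj_sub r r' x : ons r' -> {subset r <= r'} -> span_proj r' (span_proj r x) = span_proj r x.
Proof.
move=> or' rr'; rewrite [span_proj r x]/span_proj (lin_sum _ _ _ (lin_proj r')).
apply: eq_big_seq => e er; rewrite (linZ _ _ (lin_proj r')) proj_id//.
exact: rr'.
Qed.

Lemma hdot_proj r x y : hdot (span_proj r x) y = \sum_(e <- r) hdot x e * hdot e y.
Proof. by rewrite hdot_suml; apply: eq_bigr => e _; rewrite hdotZl. Qed.

Lemma selfadj_proj r : selfadj (span_proj r).
Proof.
move=> x y; rewrite hdot_proj hdot_sumr; apply: eq_bigr => e _.
by rewrite hdotZr -hdotC mulrC.
Qed.

Lemma rn_proj_compl r x : ons r ->
  rn x ^+ 2 = rn (x - span_proj r x) ^+ 2 + rn (span_proj r x) ^+ 2.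
Proof.
move=> or; have h : rdot (x - span_proj r x) (span_proj r x) = 0.
  by rewrite /rdot -selfadj_proj (linB _ _ (lin_proj r)) proj_sub// subrr hdot0l.
by have := rn_sqrD (x - span_proj r x) (span_proj r x); rewrite subrK h => ->; ring.
Qed.

Lemma bnd_proj r : ons r -> bnd (span_proj r) 1.
Proof.
move=> or; split=> [|x]; first exact: lin_proj.
rewrite mul1r -(@ler_pXn2r _ 2)// ?nnegrE ?rn_ge0//.
by rewrite (rn_proj_compl x or) lerDr sqr_ge0.
Qed.

Lemma rn_compl_proj r x : ons r -> rn (x - span_proj r x) <= rn x.
Proof.
move=> or; rewrite -(@ler_pXn2r _ 2)// ?nnegrE ?rn_ge0//.
by rewrite (rn_proj_compl x or) lerDl sqr_ge0.
Qed.

(** Since P' P = P, x - P' x is what remains of x - P x after removing its projection by P'. *)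
Lemma rn_compl_proj_sub r r' x : ons r' -> {subset r <= r'} ->
  rn (x - span_proj r' x) <= rn (x - span_proj r x).
Proof.
move=> or' rr'; apply: le_trans (rn_compl_proj _ or').
by rewrite (linB _ _ (lin_proj r')) proj_sub// opprB addrA subrK.
Qed.

Lemma lin_span_sub (A : set H) x : A x -> lin_span A x.
Proof.
move=> Ax; exists 1%N, (fun=> 1), (fun=> x); split=> //.
by rewrite big_ord1 scale1r.
Qed.

Lemma lin_span0 (A : set H) : lin_span A 0.
Proof.
by exists 0%N, (fun=> 0), (fun=> 0); rewrite big_ord0; split=> // -[].
Qed.

Lemma lin_spanDZ (A : set H) a x y :
  lin_span A x -> lin_span A y -> lin_span A (a *: x + y).
Proof.
move=> [n [c [v [Av ->]]]] [m [d [w [Aw ->]]]].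
exists (n + m)%N, (fun i : 'I_(n + m) => match fintype.split i with inl j => a * c j | inr j => d j end),
  (fun i : 'I_(n + m) => match fintype.split i with inl j => v j | inr j => w j end); split.
  by move=> i; case: fintype.split.
rewrite big_split_ord/=; congr (_ + _).
  rewrite scaler_sumr; apply: eq_bigr => i _.
  by rewrite (unsplitK (inl i)) scalerA.
by apply: eq_bigr => i _; rewrite (unsplitK (inr i)).
Qed.

Lemma closureP (A : set H) x : closure A x <->
  forall e : K, 0 < e -> exists2 y, A y & rn (x - y) <= e.
Proof.
split=> [h e e0|h B].
  have e0' : 0 < e%:C :> K[i] by rewrite ltcR.
  have [y [Ay]] := h _ (nbhsx_ballx x _ e0').
  rewrite -ball_normE /= norm_rn ltcR => /ltW ye; by exists y.
move=> /nbhs_ballP[e /=]; rewrite ltcE => /andP[/eqP/= ei er] eB.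
have [y Ay ye] := h _ (divr_gt0 er (ltr0Sn _ 1)).
exists y; split=> //; apply: eB; rewrite -ball_normE /= norm_rn ltcE /= ei eqxx /=.
by rewrite (le_lt_trans ye)// ltr_pdivrMr// ltr_pMr// ltrDl.
Qed.

Lemma orthonormal_ons (A : set H) r : orthonormal_set A -> uniq r ->
  (forall e, e \in r -> A e) -> ons r.
Proof. by move=> oA ur rA; split=> // x y /rA Ax /rA Ay; exact: oA. Qed.

(** The projection is at least as good as any combination of the same vectors. Repetitions among the
    generators are removed to obtain an orthonormal list. *)
Lemma closed_span_approx (A : set H) x (e : K) : orthonormal_set A ->
  closed_span A x -> 0 < e ->
  exists r, [/\ ons r, forall v, v \in r -> A v & rn (x - span_proj r x) <= e].
Proof.
move=> oA /closureP h e0; have [_ [n [c [v [Av ->]]]] ye] := h _ e0.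
pose r := undup [seq v i | i : 'I_n].
have rA u : u \in r -> A u.
  by rewrite mem_undup => /mapP[i _ ->].
have or : ons r by apply: orthonormal_ons oA _ _ => //; exact: undup_uniq.
exists r; split=> //; apply: le_trans ye.
set y := \sum_(i < n) _.
have py : span_proj r y = y.
  rewrite /y (lin_sum _ _ _ (lin_proj r)); apply: eq_bigr => i _.
  rewrite (linZ _ _ (lin_proj r)) proj_id// mem_undup; apply/mapP; exists i => //.
  by rewrite mem_enum.
apply: le_trans (rn_compl_proj _ or).
by rewrite (linB _ _ (lin_proj r)) py opprB addrA subrK.
Qed.

Lemma finite_approx (A : set H) (xs : seq H) (e : K) : orthonormal_set A ->
  (forall x, closed_span A x) -> 0 < e ->
  exists r, [/\ ons r, forall v, v \in r -> A v &
    forall x, x \in xs -> rn (x - span_proj r x) <= e].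
Proof.
move=> oA tA e0; elim: xs => [|x xs [r [or rA rh]]].
  by exists [::]; split=> //; exact: ons_nil.
have [r' [or' rA' rh']] := closed_span_approx oA (tA x) e0.
have sA v : v \in undup (r ++ r') -> A v.
  by rewrite mem_undup mem_cat => /orP[/rA|/rA'].
have os : ons (undup (r ++ r')).
  by apply: orthonormal_ons oA _ sA; exact: undup_uniq.
exists (undup (r ++ r')); split=> // y; rewrite inE => /orP[/eqP->|/rh h].
- apply: le_trans rh'; apply: rn_compl_proj_sub => // v vr.
  by rewrite mem_undup mem_cat vr orbT.
- apply: le_trans h; apply: rn_compl_proj_sub => // v vr.
  by rewrite mem_undup mem_cat vr.
Qed.

(** The functional y |-> <y, x> on the span is represented by a vector w of its closure, the
    projection of x; then z = x - w. *)
Lemma closed_span_orthogonal (A : set H) x : ~ closed_span A x ->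
  exists z, [/\ z != 0 & forall y, A y -> hdot y z = 0].
Proof.
move=> nx; have [||||||w [hw _ [u [Du ul]]]] :=
  @riesz_range _ _ (lin_span A) id (fun y => hdot y x) (rn x).
- by [].
- exact: lin_span0.
- by move=> a y z; exact: lin_spanDZ.
- by move=> a y z _ _; exact: hdotDZl.
- exact: rn_ge0.
- by move=> y _; rewrite mulrC cauchy_schwarz.
exists (x - w); split.
  rewrite subr_eq0; apply/eqP => xw; apply: nx; apply/closureP => e e0.
  move/cvgrPdist_lt : ul => /(_ _ e0)[N _ /(_ N (leqnn N))]/=.
  rewrite sub0r normrN ger0_norm ?rn_ge0// => /ltW h.
  by exists (u N) => //; rewrite xw rnB.
by move=> y Ay; rewrite hdotBr hw ?subrr//; exact: lin_span_sub.
Qed.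

(** The basis in [positive_trace] is picked by choice, so its properties rest on existence. A
    maximal orthonormal set from Zorn's lemma is total: otherwise a normalised vector orthogonal to
    it could be added. *)
Lemma hilbert_basis_exists : exists B : set H, hilbert_basis B.
Proof.
have [F FO Ft|B [oB mB]] := @Zorn_bigcup _ (@orthonormal_set K H).
  move=> x y [X FX Xx] [Y FY Yy]; have [XY|YX] := Ft _ _ FX FY.
    by apply: (FO _ FY) => //; exact: XY.
  by apply: (FO _ FX) => //; exact: YX.
exists B; split=> //; apply/seteqP; split=> // x _; apply: contrapT => nx.
have [z [z0 zB]] := closed_span_orthogonal nx.
have zn : rn z != 0 by apply: contra_neq z0; exact: rn_eq0.
pose f := ((rn z)^-1)%:C *: z.
have ff : hdot f f = 1.
  rewrite /f hdotZl hdotZr conjcR hdotxx -!rmorphM (_ : _ * _ = 1) ?rmorph1//.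
  by field.
have fB y : B y -> hdot y f = 0 by move=> By; rewrite hdotZr zB// mulr0.
have fB' y : B y -> hdot f y = 0 by move=> By; rewrite hdotC fB// conjc0.
apply: (mB (B `|` [set f])).
  split; first by move=> y; left.
  move=> h; have := fB' f (h f (or_intror erefl)); rewrite ff => /eqP.
  by rewrite oner_eq0.
have nf y : B y -> (y == f) = false.
  by move=> By; apply/eqP => yf; have := fB' y By; rewrite yf ff => /eqP; rewrite oner_eq0.
move=> x1 y1 [Bx|->] [By|->]; [exact: oB| | |].
- by rewrite fB// nf.
- by rewrite fB'// eq_sym nf.
- by rewrite ff eqxx.
Qed.

End orthonormal_systems.
(** * The trace norm *)

Section trace_norm_theory.
Context {K : realType} {H : hilbertType K}.
Implicit Types (x y z : H) (a b : K[i]) (S T : H -> H) (c : K) (p : seq (H * H)).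

(* The rank one sums sum_i u_i (x) v_i of operator norm at most 1, against
   which the trace norm is dual to the operator norm. *)
Definition contraction_family p := forall x y,
  complex.Re (\sum_(q <- p) hdot x q.2 * hdot q.1 y) <= rn x * rn y.

(** The sum is the real part of tr (T W), with W the operator of the test family. In this form
    subadditivity, sandwiches and limits are within reach; [trace_normP] identifies it with a bound
    on [trace_norm]. *)
Definition tnle T c := lin T /\ forall p, contraction_family p ->
  \sum_(q <- p) rdot (T q.1) q.2 <= c.

Lemma tnle_ge0 T c : tnle T c -> 0 <= c.
Proof.
move=> [_ h]; have := h [::]; rewrite big_nil; apply => x y.
by rewrite big_nil mulr_ge0 ?rn_ge0.
Qed.

Lemma tnle_le T c c' : tnle T c -> c <= c' -> tnle T c'.
Proof. by move=> [l h] cc; split=> // p /h /le_trans; apply. Qed.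

Lemma tnle_bnd T c : tnle T c -> bnd T c.
Proof.
move=> Tc; have c0 := tnle_ge0 Tc; case: Tc => [l h]; split=> // x.
apply: rn_le_dual => [|y]; first by rewrite mulr_ge0 ?rn_ge0.
have [x0|x0] := eqVneq (rn x) 0; first by rewrite (rn_eq0 x0) (lin0 l) /rdot hdot0l rn0 mulr0 mul0r.
have [y0|y0] := eqVneq (rn y) 0; first by rewrite (rn_eq0 y0) /rdot hdot0r rn0 mulr0.
pose u := ((rn x)^-1)%:C *: x; pose v := ((rn y)^-1)%:C *: y.
have nu : rn u = 1 by rewrite rnZ normc_real ger0_norm ?invr_ge0 ?rn_ge0// mulVf.
have nv : rn v = 1 by rewrite rnZ normc_real ger0_norm ?invr_ge0 ?rn_ge0// mulVf.
have := h [:: (u, v)]; rewrite big_seq1 /= => hh.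
have : rdot (T u) v <= c.
  apply: hh => z w; rewrite big_seq1 /= (le_trans (Re_le_normc _))// Normc.normcM.
  apply: ler_pM; rewrite ?normc_ge0//.
    by rewrite (le_trans (cauchy_schwarz _ _))// nv mulr1.
  by rewrite (le_trans (cauchy_schwarz _ _))// nu mul1r.
rewrite /u /v (linZ _ _ l) /rdot hdotZl hdotZr ReZ ReZJ => h1.
have xp : 0 < rn x by rewrite lt_neqAle eq_sym x0 rn_ge0.
have yp : 0 < rn y by rewrite lt_neqAle eq_sym y0 rn_ge0.
move: h1; rewrite mulrC ler_pdivrMr// mulrC ler_pdivrMr//.
Qed.

Lemma tnle0 : tnle (fun=> 0) 0.
Proof.
split=> [a x y|p _]; first by rewrite scaler0 addr0.
by rewrite big1// => q _; rewrite /rdot hdot0l.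
Qed.

Lemma tnleD S T c c' : tnle S c -> tnle T c' -> tnle (S + T) (c + c').
Proof.
move=> [lS hS] [lT hT]; split=> [a x y|p pc].
  by rewrite !fctE lS lT scalerDr addrACA.
rewrite (le_trans _ (lerD (hS p pc) (hT p pc)))// -big_split/=.
by apply: ler_sum => q _; rewrite fctE /rdot hdotDl ReD.
Qed.

(** Only real parts are tested, so the phase of a complex scalar has to be moved into the test
    family; this gives [tnleZ]. *)
Lemma contraction_phase p a : normc a <= 1 -> contraction_family p ->
  contraction_family [seq (a *: q.1, q.2) | q <- p].
Proof.
move=> a1 pc x y; rewrite big_map /=.
have -> : \sum_(q <- p) hdot x q.2 * hdot (a *: q.1) y =
    \sum_(q <- p) hdot (a *: x) q.2 * hdot q.1 y.
  by apply: eq_bigr => q _; rewrite !hdotZl mulrCA mulrA.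
rewrite (le_trans (pc _ _))// rnZ -mulrA ler_piMl// mulr_ge0 ?rn_ge0//.
Qed.

Lemma tnleZ T a c : tnle T c -> tnle (a *: T) (normc a * c).
Proof.
move=> Tc; have [a0|a0] := eqVneq a 0.
  rewrite a0 scale0r Normc.normc0 mul0r; exact: tnle0.
have [l h] := Tc; split=> [b x y|p pc].
  by rewrite !fctE l scalerDr !scalerA [a * b]mulrC.
have n0 : normc a != 0 by apply: contra_neq a0 => /Normc.eq0_normc.
have := h _ (@contraction_phase p (a * ((normc a)^-1)%:C) _ pc).
rewrite big_map/= Normc.normcM normc_real ger0_norm ?invr_ge0 ?normc_ge0// mulfV//.
move=> /(_ (lexx _)) /(ler_wpM2l (normc_ge0 a)); apply: le_trans.
rewrite mulr_sumr; apply: ler_sum => q _; rewrite fctE (linZ _ _ l) /rdot !hdotZl.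
by rewrite [a * (_)%:C]mulrC -mulrA ReZ mulrA mulfV// mul1r.
Qed.

Lemma tnleB S T c c' : tnle S c -> tnle T c' -> tnle (S - T) (c + c').
Proof.
move=> hS hT; rewrite -scaleN1r; apply: tnleD => //.
by have := tnleZ (-1) hT; rewrite normcN Normc.normc1 mul1r.
Qed.

Lemma tnle_sum I (r : seq I) (F : I -> H -> H) (f : I -> K) :
  (forall i, tnle (F i) (f i)) -> tnle (\sum_(i <- r) F i) (\sum_(i <- r) f i).
Proof.
move=> h; elim/big_rec2 : _ => [|i u v _ hv]; first exact: tnle0.
exact: tnleD.
Qed.

(** tr (A T B^H W) = tr (T B^H W A): the outer operators move into the test family, which after
    division by c1 c2 is again contractive. If c1 c2 = 0 the operator vanishes. *)
Lemma tnle_sandwich A T B' c c1 c2 : 0 <= c1 -> 0 <= c2 ->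
  bnd A c1 -> bnd B' c2 -> tnle T c -> tnle (A \o T \o adjoint B') (c1 * c2 * c).
Proof.
move=> c10 c20 Ac Bc Tc; have c0 := tnle_ge0 Tc; case: Tc => l h.
have [lB bB] := bnd_adjoint c20 Bc; have [lA bA] := Ac.
have [lA' bA'] := bnd_adjoint c10 Ac; have [lB' bB'] := Bc.
split=> [a x y /=|p pc]; first by rewrite lB l lA.
have [cc0|cc0] := eqVneq (c1 * c2) 0.
  have z q : rdot ((A \o T \o adjoint B') q.1) q.2 = 0.
    move/eqP: cc0; rewrite mulf_eq0 => /orP[/eqP e|/eqP e].
      have -> : (A \o T \o adjoint B') q.1 = 0; last by rewrite /rdot hdot0l.
      by apply: rn_eq0; apply/eqP; rewrite eq_le rn_ge0 andbT (le_trans (bA _))// e mul0r.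
    have -> : (A \o T \o adjoint B') q.1 = 0; last by rewrite /rdot hdot0l.
    rewrite /= (_ : adjoint B' q.1 = 0) ?(lin0 l) ?(lin0 lA)//.
    by apply: rn_eq0; apply/eqP; rewrite eq_le rn_ge0 andbT (le_trans (bB _))// e mul0r.
  by rewrite big1// cc0 mul0r.
have ccp : 0 < c1 * c2 by rewrite lt_neqAle eq_sym cc0 mulr_ge0.
pose k : K[i] := ((c1 * c2)^-1)%:C.
have hh : contraction_family [seq (k *: adjoint B' q.1, adjoint A q.2) | q <- p].
  move=> x y; rewrite big_map /=.
  under eq_bigr do rewrite hdotZl -(adjointP Ac) (adjointPr Bc) mulrCA.
  rewrite -mulr_sumr ReZ ler_pdivrMl// (le_trans (pc _ _))//.
  by rewrite mulrACA ler_pM ?rn_ge0.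
have := h _ hh; rewrite big_map => {}h.
have {h} : (c1 * c2)^-1 * \sum_(q <- p) rdot ((A \o T \o adjoint B') q.1) q.2 <= c.
  apply: le_trans h; rewrite mulr_sumr; apply: ler_sum => q _ /=.
  by rewrite (linZ _ _ l) /rdot hdotZl ReZ (adjointP Ac).
by rewrite ler_pdivrMl.
Qed.

Lemma tnle_tensor x y : tnle (tensor x y) (rn x * rn y).
Proof.
split=> [a u v|p pc]; first by rewrite /tensor hdotDZl scalerDl scalerA.
apply: le_trans (pc x y); rewrite Re_sum; apply: ler_sum => q _.
by rewrite /rdot /tensor hdotZl mulrC.
Qed.

(** Lower semicontinuity: every test sum is continuous for strong convergence, and [tnle] bounds
    their supremum. *)
Lemma tnle_limit (Tn : nat -> H -> H) T (f : nat -> K) c : lin T ->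
  (forall n, tnle (Tn n) (f n)) -> f @ \oo --> c ->
  (forall x, rcvg (Tn ^~ x) (T x)) -> tnle T c.
Proof.
move=> l h fc hT; split=> // p pc.
have lim : (fun n => \sum_(q <- p) rdot (Tn n q.1) q.2) @ \oo -->
    \sum_(q <- p) rdot (T q.1) q.2.
  apply: (@cvg_sum_seq _ _ p (fun q n => rdot (Tn n q.1) q.2)).
  by move=> q; exact: rcvg_rdot (hT _).
by apply: ler_cvg_to lim fc _; apply: nearW => n; exact: (h n).2.
Qed.

(** Completeness of the trace class. The limit is first taken in operator norm; the trace norm
    estimates against Tn m then survive by [tnle_limit]. *)
Lemma tnle_complete (Tn : nat -> H -> H) (f g : nat -> K) :
  (forall n, tnle (Tn n) (f n)) -> g @ \oo --> 0 ->
  (forall m n, (m <= n)%N -> tnle (Tn n - Tn m) (g m)) ->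
  exists T, forall m, tnle (T - Tn m) (g m).
Proof.
move=> hf g0 hg.
have bn n : bnd (Tn n) (f 0%N + g 0%N).
  apply: tnle_bnd; rewrite -[Tn n](subrK (Tn 0%N)) addrC.
  by apply: tnleD => //; exact: hg.
have [||T [Tb Tl]] := @op_limit _ _ Tn _ g bn => //.
  by move=> m n x mn; exact: (tnle_bnd (hg _ _ mn)).2.
exists T => m; apply: (@tnle_limit (fun k => Tn (m + k)%N - Tn m) _ (fun=> g m)).
- by move=> a x y; rewrite !fctE Tb.1 (bn m).1 opprD addrACA -scalerBr.
- by move=> k; apply: hg; exact: leq_addr.
- exact: cvg_cst.
- move=> x; rewrite /rcvg /=.
  apply: (@squeeze0 _ _ (fun k => rn (Tn (k + m)%N x - T x))).
  + by move=> n; exact: rn_ge0.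
  + by apply: nearW => n; rewrite !fctE opprB addrA subrK addnC.
  + have := Tl x; rewrite /rcvg => h; rewrite (@cvg_shiftn m _ (fun k => rn (Tn k x - T x))).
    exact: h.
Qed.

End trace_norm_theory.

(** * The trace norm as a dual norm *)

Section trace_norm_duality.
Context {K : realType} {H : hilbertType K}.
Implicit Types (x y z : H) (a b : K[i]) (S T : H -> H) (c : K).

Lemma modulus_exists T c : 0 <= c -> bnd T c ->
  exists S, [/\ bounded_op S, positive_op S & S \o S = adjoint T \o T].
Proof.
move=> c0 Tc; have [|||Q [c' [c'0 Qc Qp QQ]]] := @positive_sqrt _ _ (adjoint T \o T) (c * c).
- exact: mulr_ge0.
- exact: bnd_comp (bnd_adjoint c0 Tc) Tc.
- by move=> x /=; rewrite (adjointPr Tc) hdot_ge0.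
exists Q; split=> //; first by apply/bounded_opP; exists c'.
by apply/funext => x; exact: QQ.
Qed.

Section polar.
Variables (S T : H -> H) (c : K).
Hypotheses (Sl : lin S) (Sp : positive_op S) (Tc : bnd T c).
Hypothesis SST : S \o S = adjoint T \o T.

Lemma hdot_modulus x y : hdot (S x) (S y) = hdot (T x) (T y).
Proof.
rewrite -(positive_selfadj Sl Sp) -[S (S x)]/((S \o S) x) SST /=.
by rewrite (adjointPr Tc).
Qed.

Lemma rn_modulus x : rn (S x) = rn (T x).
Proof. by rewrite /dot_norm hdot_modulus. Qed.

(* W is the adjoint of the partial isometry U in T = U S. *)
Lemma polar_decomposition : exists W, [/\ bnd W 1,
  forall x y, hdot (T x) y = hdot (S x) (W y) & forall x, W (T x) = S x].
Proof.
(* W y is prescribed only against the range of S; lying in the closure of that range determines it,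
   which yields linearity of W and W T = S. *)
have uniqw w w' (u u' : nat -> H) : rcvg (S \o u) w -> rcvg (S \o u') w' ->
    (forall x, hdot (S x) w = hdot (S x) w') -> w = w'.
  move=> h h' e; apply/subr0_eq/rn_eq0/eqP; rewrite -sqrf_eq0 rn_sqr.
  have h2 : rcvg (fun n => S (u n - u' n)) (w - w').
    have := rcvgDZ (-1) h' h; rewrite scaleN1r addrC.
    by under [X in rcvg X]eq_fun do rewrite scaleN1r addrC /= -(linB _ _ Sl).
  have h3 := @rcvg_rdot _ _ _ _ (w - w') h2.
  have h4 : (fun n => rdot (S (u n - u' n)) (w - w')) @ \oo --> (0 : K).
    rewrite (_ : (fun n => _) = fun=> 0); first exact: cvg_cst.
    by apply/funext => n; rewrite /rdot hdotBr e subrr.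
  by apply/eqP; exact: (cvg_unique _ h3 h4).
have /choice[W hW] : forall y, exists w, [/\ forall x, hdot (T x) y = hdot (S x) w,
    rn w <= rn y & exists u, rcvg (S \o u) w].
  move=> y; have [//|//||||w [h h1 [u [_ h2]]]] :=
    @riesz_range _ _ setT S (fun x => hdot (T x) y) (rn y) Sl.
  - by move=> a u v _ _; rewrite Tc.1 hdotDZl.
  - exact: rn_ge0.
  - by move=> x _; rewrite mulrC rn_modulus cauchy_schwarz.
  - by exists w; split=> // [x|]; [exact: h|exists u].
exists W; split=> [|x y|x].
- split=> [a x y|x]; last by rewrite mul1r; case: (hW x).
  have [hx _ [u hu]] := hW x; have [hy _ [v hv]] := hW y.
  have [hxy _ [w hw]] := hW (a *: x + y).
  apply: (@uniqw _ _ w (fun n => a *: u n + v n)) => // [|z].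
    by have := rcvgDZ a hu hv; under [X in rcvg X]eq_fun do rewrite /= -Sl.
  by rewrite -hxy !hdotDr !hdotZr hx hy.
- by case: (hW y).
- have [hx _ [u hu]] := hW (T x).
  apply: (@uniqw _ _ u (fun=> x)) => // [|z]; first exact: rcvg_cst.
  by rewrite -hx hdot_modulus.
Qed.

End polar.

Definition basis : set H := xget set0 hilbert_basis.

Lemma basisP : hilbert_basis basis.
Proof. exact: xgetPex hilbert_basis_exists. Qed.

Lemma basis_total x : closed_span basis x.
Proof. by rewrite basisP.2. Qed.

Lemma positive_trace_ge S r : ons r -> (forall e, e \in r -> basis e) ->
  ((\sum_(e <- r) rdot (S e) e)%:E <= positive_trace S)%E.
Proof.
move=> [ru _] rB; apply: ereal_sup_ubound; exists [set` r].
  by split; [exact: finite_seq|move=> e /= /rB].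
by rewrite -fsbig_seq// sumEFin.
Qed.

Lemma positive_trace_le S (m : \bar K) :
  (forall r, ons r -> ((\sum_(e <- r) rdot (S e) e)%:E <= m)%E) ->
  (positive_trace S <= m)%E.
Proof.
move=> h; apply: ge_ereal_sup => _ [X [fX XB] <-].
rewrite fsbig_finite// sumEFin; apply: h; apply: orthonormal_ons basisP.1 _ _.
  exact: finmap.fset_uniq.
by move=> e; rewrite in_fset_set// inE; exact: XB.
Qed.

Lemma positive_trace_ge0 S : positive_op S -> (0 <= positive_trace S)%E.
Proof.
move=> Sp; have := @positive_trace_ge S [::] ons_nil; rewrite big_nil.
by apply.
Qed.

(** Let Q be the square root of S, so that <T u, v> = <Q u, Q W v>. Projecting Q u to a finite part
    of the basis turns a test sum into values of the family at W^H Q f and Q f, each at most |Q f|^2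
    = <S f, f>. Conversely the test family (f, W^H f) returns <S f, f>. *)
Lemma positive_traceP S T c cs ct : 0 <= cs -> bnd S cs -> positive_op S -> 0 <= ct ->
  bnd T ct -> S \o S = adjoint T \o T ->
  (positive_trace S <= c%:E)%E <-> tnle T c.
Proof.
move=> cs0 Sc Sp ct0 Tc SST; have [Sl Sb] := Sc.
have [W [[Wl Wb] TSW WT]] := polar_decomposition Sl Sp Tc SST.
have W1 : bnd W 1 by [].
have [Ul Ub] := bnd_adjoint ler01 W1.
split=> [h|[_ h]].
  split=> [|p pc]; first exact: Tc.1.
  have [Q [q [q0 Qq Qp QQ]]] := positive_sqrt cs0 Sc Sp.
  have Qs := positive_selfadj Qq.1 Qp.
  pose M := \sum_(t <- p) rn (Q (W t.2)).
  have M0 : 0 <= M by rewrite sumr_ge0// => t _; exact: rn_ge0.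
  apply/ler_addgt0Pr => e e0.
  (* The projection error is spread over the family and totals at most M e / (M + 1). *)
  have e'0 : 0 < e / (M + 1) by rewrite divr_gt0// ltr_wpDl.
  have [r [or rB rh]] := finite_approx [seq Q t.1 | t <- p] basisP.1
     basis_total e'0.
  have e1 : \sum_(t <- p) rdot (T t.1) t.2 =
     \sum_(t <- p) rdot (span_proj r (Q t.1)) (Q (W t.2)) +
     \sum_(t <- p) rdot (Q t.1 - span_proj r (Q t.1)) (Q (W t.2)).
    rewrite -big_split; apply: eq_bigr => t _ /=.
    by rewrite /rdot -ReD -hdotDl addrC subrK TSW -QQ Qs.
  rewrite e1 lerD//.
    apply: (@le_trans _ _ (\sum_(e <- r) rdot (S e) e)); last first.
      by rewrite -lee_fin (le_trans (positive_trace_ge S or rB)).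
    rewrite /rdot -Re_sum.
    under eq_bigr do rewrite hdot_proj.
    rewrite exchange_big/= Re_sum; apply: ler_sum => f _.
    have := pc (adjoint W (Q f)) (Q f).
    have -> : \sum_(q <- p) hdot (adjoint W (Q f)) q.2 * hdot q.1 (Q f) =
        \sum_(q <- p) hdot (Q q.1) f * hdot f (Q (W q.2)).
      by apply: eq_bigr => t _; rewrite (adjointPr W1) Qs mulrC -(Qs t.1).
    move/le_trans; apply.
    rewrite -QQ Qs hdotxx expr2 ler_wpM2r ?rn_ge0//.
    by rewrite -[leRHS]mul1r.
  apply: (@le_trans _ _ (e / (M + 1) * M)); last first.
    by rewrite mulrAC ler_pdivrMr ?ltr_wpDl// ler_pM2l//; lra.
  rewrite /M mulr_sumr big_seq [leRHS]big_seq; apply: ler_sum => t tp.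
  rewrite (le_trans (rdot_le _ _))// ler_wpM2r ?rn_ge0// rh//.
  by apply/mapP; exists t.
apply: positive_trace_le => r or; rewrite lee_fin.
have hc : contraction_family [seq (e, adjoint W e) | e <- r].
  move=> x y; rewrite big_map /=.
  under eq_bigr do rewrite -(adjointP W1).
  rewrite -hdot_proj (le_trans (rdot_le _ _))// ler_wpM2r ?rn_ge0//.
  rewrite (le_trans ((bnd_proj or).2 _))// mul1r.
  by rewrite -[leRHS]mul1r.
have := h _ hc; rewrite big_map /=; apply: le_trans.
by apply: ler_sum => e _; rewrite /rdot -(adjointP W1) WT.
Qed.

Lemma abs_opP T ct : 0 <= ct -> bnd T ct -> [/\ bounded_op (abs_op T),
   positive_op (abs_op T) & abs_op T \o abs_op T = adjoint T \o T].
Proof. by move=> c0 Tc; exact: xgetPex (modulus_exists c0 Tc). Qed.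

Lemma trace_normP T c : (trace_norm T <= c%:E)%E <-> tnle T c.
Proof.
rewrite /trace_norm; case: asboolP => [/bounded_opP[ct c0 Tc]|nb].
  have [/bounded_opP[cs s0 Sc] Sp SST] := abs_opP c0 Tc.
  exact: positive_traceP s0 Sc Sp c0 Tc SST.
split=> // Tc; exfalso; apply: nb; apply/bounded_opP; exists c.
  exact: tnle_ge0 Tc.
exact: tnle_bnd.
Qed.

Lemma trace_norm_ge0 T : (0 <= trace_norm T)%E.
Proof.
rewrite /trace_norm; case: asboolP => [/bounded_opP[ct c0 Tc]|//].
by have [_ Sp _] := abs_opP c0 Tc; exact: positive_trace_ge0.
Qed.

Lemma trace_norm_fin T : (trace_norm T < +oo)%E -> tnle T (fine (trace_norm T)).
Proof.
by move=> h; apply/trace_normP; rewrite fineK// ge0_fin_numE// trace_norm_ge0.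
Qed.

Lemma tnle_fin T c : tnle T c -> (trace_norm T < +oo)%E.
Proof. by move=> /trace_normP h; rewrite (le_lt_trans h)// ltry. Qed.

Lemma trace_norm0 : trace_norm (0 : H -> H) = 0%E.
Proof.
apply/eqP; rewrite eq_le trace_norm_ge0 andbT; apply/trace_normP; exact: tnle0.
Qed.

Lemma trace_normD S T : (trace_norm (S + T)%R <= trace_norm S + trace_norm T)%E.
Proof.
have hS := trace_norm_ge0 S; have hT := trace_norm_ge0 T.
have [|Sf] := eqVneq (trace_norm S) +oo%E.
  by move=> ->; rewrite addye ?leey//; case: (trace_norm T) hT.
have [|Tf] := eqVneq (trace_norm T) +oo%E.
  by move=> ->; rewrite addey ?leey//; case: (trace_norm S) hS.
have {}Sf : trace_norm S \is a fin_num by rewrite ge0_fin_numE// ltey.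
have {}Tf : trace_norm T \is a fin_num by rewrite ge0_fin_numE// ltey.
rewrite -(fineK Sf) -(fineK Tf) -EFinD; apply/trace_normP.
by apply: tnleD; apply: trace_norm_fin; rewrite -ge0_fin_numE.
Qed.

Lemma trace_normZ a T : (trace_norm (a *: T)%R <= (normc a)%:E * trace_norm T)%E.
Proof.
have [->|a0] := eqVneq a 0.
  by rewrite scale0r Normc.normc0 mul0e trace_norm0.
have n0 : 0 < normc a.
  rewrite lt_neqAle normc_ge0 eq_sym andbT; apply: contra_neq a0 => /Normc.eq0_normc.
  exact.
have [->|Tf] := eqVneq (trace_norm T) +oo%E; first by rewrite gt0_muley ?lte_fin ?leey.
have {}Tf : trace_norm T \is a fin_num by rewrite ge0_fin_numE ?trace_norm_ge0// ltey.
rewrite -(fineK Tf) -EFinM; apply/trace_normP.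
by apply: tnleZ; apply: trace_norm_fin; rewrite -ge0_fin_numE// trace_norm_ge0.
Qed.

Lemma trace_normN T : trace_norm (- T) = trace_norm T.
Proof.
have h S : (trace_norm (- S)%R <= trace_norm S)%E.
  rewrite -scaleN1r (le_trans (trace_normZ _ _))//.
  by rewrite normcN Normc.normc1 mul1e.
by apply/eqP; rewrite eq_le h -{1}(opprK T) h.
Qed.

Lemma trace_norm_eq0 T : trace_norm T = 0%E -> T = 0.
Proof.
move=> h; have /trace_normP/tnle_bnd[_ b] : (trace_norm T <= 0%:E)%E by rewrite h.
apply/funext => x; apply: rn_eq0; apply/eqP; rewrite eq_le rn_ge0 andbT.
by rewrite (le_trans (b x))// mul0r.
Qed.

(** [positive_traceP] accepts any positive S with S o S = T^H o T; taking S = T compares both sides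
    through [tnle]. *)
Lemma trace_norm_positive T : bounded_op T -> positive_op T ->
  trace_norm T = positive_trace T.
Proof.
move=> /bounded_opP[c c0 Tc] Tp.
have e : T \o T = adjoint T \o T.
  by rewrite (selfadj_adjoint Tc)//; exact: positive_selfadj Tc.1 Tp.
have h m : (trace_norm T <= m%:E)%E <-> (positive_trace T <= m%:E)%E.
  apply: iff_trans (trace_normP T m) _; apply: iff_sym.
  exact: (@positive_traceP T T m c c c0 Tc Tp c0 Tc e).
have hh (u v : \bar K) : (0 <= v)%E -> (forall m, (v <= m%:E)%E -> (u <= m%:E)%E) ->
    (u <= v)%E.
  case: v => [v _ hv|_ _|//]; first exact: hv.
  by rewrite leey.
apply/eqP; rewrite eq_le; apply/andP; split.
- by apply: hh => [|m /h//]; exact: positive_trace_ge0.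
- by apply: hh => [|m /h//]; exact: trace_norm_ge0.
Qed.

(** On positive operators the trace norm is the trace, which is additive; this makes [norm_measure]
    a measure. *)
Lemma trace_normD_positive S T : bounded_op S -> bounded_op T ->
  positive_op S -> positive_op T ->
  trace_norm (S + T)%R = (trace_norm S + trace_norm T)%E.
Proof.
move=> Sb Tb Sp Tp.
have STb : bounded_op (S + T).
  move: Sb Tb => /bounded_opP[c c0 Sc] /bounded_opP[c' c'0 Tc].
  apply/bounded_opP; exists (normc (1 : K[i]) * c + c').
    by rewrite addr_ge0// mulr_ge0// normc_ge0.
  have := bndDZ 1 Sc Tc; congr bnd; apply/funext => x.
  by rewrite scale1r.
have STp : positive_op (S + T).
  by move=> x; rewrite fctE hdotDl addr_ge0.
rewrite !trace_norm_positive// /positive_trace -esumD.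
- by apply: eq_esum => x _; rewrite fctE hdotDl ReD EFinD.
- by move=> x _; have := Sp x; rewrite lecE => /andP[].
- by move=> x _; have := Tp x; rewrite lecE => /andP[].
Qed.

End trace_norm_duality.
(** * Bochner integrals *)

Section finite_range.
Context {d : measure_display} {T : measurableType d} {K : realType}.
Variable mu : {measure set T -> \bar K}.
Hypothesis mufin : (mu setT < +oo)%E.

Lemma mu_fin_num A : measurable A -> mu A \is a fin_num.
Proof.
move=> mA; rewrite ge0_fin_numE// (le_lt_trans _ mufin)// le_measure// inE//.
Qed.

(** A partition is encoded by a map whose fibres are its pieces, so that a common refinement of two
    partitions is the paired map. *)
Definition finite_partition {U : choiceType} (p : T -> U) :=
  finite_set (range p) /\ forall u, measurable (p @^-1` [set u]).

Lemma finite_partition_comp {U U' : choiceType} (p : T -> U) (phi : U -> U') :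
  finite_partition p -> finite_partition (phi \o p).
Proof.
move=> [fp mp]; split; first by rewrite -(image_comp p phi); apply: finite_image.
move=> v; rewrite (_ : _ @^-1` _ = \bigcup_(u in range p `&` phi @^-1` [set v]) p @^-1` [set u]).
  by apply: fin_bigcup_measurable => //; apply: finite_setIl.
apply/seteqP; split=> [x /= xv|x [u [_ /= uv] /= xu]]; last by rewrite /= xu.
  by exists (p x) => //; split.
Qed.

Lemma finite_partition_pair {U U' : choiceType} (p : T -> U) (q : T -> U') :
  finite_partition p -> finite_partition q -> finite_partition (fun x => (p x, q x)).
Proof.
move=> [fp mp] [fq mq]; split.
  apply: (@sub_finite_set _ _ (range p `*` range q)); last exact: finite_setX.
  by move=> _ [x _ <-]; split; exists x.
move=> [u v]; rewrite (_ : _ @^-1` _ = (p @^-1` [set u]) `&` (q @^-1` [set v])).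
  exact: measurableI.
by apply/seteqP; split=> x /=; [move=> [-> ->]|move=> [-> ->]].
Qed.

Lemma measurable_finite_partition {U : choiceType} {d'} {T' : measurableType d'}
  (p : T -> U) (h : U -> T') : finite_partition p -> measurable_fun setT (h \o p).
Proof.
move=> [fp mp] _ Y mY; rewrite setTI.
rewrite (_ : _ @^-1` _ = \bigcup_(u in range p `&` h @^-1` Y) p @^-1` [set u]).
  by apply: fin_bigcup_measurable => //; apply: finite_setIl.
apply/seteqP; split=> [x /= xv|x [u [_ /= uv] /= xu]]; last by rewrite /= xu.
by exists (p x) => //; split.
Qed.

Lemma integral_finite_partition {U : choiceType} (p : T -> U) (h : U -> \bar K) :
  finite_partition p -> (forall u, 0 <= h u)%E ->
  (\int[mu]_x h (p x) = \sum_(u \in range p) (h u * mu (p @^-1` [set u])))%E.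
Proof.
move=> [fp mp] h0.
transitivity (\int[mu]_x (\sum_(u \in range p) h u * (\1_(p @^-1` [set u]) x)%:E)%E)%E.
  apply: eq_integral => x _.
  rewrite (fsbigD1 (p x))//=; last by exists x.
  rewrite indicE mem_set// mule1 fsbig1 ?adde0// => u [_ /= pu].
  by rewrite indicE memNset ?mule0// => /= e; apply: pu.
rewrite ge0_integral_fsum//.
- apply: eq_fsbigr => u _; rewrite ge0_integralZl//.
    by rewrite integral_indic// setIT.
  by apply/measurable_EFinP; exact: measurable_indic.
- move=> u; apply: emeasurable_funM; first exact: measurable_cst.
  by apply/measurable_EFinP; exact: measurable_indic.
- by move=> u x _; rewrite mule_ge0// lee_fin.
Qed.

Context {V : lmodType K[i]}.

(** The integral may be computed on any partition refining the level sets, pieces with equal values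
    being merged; additivity follows by passing to a common refinement. *)
Lemma simple_integral_comp {U : choiceType} (p : T -> U) (phi : U -> V) :
  finite_partition p -> simple_integral mu (phi \o p) =
  \sum_(u \in range p) (fine (mu (p @^-1` [set u])))%:C *: phi u.
Proof.
move=> fmp; have [fp mp] := fmp.
have [fq mq] := finite_partition_comp phi fmp.
rewrite /simple_integral fsbig_finite// [RHS]fsbig_finite//=.
have e v : fine (mu ((phi \o p) @^-1` [set v])) =
    \sum_(u <- finmap.enum_fset (fset_set (range p)) | phi u == v) fine (mu (p @^-1` [set u])).
  rewrite (_ : _ @^-1` _ = \bigcup_(u in range p `&` phi @^-1` [set v]) p @^-1` [set u]).
    rewrite measure_fin_bigcup//; [|exact: finite_setIl|].
      rewrite fsbig_mkcondr fsbig_finite//= [RHS]big_mkcond/= -sum_fine.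
        apply: eq_bigr => u _; rewrite /patch; case: ifPn => [|].
          by rewrite inE /= => ->; rewrite eqxx.
        by rewrite notin_setE /= => /eqP/negbTE ->.
      by move=> u _; rewrite /patch; case: ifP => // _; exact: mu_fin_num.
    by move=> u u' _ _ [x [/= <- <-]].
  apply/seteqP; split=> [x /= xv|x [u [_ /= uv] /= xu]]; last by rewrite /= xu.
  by exists (p x) => //; split.
under eq_bigr => v _ do rewrite e rmorph_sum scaler_suml.
rewrite (exchange_big_dep xpredT)//=; apply: eq_big_seq => u.
rewrite in_fset_set// inE => -[x _ xu].
rewrite big_mkcond (bigD1_seq (phi u)) //=; last 2 first.
- by rewrite in_fset_set// inE; exists x => //=; rewrite xu.
- exact: finmap.fset_uniq.
by rewrite eqxx big1 ?addr0// => v; rewrite eq_sym => /negbTE ->.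
Qed.

End finite_range.
Record extended_norm {K : realType} {V : lmodType K[i]} (N : V -> \bar K) : Prop :=
  ExtendedNorm {
  en_ge0 : forall v, (0 <= N v)%E ;
  en_0 : N 0 = 0%E ;
  en_D : forall u v, (N (u + v)%R <= N u + N v)%E ;
  en_Z : forall a v, (N (a *: v)%R <= (normc a)%:E * N v)%E ;
  en_eq0 : forall v, N v = 0%E -> v = 0 }.

Section bochner_theory.
Context {d : measure_display} {T : measurableType d} {K : realType}.
Variable mu : {measure set T -> \bar K}.
Hypothesis mufin : (mu setT < +oo)%E.
Context {V : lmodType K[i]}.
Variable N : V -> \bar K.
Hypothesis NN : extended_norm N.
Implicit Types (f s : T -> V) (I : V) (g h : T -> \bar K).

Lemma en_N v : N (- v) = N v.
Proof.
have h w : (N (- w) <= N w)%E.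
  rewrite -scaleN1r (le_trans (en_Z NN _ _))//.
  by rewrite normcN Normc.normc1 mul1e.
by apply/eqP; rewrite eq_le h -{1}(opprK v) h.
Qed.

Lemma en_BC u v : N (u - v) = N (v - u).
Proof. by rewrite -en_N opprB. Qed.

Lemma en_BD u v w : (N (u - w)%R <= N (u - v)%R + N (v - w)%R)%E.
Proof.
have -> : u - w = (u - v) + (v - w) by rewrite addrA subrK.
exact: en_D NN _ _.
Qed.

Lemma en_sum (I : Type) (r : seq I) (F : I -> V) :
  (N (\sum_(i <- r) F i)%R <= \sum_(i <- r) N (F i))%E.
Proof.
elim/big_rec2 : _ => [|i u v _ h]; first by rewrite (en_0 NN).
by rewrite (le_trans (en_D NN _ _))// leeD2l.
Qed.

(* No measurability is required: the integral of a nonnegative function is a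
   supremum over the simple functions below it. *)
Lemma ge0_le_lower_integral g h : (forall x, 0 <= g x)%E -> (forall x, g x <= h x)%E ->
  (\int[mu]_x g x <= \int[mu]_x h x)%E.
Proof.
move=> g0 gh; rewrite !ge0_integralTE// => [|x]; last exact: le_trans (gh x).
apply: le_ereal_sup => _ [k kg <-]; exists k => // x.
exact: le_trans (kg x) (gh x).
Qed.

Lemma simple_fun_comp {U : choiceType} (p : T -> U) (phi : U -> V) :
  finite_partition p -> (forall u, range p u -> N (phi u) < +oo)%E ->
  simple_fun mu N (phi \o p).
Proof.
move=> fp pN; have [fq mq] := finite_partition_comp phi fp.
split=> // v; split=> [|_|[x _ <-]]; first exact: mq.
  by have := mu_fin_num mufin (mq v); rewrite ge0_fin_numE.
by apply: pN; exists x.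
Qed.

Lemma simple_fun_partition s : simple_fun mu N s -> finite_partition s.
Proof. by move=> [fs sP]; split=> // v; case: (sP v). Qed.

Lemma simple_fun_fin s x : simple_fun mu N s -> (N (s x) < +oo)%E.
Proof. by move=> [_ sP]; case: (sP (s x)) => _ _; apply; exists x. Qed.

Lemma simple_funD s s' : simple_fun mu N s -> simple_fun mu N s' ->
  simple_fun mu N (fun x => s x + s' x) /\
  simple_integral mu (fun x => s x + s' x) =
    simple_integral mu s + simple_integral mu s'.
Proof.
move=> hs hs'; have fp := simple_fun_partition hs; have fq := simple_fun_partition hs'.
have fpq := finite_partition_pair fp fq.
split.
  apply: (@simple_fun_comp _ _ (fun q => q.1 + q.2) fpq) => _ [x _ <-] /=.
  by rewrite (le_lt_trans (en_D NN _ _))// lte_add_pinfty//; exact: simple_fun_fin.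
rewrite (simple_integral_comp mufin (fun q => q.1 + q.2) fpq).
rewrite (simple_integral_comp mufin fst fpq) (simple_integral_comp mufin snd fpq).
rewrite -fsbig_split; last by case: fpq.
by apply: eq_fsbigr => q _; rewrite scalerDr.
Qed.

Lemma simple_fun_map (Phi : V -> V) (C : K) s :
  (forall a u v, Phi (a *: u + v) = a *: Phi u + Phi v) ->
  0 <= C -> (forall v, (N (Phi v) <= C%:E * N v)%E) -> simple_fun mu N s ->
  simple_fun mu N (Phi \o s) /\
  simple_integral mu (Phi \o s) = Phi (simple_integral mu s).
Proof.
move=> Pl C0 PC hs; have fp := simple_fun_partition hs.
have P0 : Phi 0 = 0 by have := Pl (-1) 0 0; rewrite scaler0 addr0 scaleN1r addNr.
split.
  apply: (simple_fun_comp fp) => _ [x _ <-] /=.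
  rewrite (le_lt_trans (PC _))// lte_mul_pinfty//; exact: simple_fun_fin.
rewrite (simple_integral_comp mufin Phi fp) (simple_integral_comp mufin id fp).
rewrite fsbig_finite; last by case: fp.
rewrite [in RHS]fsbig_finite; last by case: fp.
elim/big_rec2 : _ => [|v u w _ ->]; first by rewrite P0.
by rewrite Pl.
Qed.

Lemma simple_integral_norm s : simple_fun mu N s ->
  (N (simple_integral mu s) <= \int[mu]_x N (s x))%E.
Proof.
move=> hs; have fp := simple_fun_partition hs.
rewrite (simple_integral_comp mufin id fp) (integral_finite_partition mu fp (en_ge0 NN)).
rewrite fsbig_finite; last by case: fp.
rewrite [leRHS]fsbig_finite; last by case: fp.
rewrite (le_trans (en_sum _ _))//; apply: lee_sum => v _.
rewrite (le_trans (en_Z NN _ _))// normc_real ger0_norm ?fine_ge0//.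
rewrite fineK; first by rewrite muleC.
by apply: mu_fin_num => //; case: fp.
Qed.

Lemma simple_fun_norm_integral s : simple_fun mu N s ->
  measurable_fun setT (fun x => N (s x)) /\ (\int[mu]_x N (s x) < +oo)%E.
Proof.
move=> hs; have fp := simple_fun_partition hs; split.
  exact: (measurable_finite_partition N fp).
rewrite (integral_finite_partition mu fp (en_ge0 NN)).
rewrite fsbig_finite; last by case: fp.
rewrite -ge0_fin_numE; last by apply: sume_ge0 => v _; rewrite mule_ge0// (en_ge0 NN).
apply/sum_fin_numP => v; rewrite in_fset_set; last by case: fp.
rewrite inE => -[x _ <-] _.
rewrite fin_numM//; last by apply: mu_fin_num => //; case: fp.
by rewrite ge0_fin_numE; [exact: simple_fun_fin|exact: en_ge0].
Qed.

(** The working form of [is_bochner_integral]. As N (f - s) need not be measurable, its integral is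
    not known to be additive; a measurable majorant g of small integral takes its place. The two
    notions are equivalent by [is_bochner_approx] and [approx_is_bochner]. *)
Definition approx_integral f I := forall e : K, 0 < e -> exists s g,
  [/\ simple_fun mu N s, measurable_fun setT g /\ (forall x, 0 <= g x)%E,
      (forall x, N (f x - s x) <= g x)%E, (\int[mu]_x g x <= e%:E)%E &
      (N (simple_integral mu s - I) <= e%:E)%E].

Lemma approx_integralD f f' I I' : approx_integral f I -> approx_integral f' I' ->
  approx_integral (fun x => f x + f' x) (I + I').
Proof.
move=> h h' e e0; have e20 : 0 < e / 2 by rewrite divr_gt0.
have [s [g [hs [mg g0] fg ig iI]]] := h _ e20.
have [s' [g' [hs' [mg' g0'] fg' ig' iI']]] := h' _ e20.
have [hss iss] := simple_funD hs hs'.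
exists (fun x => s x + s' x), (fun x => g x + g' x)%E; split=> //.
- split; first exact: emeasurable_funD.
  by move=> x; rewrite adde_ge0.
- by move=> x; rewrite opprD addrACA (le_trans (en_D NN _ _))// leeD.
- by rewrite ge0_integralD// [e]splitr EFinD leeD.
- by rewrite iss opprD addrACA [e]splitr EFinD (le_trans (en_D NN _ _))// leeD.
Qed.

Lemma approx_integral_map (Phi : V -> V) (C : K) f I :
  (forall a u v, Phi (a *: u + v) = a *: Phi u + Phi v) ->
  0 <= C -> (forall v, (N (Phi v) <= C%:E * N v)%E) ->
  approx_integral f I -> approx_integral (Phi \o f) (Phi I).
Proof.
move=> Pl C0 PC h e e0.
have PB u v : Phi (u - v) = Phi u - Phi v.
  by rewrite addrC -scaleN1r Pl scaleN1r addrC.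
have e10 : 0 < e / (C + 1) by rewrite divr_gt0// ltr_wpDl.
have [s [g [hs [mg g0] fg ig iI]]] := h _ e10.
have [hps ips] := simple_fun_map Pl C0 PC hs.
have Ce : C * (e / (C + 1)) <= e.
  by rewrite mulrA ler_pdivrMr ?ltr_wpDl// mulrC ler_pM2l//; lra.
exists (Phi \o s), (fun x => C%:E * g x)%E; split=> //.
- split; first exact: measurable_funeM.
  by move=> x; rewrite mule_ge0// lee_fin.
- by move=> x /=; rewrite -PB (le_trans (PC _))// lee_wpmul2l// lee_fin.
- rewrite ge0_integralZl ?lee_fin//; apply: (@le_trans _ _ (C%:E * (e / (C + 1))%:E)%E).
    by rewrite lee_wpmul2l// lee_fin.
  by rewrite -EFinM lee_fin.
- rewrite ips -PB (le_trans (PC _))//.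
  apply: (@le_trans _ _ (C%:E * (e / (C + 1))%:E)%E).
    by rewrite lee_wpmul2l// lee_fin.
  by rewrite -EFinM lee_fin.
Qed.

Lemma approx_integral_norm f I h : measurable_fun setT h -> (forall x, 0 <= h x)%E ->
  approx_integral f I -> (forall x, N (f x) <= h x)%E -> (N I <= \int[mu]_x h x)%E.
Proof.
move=> mh h0 fI fh; apply/lee_addgt0Pr => e e0.
have e20 : 0 < e / 2 by rewrite divr_gt0.
have [s [g [hs [mg g0] fg ig iI]]] := fI _ e20.
have -> : I = simple_integral mu s - (simple_integral mu s - I) by rewrite opprB addrC subrK.
rewrite (le_trans (en_D NN _ _))// en_N [e]splitr EFinD addeA leeD//.
rewrite (le_trans (simple_integral_norm hs))//.
apply: (@le_trans _ _ (\int[mu]_x (h x + g x))%E).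
  apply: ge0_le_lower_integral => x; first exact: en_ge0.
  have -> : s x = f x - (f x - s x) by rewrite opprB addrC subrK.
  by rewrite (le_trans (en_D NN _ _))// en_N leeD.
by rewrite ge0_integralD// leeD2l.
Qed.

Lemma approx_integral0 : approx_integral (fun=> 0) 0.
Proof.
move=> e e0; exists (fun=> 0), (fun=> 0%E).
have fp : finite_partition (fun _ : T => tt).
  split=> [|u]; first by apply: (sub_finite_set _ (finite_set1 tt)) => -[].
  by rewrite (_ : _ @^-1` _ = setT)//; apply/seteqP; split=> // x; case: u.
have hs : simple_fun mu N (fun=> 0).
  by apply: (@simple_fun_comp _ _ (fun=> 0) fp) => u _; rewrite (en_0 NN).
split=> //.
- by move=> x; rewrite subrr (en_0 NN).
- by rewrite integral0 lee_fin ltW.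
- have := simple_integral_norm hs.
  have -> : (\int[mu]_x N 0 = 0)%E by under eq_integral do rewrite (en_0 NN); exact: integral0.
  by rewrite subr0 => /le_trans; apply; rewrite lee_fin ltW.
Qed.

Lemma approx_integral_uniq f I I' :
  approx_integral f I -> approx_integral f I' -> I = I'.
Proof.
move=> h h'; apply/subr0_eq/(en_eq0 NN)/eqP; rewrite eq_le (en_ge0 NN) andbT.
have h2 : approx_integral (fun x => f x + - f x) (I - I').
  apply: approx_integralD => //; apply: (@approx_integral_map -%R 1) => //.
  - by move=> a u v; rewrite opprD scalerN.
  - by move=> v; rewrite en_N mul1e.
have := @approx_integral_norm _ _ (fun=> 0%E) _ _ h2.
rewrite integral0; apply=> // x.
by rewrite subrr (en_0 NN).
Qed.

Lemma approx_integral_dom f I : approx_integral f I -> exists h,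
  [/\ measurable_fun setT h, (forall x, 0 <= h x)%E, (forall x, N (f x) <= h x)%E &
      (\int[mu]_x h x < +oo)%E].
Proof.
move=> /(_ 1 ltr01)[s [g [hs [mg g0] fg ig _]]].
have [ms si] := simple_fun_norm_integral hs.
exists (fun x => N (s x) + g x)%E; split.
- exact: emeasurable_funD.
- by move=> x; rewrite adde_ge0// (en_ge0 NN).
- move=> x; have -> : f x = s x + (f x - s x) by rewrite addrC subrK.
  by rewrite (le_trans (en_D NN _ _))// leeD2l.
- rewrite ge0_integralD// => [|x _]; last exact: en_ge0.
  by rewrite lte_add_pinfty// (le_lt_trans ig)// ltry.
Qed.

Lemma approx_integral_limit f I : (forall e : K, 0 < e -> exists f' I' h,
    [/\ approx_integral f' I', measurable_fun setT h /\ (forall x, 0 <= h x)%E,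
        (forall x, N (f x - f' x) <= h x)%E, (\int[mu]_x h x <= e%:E)%E &
        (N (I' - I) <= e%:E)%E]) -> approx_integral f I.
Proof.
move=> H e e0; have e20 : 0 < e / 2 by rewrite divr_gt0.
have [f' [I' [h [fI' [mh h0] fh ih II]]]] := H _ e20.
have [s [g [hs [mg g0] fg ig iI]]] := fI' _ e20.
exists s, (fun x => h x + g x)%E; split=> //.
- split; first exact: emeasurable_funD.
  by move=> x; rewrite adde_ge0.
- by move=> x; rewrite (le_trans (en_BD _ (f' x) _))// leeD.
- by rewrite ge0_integralD// [e]splitr EFinD leeD.
- by rewrite (le_trans (en_BD _ I' _))// [e]splitr EFinD leeD.
Qed.

End bochner_theory.
Section bochner_approx.
Context {d : measure_display} {T : measurableType d} {K : realType}.
Variable mu : {measure set T -> \bar K}.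
Hypothesis mufin : (mu setT < +oo)%E.
Context {V : lmodType K[i]}.
Variable N : V -> \bar K.
Hypothesis NN : extended_norm N.
Implicit Types (f : T -> V) (I : V).

Lemma cvge0_lt (u : nat -> \bar K) (e : K) : (forall n, 0 <= u n)%E ->
  u @ \oo --> 0%E -> 0 < e -> \forall n \near \oo, (u n < e%:E)%E.
Proof.
move=> u0 /fine_cvgP[uf] /cvgrPdist_lt h e0; have := h _ e0.
move: uf; apply: filterS2 => n fn /=; rewrite sub0r normrN => he.
by rewrite -(fineK fn) lte_fin (le_lt_trans (ler_norm _)).
Qed.

Lemma squeezee (u v w : nat -> \bar K) (l : \bar K) :
  (\forall n \near \oo, (u n <= v n <= w n)%E) ->
  u @ \oo --> l -> w @ \oo --> l -> v @ \oo --> l.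
Proof. by move=> h hu hw; apply: (squeeze_cvge h hu hw). Qed.

(** Off the null set A, N (f - s n) is the pointwise limit of the measurable N (s k - s n), hence
    measurable; on A the majorant is set to +oo, which does not change its integral. *)
Lemma is_bochner_approx f I : is_bochner_integral mu N f I -> approx_integral mu N f I.
Proof.
move=> [s [hs [A [mA A0 cA]] hi hI]] e e0.
have n1 : \forall n \near \oo, (\int[mu]_x N (f x - s n x) < e%:E)%E.
  by apply: cvge0_lt => // n; apply: integral_ge0 => x _; exact: en_ge0.
have n2 : \forall n \near \oo, (N (simple_integral mu (s n) - I) < e%:E)%E.
  by apply: cvge0_lt => // n; exact: en_ge0.
have [n _ hn] := filterI n1 n2; have [/ltW h1 /ltW h2] := hn n (leqnn n).
pose F x := N (f x - s n x).
have cvA x : (~` A) x -> (fun k => N (f x - s k x)) @ \oo --> 0%E.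
  by move=> nA; apply: contrapT => h; apply: nA; exact: cA.
have mF : measurable_fun (~` A) F.
  apply: (@emeasurable_fun_cvg _ _ _ _ (fun k x => N (s k x - s n x))).
    move=> k; apply: measurable_funTS.
    exact: (measurable_finite_partition (fun q => N (q.1 - q.2))
      (finite_partition_pair (simple_fun_partition (hs k)) (simple_fun_partition (hs n)))).
  move=> x nA; have cx := cvA x nA.
  have vfin k : (N (s k x - s n x) < +oo)%E.
    apply: le_lt_trans (en_D NN _ _) _.
    have h3 := simple_fun_fin x (hs k); have h4 := simple_fun_fin x (hs n).
    by rewrite (en_N NN) lte_add_pinfty.
  have ufin : \forall k \near \oo, N (f x - s k x) \is a fin_num.
    have := cvge0_lt (fun k => en_ge0 NN _) cx ltr01.
    by apply: filterS => k hk; rewrite ge0_fin_numE ?(en_ge0 NN)// (lt_trans hk)// ltry.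
  have Ffin : F x \is a fin_num.
    have [k _ hk] := ufin; have {}hk := hk k (leqnn k).
    rewrite ge0_fin_numE; last exact: en_ge0.
    rewrite (le_lt_trans (en_BD NN _ (s k x) _))// lte_add_pinfty ?vfin//.
    by rewrite -ge0_fin_numE// (en_ge0 NN).
  apply: (@squeezee (fun k => F x - N (f x - s k x))%E
      (fun k => N (s k x - s n x))
      (fun k => F x + N (f x - s k x))%E (F x)).
  - move: ufin; apply: filterS => k uk; apply/andP; split.
      by rewrite leeBlDr// addeC; exact: en_BD.
    by rewrite addeC [X in (_ <= X + _)%E](en_BC NN); exact: en_BD.
  - rewrite -[X in _ --> X]sube0; apply: cvgeB => //; last exact: cvg_cst.
    by rewrite fin_num_adde_defr.
  - rewrite -[X in _ --> X]adde0; apply: cvgeD => //; last exact: cvg_cst.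
    by rewrite fin_num_adde_defl.
pose g x := if x \in A then +oo%E else F x.
have g0 x : (0 <= g x)%E by rewrite /g; case: ifP => // _; exact: en_ge0.
have mg : measurable_fun setT g.
  rewrite -(setvU A); apply/measurable_funU => //; first exact: measurableC.
  split.
    apply: eq_measurable_fun mF => x; rewrite inE /= => nA.
    by rewrite /g memNset.
  apply: (@eq_measurable_fun _ _ _ _ _ (cst +oo%E)); last exact: measurable_cst.
  by move=> x xA; rewrite /g xA.
exists (s n), g; split=> //.
- by move=> x; rewrite /g; case: ifP => // _; rewrite leey.
- rewrite (ge0_negligible_integral mA)// integral_mkcond; apply: le_trans h1.
  apply: ge0_le_lower_integral => x; rewrite /patch; case: ifPn => //.
  by rewrite inE /= => -[_ nA]; rewrite /g memNset.
  by move=> _; exact: en_ge0.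
Qed.

(** The errors 1 / 2^(k+1) are summable, so the sum of the majorants g k is integrable and therefore
    finite almost everywhere; where it is finite, g k tends to 0. *)
Lemma approx_is_bochner f I : approx_integral mu N f I -> is_bochner_integral mu N f I.
Proof.
move=> h; pose e k : K := 1 / (2 ^ k.+1)%:R.
have e0 k : 0 < e k by rewrite divr_gt0// ltr0n expn_gt0.
have ecvg : e @ \oo --> (0 : K).
  apply: (@cvg_series_cvg_0 _ K^o).
  apply: nnseries_is_cvg => [i|]; first exact: ltW.
  by rewrite (le_lt_trans (epsilon_trick0 _ ler01))// ltry.
have eecvg : (fun k => (e k)%:E) @ \oo --> 0%E.
  by apply: cvg_EFin => //; exact: nearW.
have /choice[s /choice[g hsg]] := fun k => h (e k) (e0 k).
have mg k : measurable_fun setT (g k) by have [_ []] := hsg k.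
have g0 k x : (0 <= g k x)%E by have [_ [_ ]] := hsg k.
have sq (u : nat -> \bar K) : (forall k, 0 <= u k <= (e k)%:E)%E -> u @ \oo --> 0%E.
  move=> hu; apply: (@squeezee (cst 0%E) _ (fun k => (e k)%:E)) => //.
    by apply: nearW => k; exact: hu.
  exact: cvg_cst.
exists s; split.
- by move=> n; have [] := hsg n.
- pose G x := (\sum_(k <oo) g k x)%E.
  have mG : measurable_fun setT G by apply: ge0_emeasurable_sum.
  have G0 x : (0 <= G x)%E by apply: nneseries_ge0 => k _ _; exact: g0.
  have iG : mu.-integrable setT G.
    apply/integrableP; split=> //.
    under eq_integral do rewrite gee0_abs//.
    rewrite integral_nneseries//.
    apply: (@le_lt_trans _ _ (\sum_(k <oo) (e k)%:E)%E).
      apply: lee_nneseries => [k _ _|k _]; first exact: integral_ge0.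
      by have [_ _ _] := hsg k.
    by rewrite (le_lt_trans (epsilon_trick0 _ ler01))// ltry.
  have := integrable_ae measurableT iG; apply: filterS => x /(_ Logic.I) Gx.
  apply: (@squeezee (cst 0%E) _ (g ^~ x)); last 2 first.
  + exact: cvg_cst.
  + have gfin k : g k x \is a fin_num.
      rewrite ge0_fin_numE// (@le_lt_trans _ _ (G x))//; last by rewrite -ge0_fin_numE.
      by rewrite /G (@nneseriesD1 _ (g ^~ x) k) //= leeDl// nneseries_ge0.
    apply/fine_cvgP; split; first by apply: nearW.
    apply: (@cvg_series_cvg_0 _ K^o); apply: nnseries_is_cvg => [i|].
      exact: fine_ge0.
    rewrite (_ : (\sum_(_ <= _ <oo) _)%E = G x); first by rewrite -ge0_fin_numE.
    by apply: eq_eseriesr => k _; rewrite fineK.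
  + apply: nearW => k; rewrite (en_ge0 NN)/=.
    by have [_ _ ] := hsg k.
- apply: sq => k; have [_ _ fg ig _] := hsg k; apply/andP; split.
    by apply: integral_ge0 => x _; exact: en_ge0.
  apply: le_trans ig; apply: ge0_le_lower_integral => // x; exact: en_ge0.
- by apply: sq => k; have [_ _ _ _ ->] := hsg k; rewrite (en_ge0 NN).
Qed.

Lemma bochner_integralE f I : approx_integral mu N f I -> bochner_integral mu N f = I.
Proof.
move=> h; have /(xgetPex 0)/is_bochner_approx h2 :
  exists I, is_bochner_integral mu N f I by exists I; exact: approx_is_bochner.
exact: approx_integral_uniq h2 h.
Qed.

End bochner_approx.
(** * The torus *)

Section circle.
Context {K : realType}.
Implicit Types (x y t : K) (h k : int) (l : torus K).

Definition cis t : K[i] := cos t +i* sin t.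

Lemma cis0 : cis 0 = 1.
Proof. by rewrite /cis cos0 sin0. Qed.

Lemma cisD x y : cis (x + y) = cis x * cis y.
Proof. by rewrite /cis cosD sinD; congr (_ +i* _); rewrite addrC. Qed.

Lemma cisN x : cis (- x) = conjc (cis x).
Proof. by rewrite /cis cosN sinN. Qed.

Lemma normc_cis x : normc (cis x) = 1.
Proof. by rewrite /= cos2Dsin2 sqrtr1. Qed.

Lemma cis2pi k : cis (k%:~R * (2 * pi)) = 1.
Proof.
have h n : cis (n%:R * (2 * pi)) = 1.
  elim: n => [|n IH]; first by rewrite mul0r cis0.
  rewrite -natr1 mulrDl mul1r cisD IH mul1r /cis mulr_natl.
  by rewrite cos2pi sin2pi.
case: k => n; first exact: h.
by rewrite NegzE mulrNz mulNr cisN h conjc1.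
Qed.

Lemma cisX x n : cis x ^+ n = cis (n%:R * x).
Proof.
elim: n => [|n IH]; first by rewrite expr0 mul0r cis0.
by rewrite exprSr IH -cisD -natr1 mulrDl mul1r.
Qed.

Lemma pi2_gt0 : 0 < 2 * pi :> K.
Proof. by rewrite mulr_gt0// pi_gt0. Qed.

Lemma mod2pi x : exists k, 0 <= x - k%:~R * (2 * pi) < 2 * pi.
Proof.
exists (Num.floor (x / (2 * pi))).
have := floor_le_tmp (x / (2 * pi)); have := floorD1_gt (x / (2 * pi)).
rewrite ltr_pdivrMr ?pi2_gt0// ler_pdivlMr ?pi2_gt0// intrD mulrDl mul1r.
by rewrite subr_ge0 ltrBlDl => h1 h2; rewrite h2 addrC; rewrite addrC in h1; lra.
Qed.

(** Modulo 2 pi, t becomes u in [0, 2 pi), where cos u = 1 - 2 sin (u / 2)^2 and sin (u / 2) > 0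
    unless u = 0. *)
Lemma cos_eq1 t : cos t = 1 -> exists k, t = k%:~R * (2 * pi).
Proof.
move=> t1; have [k /andP[h1 h2]] := mod2pi t; exists k.
set u := t - _ in h1 h2.
have u1 : cos u = 1.
  have := cisD t (- (k%:~R * (2 * pi))); rewrite -/u cisN cis2pi conjc1 mulr1.
  by rewrite /cis t1 => -[].
have [u0|u0] := eqVneq u 0; first by apply/eqP; rewrite -subr_eq0 -/u u0.
have up : 0 < u by rewrite lt_neqAle eq_sym u0.
have s0 : 0 < sin (u / 2) by apply: sin_gt0_pi; apply/andP; split; lra.
have e : (u / 2) *+ 2 = u by rewrite -mulr_natr divfK.
have := cos_mulr2n (u / 2); rewrite e u1 cos2sin2 -mulr_natr => h3.
by have := exprn_gt0 2 s0; lra.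
Qed.

Lemma torus_piP x y : torus_pi x = torus_pi y <-> exists k, x - y = k%:~R * (2 * pi).
Proof.
have h : torus_pi x = torus_pi y <-> torus_rel x y.
  by split=> [/generic_quotient.eqmodP|h]//; apply/generic_quotient.eqmodP.
by apply: (iff_trans h); split=> [/asboolP//|?]; exact/asboolP.
Qed.

Lemma torus_reprK l : torus_pi (torus_repr l) = l.
Proof. exact: generic_quotient.reprK. Qed.

Lemma torus_repr_pi x : exists k, torus_repr (torus_pi x) = x + k%:~R * (2 * pi).
Proof.
have /torus_piP[k h] := torus_reprK (torus_pi x).
by exists k; rewrite -h addrC subrK.
Qed.

Lemma torus_exp_cis h x : torus_exp h (torus_pi x) = cis (h%:~R * x).
Proof.
rewrite /torus_exp -/(cis _); have [k ->] := torus_repr_pi x.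
by rewrite mulrDr mulrA -intrM cisD cis2pi mulr1.
Qed.

Lemma torus_expE h l : torus_exp h l = cis (h%:~R * torus_repr l).
Proof. by []. Qed.

Lemma torus_expD h k l : torus_exp (h + k) l = torus_exp h l * torus_exp k l.
Proof. by rewrite !torus_expE intrD mulrDl cisD. Qed.

Lemma torus_expN h l : torus_exp (- h) l = conjc (torus_exp h l).
Proof. by rewrite !torus_expE mulrNz mulNr cisN. Qed.

Lemma torus_exp0 l : torus_exp 0 l = 1.
Proof. by rewrite torus_expE mul0r cis0. Qed.

Lemma normc_torus_exp h l : normc (torus_exp h l) = 1.
Proof. exact: normc_cis. Qed.

(* The squared chordal distance between e^{i l} and e^{i l'}. *)
Definition chord2 l l' : K := 2 - 2 * cos (torus_repr l - torus_repr l').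

Lemma chord2_ge0 l l' : 0 <= chord2 l l'.
Proof. by rewrite /chord2; have := cos_le1 (torus_repr l - torus_repr l'); lra. Qed.

Lemma chord2_eq0 l l' : chord2 l l' = 0 -> l = l'.
Proof.
rewrite /chord2 => h; have /cos_eq1[k hk] : cos (torus_repr l - torus_repr l') = 1 by lra.
by rewrite -(torus_reprK l) -(torus_reprK l'); apply/torus_piP; exists k.
Qed.

Lemma chord2E l l' : chord2 l l' = 2 - 2 * (complex.Re (torus_exp 1 l) * complex.Re (torus_exp 1 l')
   + complex.Im (torus_exp 1 l) * complex.Im (torus_exp 1 l')).
Proof. by rewrite /chord2 cosB !torus_expE !mul1r. Qed.

Lemma chord2_normc l l' : normc (torus_exp 1 l - torus_exp 1 l') ^+ 2 = chord2 l l'.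
Proof.
rewrite normc_sqr chord2E !torus_expE !mul1r /=.
have := cos2Dsin2 (torus_repr l); have := cos2Dsin2 (torus_repr l').
by move: (cos _) (sin _) (cos _) (sin _) => a b c e h1 h2; nra.
Qed.

Lemma torus_pi_continuous : continuous (@torus_pi K).
Proof. exact: pi_continuous. Qed.

Lemma torus_continuous {Z : topologicalType} (f : torus K -> Z) :
  continuous (f \o @torus_pi K) -> continuous f.
Proof. by move=> h; apply/quotient_continuous. Qed.

Lemma continuous_torus_Re h : continuous (fun l => complex.Re (torus_exp h l)).
Proof.
apply: torus_continuous => x.
rewrite (_ : _ \o _ = cos \o (fun x => h%:~R * x)).
  by apply: continuous_comp; [exact: mulrl_continuous|exact: continuous_cos].
apply/funext => y; rewrite -[LHS]/(complex.Re (torus_exp h (torus_pi y))).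
by rewrite torus_exp_cis.
Qed.

Lemma continuous_torus_Im h : continuous (fun l => complex.Im (torus_exp h l)).
Proof.
apply: torus_continuous => x.
rewrite (_ : _ \o _ = sin \o (fun x => h%:~R * x)).
  by apply: continuous_comp; [exact: mulrl_continuous|exact: continuous_sin].
apply/funext => y; rewrite -[LHS]/(complex.Im (torus_exp h (torus_pi y))).
by rewrite torus_exp_cis.
Qed.

Lemma torus_compact : compact [set: torus K].
Proof.
have -> : [set: torus K] = @torus_pi K @` `[0, 2 * pi].
  apply/seteqP; split=> // l _; have [k /andP[h1 h2]] := mod2pi (torus_repr l).
  exists (torus_repr l - k%:~R * (2 * pi)); first by rewrite /= in_itv /= h1 ltW.
  rewrite -[RHS]torus_reprK; apply/torus_piP; exists (- k).
  by rewrite mulrNz mulNr addrC addKr.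
apply: continuous_compact; last exact: segment_compact.
exact/continuous_subspaceT/torus_pi_continuous.
Qed.

(** [torus_repr] is an arbitrary section, so continuity is read off the expression of [chord2] by
    real and imaginary parts of exponentials, which are continuous on the quotient. *)
Lemma chord2_near l l' (e : K) : 0 < e -> \forall q \near (l, l'),
  `|chord2 q.1 q.2 - chord2 l l'| < e.
Proof.
move=> e0; pose F (q : torus K * torus K) := chord2 q.1 q.2.
have cF : F @ (l, l') --> F (l, l').
  have -> : F = fun q => 2 - 2 * (complex.Re (torus_exp 1 q.1) * complex.Re (torus_exp 1 q.2)
       + complex.Im (torus_exp 1 q.1) * complex.Im (torus_exp 1 q.2)).
    by apply/funext => q; rewrite /F chord2E.
  have c1 (f : torus K -> K) : continuous f -> f q.1 @[q --> (l, l')] --> f l.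
    by move=> cf; apply: (@cvg_comp _ _ _ fst f _ (nbhs l)); [exact: cvg_fst|exact: cf].
  have c2 (f : torus K -> K) : continuous f -> f q.2 @[q --> (l, l')] --> f l'.
    by move=> cf; apply: (@cvg_comp _ _ _ snd f _ (nbhs l')); [exact: cvg_snd|exact: cf].
  apply: cvgB; first exact: cvg_cst.
  apply: cvgM; first exact: cvg_cst.
  apply: cvgD; apply: cvgM.
  - exact: (c1 _ (@continuous_torus_Re 1)).
  - exact: (c2 _ (@continuous_torus_Re 1)).
  - exact: (c1 _ (@continuous_torus_Im 1)).
  - exact: (c2 _ (@continuous_torus_Im 1)).
have := cF; move=> /cvgrPdist_lt /(_ _ e0).
by apply: filterS => q /=; rewrite distrC.
Qed.

(** A geometric sum with ratio z and z^M = 1; z = 1 would make M divide h, impossible for 0 < |h| <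
    M. *)
Lemma sum_root_of_unity (M : nat) (h : int) : (0 < `|h| < M)%N ->
  \sum_(j < M) cis (h%:~R * (j%:R * (2 * pi / M%:R))) = 0.
Proof.
move=> /andP[h0 hM]; have M0 : (0 < M)%N by exact: leq_ltn_trans hM.
have Mn0 : M%:R != 0 :> K by rewrite pnatr_eq0 -lt0n.
set z := cis (h%:~R * (2 * pi / M%:R)).
have -> : \sum_(j < M) cis (h%:~R * (j%:R * (2 * pi / M%:R))) = \sum_(j < M) z ^+ j.
  by apply: eq_bigr => j _; rewrite cisX mulrCA.
have zM : z ^+ M = 1.
  by rewrite cisX mulrCA [M%:R * _]mulrC divfK// cis2pi.
have z1 : z - 1 != 0.
  rewrite subr_eq0; apply/eqP => z1; have := z1; rewrite /z /cis => -[/cos_eq1[k hk] _].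
  have : h%:~R = k%:~R * M%:R :> K.
    have p0 : (2 * pi : K) != 0 by rewrite gt_eqF// pi2_gt0.
    have p1 : 2 * pi / M%:R != 0 :> K by rewrite mulf_neq0// invr_eq0.
    by apply: (mulIf p1); rewrite /= hk -[RHS]mulrA; congr (_ * _); rewrite [RHS]mulrC divfK.
  rewrite -[M%:R]/(M%:~R) -intrM => /eqP; rewrite eqr_int => /eqP hk'.
  move: h0 hM; rewrite hk' abszM /=; case: (`|k|%N) => // n _.
  by rewrite mulSn ltnNge leq_addr.
have := subrX1 z M; rewrite zM subrr => /esym/eqP.
by rewrite mulf_eq0 (negbTE z1) => /eqP.
Qed.

End circle.

(** * Continuous operator-valued functions on compact spaces *)

Section operator_algebra.
Context {K : realType} {H : hilbertType K}.
Implicit Types (S T : H -> H) (c : K).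

Lemma bndZ T (a : K[i]) c : bnd T c -> bnd (a *: T) (normc a * c).
Proof.
move=> [l b]; split=> [a' x y|x].
  by rewrite !fctE l scalerDr !scalerA [a * _]mulrC.
by rewrite fctE rnZ -mulrA ler_wpM2l ?normc_ge0.
Qed.

Lemma bndD S T c c' : bnd S c -> bnd T c' -> bnd (S + T) (c + c').
Proof.
move=> [l b] [l' b']; split=> [a x y|x].
  by rewrite !fctE l l' scalerDr addrACA.
by rewrite fctE (le_trans (rnD _ _))// mulrDl lerD.
Qed.

Lemma bndB S T c c' : bnd S c -> bnd T c' -> bnd (S - T) (c + c').
Proof.
move=> hS hT; rewrite -scaleN1r; apply: bndD => //.
by have := bndZ (-1) hT; rewrite normcN Normc.normc1 mul1r.
Qed.

Lemma bnd0 : bnd (0 : H -> H) 0.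
Proof.
split=> [a x y|x]; first by change (0 = a *: 0 + 0 :> H); rewrite scaler0 addr0.
by change (rn (0 : H) <= 0 * rn x); rewrite rn0 mul0r.
Qed.

Lemma bnd_sum I (r : seq I) (P : pred I) (F : I -> H -> H) (f : I -> K) :
  (forall i, P i -> bnd (F i) (f i)) ->
  bnd (\sum_(i <- r | P i) F i) (\sum_(i <- r | P i) f i).
Proof.
move=> h; elim/big_rec2 : _ => [|i u v Pi hv]; first exact: bnd0.
exact: bndD (h i Pi) hv.
Qed.

Lemma nat_ge (x : K) : exists n : nat, x <= n%:R.
Proof.
exists (Num.bound `|x|); rewrite (le_trans (ler_norm x))// ltW//.
exact: archi_boundP.
Qed.

(** Near each point every large integer is a bound, so the covering form of compactness yields one
    integer for all points. *)
Lemma in_C_bounded {Y : topologicalType} (F : Y -> H -> H) :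
  compact [set: Y] -> in_C opnorm F ->
  exists M, 0 <= M /\ forall p, bnd (F p) M.
Proof.
move=> /compact_near_coveringP cY [fF cF].
have : \forall n \near \oo, [set: Y] `<=` (fun p => bnd (F p) n%:R).
  apply: (cY nat \oo (fun n p => bnd (F p) n%:R)) => p _.
  have [c c0 hc] : exists2 c, 0 <= c & bnd (F p) c by apply/bounded_opP; exact: fF.
  have [N hN] := nat_ge (1 + c).
  exists ([set q | opnorm (F q - F p)%R < 1%:E]%E, [set n | (N <= n)%N]); first split => /=.
  - exact: cF.
  - by exists N.
  - move=> [q n] /= [/opnorm_lt[_ h] Nn].
    rewrite -[F q](subrK (F p)); apply: bnd_le (bndD h hc) _.
    by rewrite (le_trans hN)// ler_nat.
by move=> [n _ /(_ n (leqnn n)) h]; exists n%:R; split=> // p; exact: h.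
Qed.

(** Near the diagonal continuity gives e; away from it [chord2] is bounded below and a large C
    absorbs the trivial bound 2 M. Compactness makes C uniform. The term in [chord2] is one that
    Fejer's kernel makes small. *)
Lemma in_C_uniform_torus {E : topologicalType} (L : E * torus K -> H -> H) (e : K) :
  compact [set: E] -> in_C opnorm L -> 0 < e -> exists C, 0 <= C /\
    forall th l l', bnd (L (th, l) - L (th, l')) (e + C * chord2 l l').
Proof.
move=> cE iL e0; have cET : compact [set: E * torus K].
  by rewrite -setXTT; apply: compact_setX => //; exact: torus_compact.
have [M [M0 hM]] := in_C_bounded cET iL; have [_ cL] := iL.
have /compact_near_coveringP cY : compact [set: (E * torus K) * torus K].
  by rewrite -setXTT; apply: compact_setX => //; exact: torus_compact.
pose P (n : nat) (q : (E * torus K) * torus K) :=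
  bnd (L (q.1.1, q.1.2) - L (q.1.1, q.2)) (e + n%:R * chord2 q.1.2 q.2).
have : \forall n \near \oo, [set: (E * torus K) * torus K] `<=` P n.
  apply: (cY nat \oo P); move=> [[th l] l'] _.
  have [ll|ll] := pselect (l = l').
    rewrite -{l'}ll; have e20 : 0 < e / 2 by rewrite divr_gt0.
    have h := cL (th, l) _ e20.
    exists ([set q : (E * torus K) * torus K | (opnorm (L (q.1.1, q.1.2) - L (th, l))%R < (e / 2)%:E)%E /\
        (opnorm (L (q.1.1, q.2) - L (th, l))%R < (e / 2)%:E)%E], setT); first split => /=.
    - apply: filterI.
        have : (fun q : (E * torus K) * torus K => (q.1.1, q.1.2)) @ (th, l, l) --> (th, l).
          by rewrite (_ : (fun _ => _) = fst); [exact: cvg_fst|apply/funext => -[[]]].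
        by move=> /(_ _ h).
      have : (fun q : (E * torus K) * torus K => (q.1.1, q.2)) @ (th, l, l) --> (th, l).
        apply: (@cvg_pair _ _ _ _ (nbhs th) (nbhs l)); last exact: cvg_snd.
        by apply: (@cvg_comp _ _ _ fst fst _ (nbhs (th, l))); [exact: cvg_fst|exact: cvg_fst].
      by move=> /(_ _ h).
    - exact: filterT.
    - move=> [[[th' l1] l2] n] /= [[/opnorm_lt[_ h1] /opnorm_lt[_ h2]] _].
      rewrite /P /=; have -> : L (th', l1) - L (th', l2) =
        (L (th', l1) - L (th, l)) - (L (th', l2) - L (th, l)).
        by rewrite opprB addrA subrK.
      apply: bnd_le (bndB h1 h2) _.
      by rewrite -splitr lerDl mulr_ge0 ?chord2_ge0.
  pose dl := chord2 l l'.
  have d0 : 0 < dl.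
    by rewrite lt_neqAle chord2_ge0 andbT eq_sym; apply/eqP => /chord2_eq0.
  have d20 : 0 < dl / 2 by rewrite divr_gt0.
  have [N hN] := nat_ge ((M + M) / (dl / 2)).
  exists ([set q : (E * torus K) * torus K | `|chord2 q.1.2 q.2 - chord2 l l'| < dl / 2],
     [set n | (N <= n)%N]); first split => /=.
  - have : (fun q : (E * torus K) * torus K => (q.1.2, q.2)) @ (th, l, l') --> (l, l').
      apply: (@cvg_pair _ _ _ _ (nbhs l) (nbhs l')); last exact: cvg_snd.
      by apply: (@cvg_comp _ _ _ fst snd _ (nbhs (th, l))); [exact: cvg_fst|exact: cvg_snd].
    by move=> /(_ _ (chord2_near l l' d20)).
  - by exists N.
  - move=> [[[th' l1] l2] n] /= [h Nn]; rewrite /P /=.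
    apply: bnd_le (bndB (hM _) (hM _)) _.
    rewrite -[leLHS]add0r lerD ?(ltW e0)//.
    have h1 : dl / 2 <= chord2 l1 l2.
      by move: h; rewrite ltr_distl => /andP[h _]; rewrite -/dl in h; lra.
    rewrite ler_pdivrMr// in hN; apply: le_trans hN _.
    by apply: ler_pM => //; [exact: ltW|rewrite ler_nat].
move=> [n _ /(_ n (leqnn n)) h]; exists n%:R; split=> // th l l'.
exact: (h (th, l, l')).
Qed.

Lemma in_C_uniform_near {E : topologicalType} (L : E * torus K -> H -> H) th (e : K) :
  in_C opnorm L -> 0 < e ->
  \forall th' \near th, forall l, bnd (L (th', l) - L (th, l)) e.
Proof.
move=> [_ cL] e0; have e20 : 0 < e / 2 by rewrite divr_gt0.
have /compact_near_coveringP cY := @torus_compact K.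
pose P th' l := bnd (L (th', l) - L (th, l)) e.
have : \forall th' \near th, [set: torus K] `<=` P th'.
  apply: (cY E (nbhs th) P) => l _; have := cL (th, l) _ e20.
  move=> [[A B] [/= hA hB] hAB]; exists (B, A); first by split.
  move=> [l1 th1] /= [Bl Ath].
  have /opnorm_lt[_ h1] : (opnorm (L (th1, l1) - L (th, l))%R < (e / 2)%:E)%E by apply: (hAB (th1, l1)).
  have Ath0 : A th by exact: nbhs_singleton.
  have /opnorm_lt[_ h2] : (opnorm (L (th, l1) - L (th, l))%R < (e / 2)%:E)%E by apply: (hAB (th, l1)).
  rewrite /P (_ : _ - _ = (L (th1, l1) - L (th, l)) - (L (th, l1) - L (th, l))).
    by rewrite [e]splitr; exact: bndB.
  by rewrite opprB addrA subrK.
by apply: filterS => th' h l; exact: h.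
Qed.

End operator_algebra.

(** * Equal arcs of the torus and step functions *)

Section torus_partition.
Context {K : realType}.
Implicit Types (x y t : K) (l : torus K) (M j : nat).

Lemma int_period_small (k : int) : `|k%:~R * (2 * pi) : K| < 2 * pi -> k = 0.
Proof.
rewrite normrM [`|2 * pi|]ger0_norm; last exact/ltW/pi2_gt0.
rewrite -[X in _ < X]mul1r ltr_pM2r ?pi2_gt0// -intr_norm -[1]/(1%:~R) ltr_int.
by move=> h; apply/eqP; rewrite -normr_le0 -ltzD1 add0r.
Qed.

(** The representative on which arcs and their lengths are computed; [torus_repr] is an unspecified
    one. *)
Definition nrep l : K := xget 0 [set x | 0 <= x < 2 * pi /\ torus_pi x = l].

Lemma nrepP l : 0 <= nrep l < 2 * pi /\ torus_pi (nrep l) = l.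
Proof.
have [k hk] := mod2pi (torus_repr l).
have : exists x : K, 0 <= x < 2 * pi /\ torus_pi x = l.
  exists (torus_repr l - k%:~R * (2 * pi)); split=> //.
  rewrite -[RHS]torus_reprK; apply/torus_piP; exists (- k).
  by rewrite mulrNz mulNr addrC addKr.
by move=> /(xgetPex 0).
Qed.

Lemma nrep_pi x : 0 <= x < 2 * pi -> nrep (torus_pi x) = x.
Proof.
move=> /andP[x0 x1]; have [/andP[n0 n1] /torus_piP[k hk]] := nrepP (torus_pi x).
have k0 : k = 0 by apply: int_period_small; rewrite -hk ltr_norml; apply/andP; split; lra.
by apply/eqP; rewrite -subr_eq0 hk k0 mul0r.
Qed.

Lemma torus_pi_open x y : open (@torus_pi K @` `]x, y[).
Proof.
rewrite /open /= /quotient_open.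
rewrite (_ : _ @^-1` _ = \bigcup_(k in [set: int]) [set z | x < z + k%:~R * (2 * pi) < y]).
  apply: bigcup_open => k _.
  rewrite (_ : mkset _ = (fun z => z + k%:~R * (2 * pi)) @^-1` `]x, y[).
    apply: open_comp; last exact: itv_open.
    move=> z _; apply: cvgD; [exact: cvg_id|exact: cvg_cst].
  by apply/seteqP; split=> z /=; rewrite in_itv.
apply/seteqP; split=> [z [u /= + /torus_piP[k uz]]|z [k _ /= h]].
  rewrite in_itv /= => h; exists k => //=.
  by rewrite -uz addrC subrK.
exists (z + k%:~R * (2 * pi)); first by rewrite /= in_itv.
by apply/torus_piP; exists k; rewrite addrC addKr.
Qed.

(** Exhibits points as closed sets, so that half-open arcs are Borel. *)
Lemma torus_set1 x : [set torus_pi x] = ~` (@torus_pi K @` `]x, (x + 2 * pi)[).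
Proof.
apply/seteqP; split=> [_ ->|l nl].
  move=> [y /=]; rewrite in_itv /= => /andP[h1 h2] /torus_piP[k hk].
  have k0 : k = 0 by apply: int_period_small; rewrite -hk ltr_norml; apply/andP; split; lra.
  by move: hk; rewrite k0 mul0r; lra.
have [k /andP[h1 h2]] := mod2pi (torus_repr l - x).
set y := x + (torus_repr l - x - k%:~R * (2 * pi)).
have yl : torus_pi y = l.
  rewrite -[RHS]torus_reprK; apply/torus_piP; exists (- k).
  by rewrite mulrNz mulNr /y; lra.
have [xy|xy] := eqVneq x y; first by move: yl; rewrite -xy => <-.
exfalso; apply: nl; exists y => //=; rewrite in_itv /=; apply/andP; split.
  by rewrite lt_neqAle xy /= /y; lra.
by rewrite /y; lra.
Qed.

Lemma torus_open_measurable (A : set (torus K)) : open A -> measurable (A : set (torusB K)).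
Proof. by move=> oA; exact: sub_sigma_algebra. Qed.

Lemma torus_arc_measurable x y :
  measurable (@torus_pi K @` `]x, y[ `|` [set torus_pi x] : set (torusB K)).
Proof.
have mo a b : measurable (@torus_pi K @` `]a, b[ : set (torusB K)).
  by apply: torus_open_measurable; exact: torus_pi_open.
by apply: measurableU => //; rewrite torus_set1; exact: measurableC.
Qed.

Definition torus_node M j : K := j%:R * (2 * pi / M%:R).

Definition torus_arc M l : nat := Num.truncn (M%:R * nrep l / (2 * pi)).

(** Moves l to the left end of its arc; for M > 0, composing with it produces a function with
    finitely many values. *)
Definition torus_step M l : torus K := torus_pi (torus_node M (torus_arc M l)).

Lemma torus_arcP M l j : (0 < M)%N -> torus_arc M l = j <-> torus_node M j <= nrep l < torus_node M j.+1.
Proof.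
move=> M0; have [/andP[n0 n1] _] := nrepP l.
have Mp : 0 < M%:R :> K by rewrite ltr0n.
have h0 : 0 <= M%:R * nrep l / (2 * pi).
  by apply: divr_ge0; [exact: mulr_ge0|exact/ltW/pi2_gt0].
have e i : (torus_node M i <= nrep l) = (i%:R <= M%:R * nrep l / (2 * pi)).
  by rewrite /torus_node ler_pdivlMr ?pi2_gt0// mulrA ler_pdivrMr// [nrep l * _]mulrC.
rewrite ltNge !e -ltNge /torus_arc; split=> [<-|]; first exact: truncn_itv.
exact: truncn_def.
Qed.

Lemma arc_lt M l : (0 < M)%N -> (torus_arc M l < M)%N.
Proof.
move=> M0; have /(torus_arcP _ _ M0)/andP[h _] := erefl (torus_arc M l).
have [/andP[_ n1] _] := nrepP l; have := le_lt_trans h n1.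
rewrite /torus_node mulrA ltr_pdivrMr ?ltr0n// mulrC ltr_pM2l ?pi2_gt0//.
by rewrite ltr_nat.
Qed.

Lemma node_bound M j : (j < M)%N -> 0 <= torus_node M j /\ torus_node M j.+1 <= 2 * pi.
Proof.
move=> jM; have M0 : (0 < M)%N by exact: leq_ltn_trans jM.
split; first by apply: mulr_ge0 => //; apply: divr_ge0 => //; exact/ltW/pi2_gt0.
rewrite /torus_node mulrA ler_pdivrMr ?ltr0n// mulrC ler_pM2l ?pi2_gt0//.
by rewrite ler_nat.
Qed.

Lemma arc_preimage M j : (j < M)%N ->
  torus_arc M @^-1` [set j] = @torus_pi K @` `]torus_node M j, torus_node M j.+1[ `|` [set torus_pi (torus_node M j)].
Proof.
move=> jM; have M0 : (0 < M)%N by exact: leq_ltn_trans jM.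
have [b0 b1] := node_bound jM.
have lt : torus_node M j < torus_node M j.+1.
  by rewrite /torus_node ltr_pM2r ?ltr_nat// divr_gt0 ?pi2_gt0// ltr0n.
apply/seteqP; split=> [l /= /(torus_arcP _ _ M0)/andP[h1 h2]|l].
  have [_ nl] := nrepP l; move: h1; rewrite le_eqVlt => /orP[/eqP h1|h1].
    by right; rewrite /= h1 nl.
  by left; exists (nrep l) => //=; rewrite in_itv /= h1 h2.
move=> [[x /=]|->].
  rewrite in_itv /= => /andP[h1 h2] <-; apply/(torus_arcP _ _ M0).
  by rewrite nrep_pi ?h2 ?andbT ?(ltW h1)//; apply/andP; split; lra.
apply/(torus_arcP _ _ M0); rewrite nrep_pi ?lexx ?lt//.
by apply/andP; split=> //; lra.
Qed.

Lemma arc_measurable M j : (0 < M)%N -> measurable (torus_arc M @^-1` [set j] : set (torusB K)).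
Proof.
move=> M0; have [jM|Mj] := ltnP j M.
  by rewrite arc_preimage//; exact: torus_arc_measurable.
rewrite (_ : _ @^-1` _ = set0); first exact: measurable0.
apply/seteqP; split=> // l /= al; have := arc_lt l M0.
by rewrite al ltnNge Mj.
Qed.

Lemma arc_finite_partition M : (0 < M)%N ->
  finite_partition (torus_arc M : torusB K -> nat).
Proof.
move=> M0; split=> [|j]; last exact: arc_measurable.
apply: (@sub_finite_set _ _ `I_M); last exact: finite_II.
by move=> _ [l _ <-] /=; exact: arc_lt.
Qed.

Lemma arc_node M j : (j < M)%N -> torus_arc M (torus_pi (torus_node M j)) = j.
Proof.
move=> jM; have M0 : (0 < M)%N by exact: leq_ltn_trans jM.
have := arc_preimage jM => /seteqP[_ /(_ (torus_pi (torus_node M j)))]; apply.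
by right.
Qed.

Lemma range_arc M : (0 < M)%N -> range (torus_arc M : torusB K -> nat) = `I_M.
Proof.
move=> M0; apply/seteqP; split=> [_ [l _ <-]|j /= jM]; first exact: arc_lt.
by exists (torus_pi (torus_node M j)) => //; exact: arc_node.
Qed.

Lemma sum_arc (V : nmodType) M (F : nat -> V) : (0 < M)%N ->
  \sum_(j \in range (torus_arc M : torusB K -> nat)) F j = \sum_(j < M) F j.
Proof.
move=> M0; rewrite range_arc// -(big_mkord xpredT F).
rewrite (_ : `I_M = [set` index_iota 0 M]).
  by rewrite -fsbig_seq// iota_uniq.
by apply/seteqP; split=> j /=; rewrite mem_index_iota.
Qed.

Lemma torus_exp_step (h : int) (e : K) : 0 < e -> exists M0, forall M, (M0 <= M)%N ->
  forall l, normc (torus_exp h l - torus_exp h (torus_step M l)) <= e.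
Proof.
move=> e0; have e20 : 0 < e / 2 by rewrite divr_gt0.
have c1 : {for (0 : K), continuous (cos \o (fun t : K => h%:~R * t))}.
  by apply: continuous_comp; [exact: mulrl_continuous|exact: continuous_cos].
have c2 : {for (0 : K), continuous (sin \o (fun t : K => h%:~R * t))}.
  by apply: continuous_comp; [exact: mulrl_continuous|exact: continuous_sin].
have {}c1 : cos (h%:~R * t) @[t --> (0 : K)] --> cos (h%:~R * 0) := c1.
have {}c2 : sin (h%:~R * t) @[t --> (0 : K)] --> sin (h%:~R * 0) := c2.
rewrite mulr0 cos0 in c1; rewrite mulr0 sin0 in c2.
have /cvgrPdist_lt/(_ _ e20) h1 := c1; have /cvgrPdist_lt/(_ _ e20) h2 := c2.
have hh : \forall t \near (0 : K), `|1 - cos (h%:~R * t)| < e / 2 /\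
    `|0 - sin (h%:~R * t)| < e / 2 by exact: filterI h1 h2.
have [dl d0 hd] := (nbhs_ballP _ _).1 hh; have {}d0 : 0 < dl := d0.
have [M1 hM1] := nat_ge ((2 * pi + 1) / dl).
exists M1.+1 => M MM l; have M0 : (0 < M)%N by exact: leq_ltn_trans MM.
have Mp : 0 < M%:R :> K by rewrite ltr0n.
have /(torus_arcP _ _ M0)/andP[a1 a2] := erefl (torus_arc M l).
have [_ nl] := nrepP l; set x := nrep l in a1 a2 nl; set y := torus_node M _ in a1 a2.
have -> : torus_exp h l = cis (h%:~R * x) by rewrite -[in LHS]nl torus_exp_cis.
have -> : torus_exp h (torus_step M l) = cis (h%:~R * y) by rewrite /torus_step torus_exp_cis.
have [t0 t1] : 0 <= x - y /\ x - y < dl.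
  split; first by rewrite subr_ge0.
  have : x - y < 2 * pi / M%:R.
    by move: a2; rewrite /y /torus_node -natr1 mulrDl mul1r; lra.
  move/lt_trans; apply; rewrite ltr_pdivrMr//.
  rewrite ler_pdivrMr// mulrC in hM1.
  have : dl * M1%:R <= dl * M%:R by rewrite ler_pM2l// ler_nat ltnW.
  by lra.
have bb : ball (0 : K) dl (x - y) by rewrite -ball_normE /= sub0r normrN ger0_norm.
have [b1 b2] := hd _ bb.
rewrite -{1}(subrK y x) mulrDr cisD -{2}[cis (h%:~R * y)]mul1r -mulrBl.
rewrite Normc.normcM normc_cis mulr1 (le_trans (normc_le_ReIm _))//=.
rewrite oppr0 addr0 [e]splitr; move: b1 b2; rewrite sub0r normrN distrC => b1 b2.
by rewrite lerD// ltW.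
Qed.

Lemma chord2_step (e : K) : 0 < e -> exists M0, forall M, (M0 <= M)%N ->
  forall l, chord2 l (torus_step M l) <= e.
Proof.
move=> e0; have s0 : 0 < Num.sqrt e by rewrite sqrtr_gt0.
have [M0 h] := torus_exp_step 1 s0; exists M0 => M MM l.
rewrite -chord2_normc -(sqr_sqrtr (ltW e0)) ler_pXn2r ?nnegrE ?normc_ge0 ?(ltW s0)//.
exact: h.
Qed.

End torus_partition.
(** * Integrals of periodograms and of spectral densities *)

Section operator_integrals.
Context {K : realType} {H : hilbertType K}.
Implicit Types (A B S T : H -> H) (c e : K).

Lemma trace_norm_extended : extended_norm (@trace_norm K H).
Proof.
split; [exact: trace_norm_ge0|exact: trace_norm0|exact: trace_normD|
  exact: trace_normZ|exact: trace_norm_eq0].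
Qed.
Local Notation NN := trace_norm_extended.

Lemma trace_norm_sandwich A B T c1 c2 : 0 < c1 -> 0 < c2 -> bnd A c1 -> bnd B c2 ->
  (trace_norm (A \o T \o adjoint B) <= (c1 * c2)%:E * trace_norm T)%E.
Proof.
move=> c10 c20 Ac Bc; have [->|Tf] := eqVneq (trace_norm T) +oo%E.
  by rewrite gt0_muley ?leey// lte_fin mulr_gt0.
have {}Tf : trace_norm T \is a fin_num by rewrite ge0_fin_numE ?trace_norm_ge0// ltey.
rewrite -(fineK Tf) -EFinM; apply/trace_normP.
apply: tnle_sandwich (ltW c10) (ltW c20) Ac Bc _.
by apply: trace_norm_fin; rewrite -ge0_fin_numE// trace_norm_ge0.
Qed.

Lemma adjointB B B' c c' : bnd B c -> bnd B' c' -> adjoint (B - B') = adjoint B - adjoint B'.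
Proof.
move=> Bc Bc'; apply: adjoint_uniq (bndB Bc Bc') _ => x y.
by rewrite !fctE hdotBl hdotBr (adjointP Bc) (adjointP Bc').
Qed.

Lemma trace_norm_sandwichB A A' B B' T b e : 0 < b -> 0 < e ->
  bnd A' b -> bnd B b -> bnd B' b -> bnd (A - A') e -> bnd (B - B') e ->
  (trace_norm ((A \o T \o adjoint B) - (A' \o T \o adjoint B'))%R
    <= (2 * b * e)%:E * trace_norm T)%E.
Proof.
move=> b0 e0 Ab' Bb Bb' Ae Be; have [->|Tf] := eqVneq (trace_norm T) +oo%E.
  by rewrite gt0_muley ?leey// lte_fin !mulr_gt0.
have Tl : lin T.
  have [] // : bnd T (fine (trace_norm T)).
  by apply: tnle_bnd; apply: trace_norm_fin; rewrite ltey.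
have -> : (A \o T \o adjoint B) - (A' \o T \o adjoint B') =
    ((A - A') \o T \o adjoint B) + (A' \o T \o adjoint (B - B')).
  rewrite (adjointB Bb Bb'); apply/funext => x.
  rewrite !fctE /= (linB _ _ Tl) (linB _ _ Ab'.1).
  by rewrite addrA subrK.
rewrite (le_trans (trace_normD _ _))//.
have -> : (2 * b * e)%:E = ((e * b)%:E + (b * e)%:E)%E.
  by rewrite -EFinD; congr EFin; ring.
rewrite ge0_muleDl ?lee_fin ?mulr_ge0 ?(ltW b0) ?(ltW e0)//.
by rewrite leeD// trace_norm_sandwich.
Qed.

(** The form of continuity used for integration: boundedness and uniform approximation by step
    functions on equal arcs. It is stable under sums and under multiplication by exponentials. *)
Definition ucont (L : torus K -> H -> H) :=
  (exists b : K, 0 <= b /\ forall l, bnd (L l) b) /\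
  (forall e, 0 < e -> exists M0, forall M, (M0 <= M)%N -> forall l,
     bnd (L l - L (torus_step M l)) e).

Lemma in_C_ucont {E : topologicalType} (L : E * torus K -> H -> H) th :
  compact [set: E] -> in_C opnorm L -> ucont (fun l => L (th, l)).
Proof.
move=> cE iL; split.
  have [|B [B0 hB]] := in_C_bounded _ iL; last by exists B.
  by rewrite -setXTT; apply: compact_setX => //; exact: torus_compact.
move=> e e0; have e20 : 0 < e / 2 by rewrite divr_gt0.
have [C [C0 hC]] := in_C_uniform_torus cE iL e20.
have d0 : 0 < e / 2 / (C + 1) by rewrite divr_gt0// ltr_wpDl.
have [M0 h] := chord2_step d0; exists M0 => M MM l.
apply: bnd_le (hC th l (torus_step M l)) _.
rewrite [leRHS]splitr lerD2l (le_trans (ler_wpM2l C0 (h M MM l)))//.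
by rewrite mulrA ler_pdivrMr ?ltr_wpDl// mulrC ler_pM2l//; lra.
Qed.

Lemma ucontD (L L' : torus K -> H -> H) : ucont L -> ucont L' ->
  ucont (fun l => L l + L' l).
Proof.
move=> [[B [B0 hB]] h] [[B' [B'0 hB']] h']; split.
  by exists (B + B'); split=> [|l]; [exact: addr_ge0|exact: bndD].
move=> e e0; have e20 : 0 < e / 2 by rewrite divr_gt0.
have [M0 h1] := h _ e20; have [M1 h2] := h' _ e20.
exists (maxn M0 M1) => M; rewrite geq_max => /andP[MM0 MM1] l.
by rewrite opprD addrACA [e]splitr; apply: bndD; [exact: h1|exact: h2].
Qed.

Lemma ucont_exp (L : torus K -> H -> H) (h : int) : ucont L ->
  ucont (fun l => torus_exp h l *: L l).
Proof.
move=> [[B [B0 hB]] hL]; split.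
  by exists B; split=> // l; have := bndZ (torus_exp h l) (hB l);
    rewrite normc_torus_exp mul1r.
move=> e e0; have e20 : 0 < e / 2 by rewrite divr_gt0.
have d0 : 0 < e / 2 / (B + 1) by rewrite divr_gt0// ltr_wpDl.
have [M0 h1] := hL _ e20; have [M1 h2] := torus_exp_step h d0.
exists (maxn M0 M1) => M; rewrite geq_max => /andP[MM0 MM1] l.
rewrite (_ : _ - _ = torus_exp h l *: (L l - L (torus_step M l)) +
   (torus_exp h l - torus_exp h (torus_step M l)) *: L (torus_step M l)); last first.
  by rewrite scalerBr scalerBl addrA subrK.
have b1 := bndZ (torus_exp h l) (h1 M MM0 l).
have b2 := bndZ (torus_exp h l - torus_exp h (torus_step M l)) (hB (torus_step M l)).
apply: bnd_le (bndD b1 b2) _; rewrite normc_torus_exp mul1r [leRHS]splitr lerD2l.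
rewrite (le_trans (ler_wpM2r B0 (h2 M MM1 l)))//.
by rewrite mulrAC ler_pdivrMr ?ltr_wpDl// ler_pM2l//; lra.
Qed.

Lemma ucont_cst T c : 0 <= c -> bnd T c -> ucont (fun=> T).
Proof.
move=> c0 Tc; split; first by exists c.
move=> e e0; exists 0%N => M _ l; rewrite subrr.
by apply: bnd_le bnd0 _; exact: ltW.
Qed.

Lemma ucont_sum I (r : seq I) (L : I -> torus K -> H -> H) :
  (forall i, ucont (L i)) -> ucont (fun l => \sum_(i <- r) L i l).
Proof.
move=> h; elim: r => [|i r IH].
  under eq_fun do rewrite big_nil; exact: ucont_cst bnd0.
by under eq_fun do rewrite big_cons; exact: ucontD.
Qed.

Section measure.
Context {d : measure_display} {X : measurableType d}.
Variable mu : {measure set X -> \bar K}.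
Hypothesis mufin : (mu setT < +oo)%E.
Local Notation approx := (approx_integral mu (@trace_norm K H)).

Lemma approx_integralB (f f' : X -> H -> H) (I I' : H -> H) :
  approx f I -> approx f' I' -> approx (fun x => f x - f' x) (I - I').
Proof.
move=> h h'; apply: (approx_integralD mufin NN) => //.
apply: (@approx_integral_map _ _ _ mu mufin _ _ -%R 1) h' => //.
- by move=> a u v; rewrite opprD scalerN.
- by move=> v; rewrite trace_normN mul1e.
Qed.

Lemma approx_integral_sandwich (f : X -> H -> H) (I : H -> H) A B c1 c2 :
  0 <= c1 -> 0 <= c2 -> bnd A c1 -> bnd B c2 -> approx f I ->
  approx (fun x => A \o f x \o adjoint B) (A \o I \o adjoint B).
Proof.
move=> c10 c20 Ac Bc h.
have Ac' : bnd A (c1 + 1) by apply: bnd_le Ac _; rewrite lerDl.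
have Bc' : bnd B (c2 + 1) by apply: bnd_le Bc _; rewrite lerDl.
apply: (@approx_integral_map _ _ _ mu mufin _ _ (fun T => A \o T \o adjoint B)
   ((c1 + 1) * (c2 + 1))) h.
- by move=> a u v; apply/funext => x; rewrite !fctE /= Ac.1.
- by rewrite mulr_ge0// addr_ge0.
- by move=> T; apply: trace_norm_sandwich => //; rewrite ltr_wpDl.
Qed.

Lemma approx_integral_sum I (r : seq I) (f : I -> X -> H -> H) (J : I -> H -> H) :
  (forall i, approx (f i) (J i)) ->
  approx (fun x => \sum_(i <- r) f i x) (\sum_(i <- r) J i).
Proof.
move=> h; elim: r => [|i r IH].
  by rewrite big_nil; under eq_fun do rewrite big_nil; exact: (approx_integral0 mufin NN).
by rewrite big_cons; under eq_fun do rewrite big_cons; exact: (approx_integralD mufin NN).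
Qed.

(** The integral J is not known in advance: the uniform rate relative to h makes integrals Jn along
    a subsequence Cauchy in trace norm, and completeness of the trace class supplies J. *)
Lemma approx_integral_complete (f : X -> H -> H) (fn : nat -> X -> H -> H)
    (Jn : nat -> H -> H) (h : X -> \bar K) :
  measurable_fun setT h -> (forall x, 0 <= h x)%E -> (\int[mu]_x h x < +oo)%E ->
  (forall n, (0 < n)%N -> approx (fn n) (Jn n)) ->
  (forall e, 0 < e -> exists n0, forall n, (n0 <= n)%N ->
     forall x, (trace_norm (f x - fn n x)%R <= e%:E * h x)%E) ->
  exists J, approx f J /\ (forall e, 0 < e -> exists n0, forall n, (n0 <= n)%N ->
     (trace_norm (J - Jn n)%R <= e%:E)%E).
Proof.
move=> mh h0 hfin aJ cf.
have ifin : (\int[mu]_x h x)%E \is a fin_num by rewrite ge0_fin_numE// integral_ge0.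
pose c := fine (\int[mu]_x h x)%E + 1.
have c0 : 0 < c by rewrite ltr_wpDl// fine_ge0// integral_ge0.
have ic : (\int[mu]_x h x <= c%:E)%E by rewrite -(fineK ifin) lee_fin lerDl.
have ich e : 0 <= e -> (\int[mu]_x (e%:E * h x) <= (e * c)%:E)%E.
  move=> e0; rewrite ge0_integralZl ?lee_fin// EFinM.
  by rewrite lee_wpmul2l// lee_fin.
have mhe e : measurable_fun setT (fun x => e%:E * h x)%E by exact: measurable_funeM.
have he0 e x : 0 <= e -> (0 <= e%:E * h x)%E by move=> e0; rewrite mule_ge0.
have hn (k : nat) : 0 < k.+1%:R^-1 :> K by rewrite invr_gt0.
have /choice[m hm] : forall k : nat, exists n, (0 < n)%N /\
    forall x, (trace_norm (f x - fn n x)%R <= k.+1%:R^-1%:E * h x)%E.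
  move=> k; have [n0 hn0] := cf _ (hn k); exists n0.+1; split=> // x.
  exact: hn0 (leqnSn n0) x.
have dif k k' : (k <= k')%N -> (trace_norm (Jn (m k') - Jn (m k))%R
    <= (2 * c * k.+1%:R^-1)%:E)%E.
  move=> kk; have [m0 mk] := hm k; have [m0' mk'] := hm k'.
  have le : k'.+1%:R^-1 <= k.+1%:R^-1 :> K by rewrite lef_pV2 ?posrE ?ltr0n// ler_nat.
  have a1 := approx_integralB (aJ _ m0') (aJ _ m0).
  have := @approx_integral_norm _ _ _ mu mufin _ _ NN _ _
     (fun x => (2 * k.+1%:R^-1)%:E * h x)%E (mhe _) _ a1.
  move=> /(_ (fun x => he0 _ x (mulr_ge0 (ler0n _ 2) (ltW (hn k))))) n1.
  apply: le_trans (n1 _) _ => [x|]; last first.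
    have c2 : 0 <= 2 * k.+1%:R^-1 :> K by rewrite mulr_ge0// ltW.
    by rewrite (le_trans (ich _ c2))// lee_fin mulrAC.
  rewrite (le_trans (en_BD NN _ (f x) _))// (en_BC NN (fn (m k') x)).
  have -> : ((2 * k.+1%:R^-1)%:E * h x = k.+1%:R^-1%:E * h x + k.+1%:R^-1%:E * h x)%E.
    by rewrite -ge0_muleDl ?lee_fin ?(ltW (hn k))// -EFinD mulr2n mulrDl mul1r.
  rewrite leeD//; apply: le_trans (mk' x) _.
  by rewrite lee_wpmul2r// lee_fin.
have fJ n : (0 < n)%N -> (trace_norm (Jn n) < +oo)%E.
  move=> n0; have [h' [mh' h'0 fh' ih']] := approx_integral_dom mufin NN (aJ n n0).
  exact: le_lt_trans (approx_integral_norm mufin NN mh' h'0 (aJ n n0) fh') ih'.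
have [|||J hJ] := @tnle_complete _ _ (fun k => Jn (m k))
    (fun k => fine (trace_norm (Jn (m k)))) (fun k => 2 * c * k.+1%:R^-1).
- by move=> k; apply: trace_norm_fin; apply: fJ; case: (hm k).
- rewrite -[X in _ --> X](mulr0 (2 * c)); apply: cvgMr; exact: cvg_harmonic.
- by move=> k k' kk; apply/trace_normP; exact: dif.
have aJf : approx f J.
  apply: (approx_integral_limit NN) => e e0.
  have [k hk] := nat_ge (2 * c / e).
  have ke : 2 * c * k.+1%:R^-1 <= e.
    have hk' : 2 * c <= e * k%:R by rewrite [leRHS]mulrC -ler_pdivrMr.
    by rewrite ler_pdivrMr ?ltr0n// (le_trans hk')// ler_pM2l// ler_nat.
  have [m0 mk] := hm k.
  exists (fn (m k)), (Jn (m k)), (fun x => k.+1%:R^-1%:E * h x)%E; split=> //.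
  - exact: aJ.
  - by split=> // x; rewrite he0// ltW.
  - rewrite (le_trans (ich _ (ltW (hn k))))// lee_fin (le_trans _ ke)//.
    by rewrite mulrC ler_pM2r//; lra.
  - rewrite (en_BC NN); have /trace_normP/le_trans := hJ k; apply.
    by rewrite lee_fin.
exists J; split=> // e e0; have ec0 : 0 < e / c by rewrite divr_gt0.
have [n0 hn0] := cf _ ec0; exists n0.+1 => n nn.
have n00 : (0 < n)%N by exact: leq_trans nn.
have a1 := approx_integralB aJf (aJ n n00).
have := @approx_integral_norm _ _ _ mu mufin _ _ NN _ _ _ (mhe (e / c)) _ a1 _.
move=> /(_ (fun x => he0 _ x (ltW ec0)) (hn0 n (ltnW nn))) /le_trans; apply.
by rewrite (le_trans (ich _ (ltW ec0)))// lee_fin divfK// gt_eqF.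
Qed.

End measure.

Section form.
Variable mu : {measure set (torusB K) -> \bar K}.
Hypothesis mufin : (mu setT < +oo)%E.
Local Notation approx := (approx_integral mu (@trace_norm K H)).

(** Common interface of periodogram and spectral density, with k in the role of a total mass. The
    same J must satisfy the estimate for all bounds a and b. *)
Definition integrable_form (F : torusB K -> H -> H) (k : K) :=
  forall L R, ucont L -> ucont R -> exists J,
    approx (fun l => L l \o F l \o adjoint (R l)) J /\
    forall a b, 0 <= a -> 0 <= b -> (forall l, bnd (L l) a) -> (forall l, bnd (R l) b) ->
      (trace_norm J <= (a * b * k)%:E)%E.

(** For step functions the integral is a finite sum of L (q_j) nu (A_j) R (q_j)^H, since the density
    integrates to nu on each arc; uniform approximation extends this. The constant is the integral
    of a measurable majorant of the trace norm of f. *)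
Lemma density_form (nu : set (torusB K) -> H -> H) (f : torusB K -> H -> H) :
  (forall A : set (torusB K), measurable A -> approx (fun l => (\1_A l : K[i]) *: f l) (nu A)) ->
  exists2 k, 0 <= k & integrable_form f k.
Proof.
move=> hf; have : approx f (nu setT).
  have := hf setT measurableT; congr approx_integral; apply/funext => l.
  by rewrite indicT scale1r.
move=> /(approx_integral_dom mufin NN)[h [mh h0 fh hfin]].
have ifin : (\int[mu]_x h x)%E \is a fin_num by rewrite ge0_fin_numE// integral_ge0.
exists (fine (\int[mu]_x h x)%E); first by rewrite fine_ge0// integral_ge0.
move=> L R [[B [B0 hB]] hL] [[B' [B'0 hB']] hR].
pose q M j : torus K := torus_pi (torus_node M j).
have [//|//|||J [aJ _]] := @approx_integral_complete _ _ mu mufin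
    (fun l => L l \o f l \o adjoint (R l))
    (fun M l => L (torus_step M l) \o f l \o adjoint (R (torus_step M l)))
    (fun M => \sum_(j < M) (L (q M j) \o nu (torus_arc M @^-1` [set (j : nat)]) \o adjoint (R (q M j)))) h mh.
- move=> M M0.
  have := @approx_integral_sum _ _ mu mufin _ (index_enum 'I_M)
    (fun j l => L (q M j) \o ((\1_(torus_arc M @^-1` [set (j : nat)]) l : K[i]) *: f l) \o adjoint (R (q M j)))
    (fun j => L (q M j) \o nu (torus_arc M @^-1` [set (j : nat)]) \o adjoint (R (q M j))).
  move=> /(_ _)/wrap[j|].
    apply: (approx_integral_sandwich mufin B0 B'0 (hB _) (hB' _)).
    by apply: hf; exact: arc_measurable.
  congr approx_integral; apply/funext => l.
  pose j0 := Ordinal (arc_lt l M0).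
  rewrite (bigD1 j0)//= big1 ?addr0.
    by rewrite indicE mem_set// scale1r.
  move=> j jj0; rewrite indicE memNset ?scale0r.
    by apply/funext => x /=; rewrite [(0 : H -> H) _]/(0 : H) (lin0 (hB _).1).
  by move=> /= e; move/eqP: jj0; apply; apply: val_inj.
- move=> e e0; pose b := B + B' + 1.
  have b0 : 0 < b by rewrite ltr_wpDl// addr_ge0.
  have bB S : bnd S B -> bnd S b by move=> /bnd_le; apply; rewrite /b; lra.
  have bB' S : bnd S B' -> bnd S b by move=> /bnd_le; apply; rewrite /b; lra.
  have d0 : 0 < e / (2 * b) by rewrite divr_gt0// mulr_gt0.
  have [M0 h1] := hL _ d0; have [M1 h2] := hR _ d0.
  exists (maxn M0 M1) => M; rewrite geq_max => /andP[MM0 MM1] l.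
  rewrite (le_trans (trace_norm_sandwichB _ b0 d0 (bB _ (hB _)) (bB' _ (hB' _))
      (bB' _ (hB' _)) (h1 M MM0 l) (h2 M MM1 l)))//.
  rewrite mulrC divfK; last by rewrite gt_eqF// mulr_gt0.
  by rewrite lee_wpmul2l// lee_fin ltW.
exists J; split=> // a b a0 b0 La Rb.
(* [trace_norm_sandwich] asks for positive constants, so a and b are first enlarged by e. *)
have e1 e : 0 < e -> (trace_norm J <= ((a + e) * (b + e) * fine (\int[mu]_x h x)%E)%:E)%E.
  move=> e0; have ae : 0 < a + e by rewrite ltr_wpDl.
  have be : 0 < b + e by rewrite ltr_wpDl.
  have ab0 : 0 <= (a + e) * (b + e) by rewrite mulr_ge0// ltW.
  rewrite EFinM fineK// -ge0_integralZl ?lee_fin//.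
  apply: (approx_integral_norm mufin NN _ _ aJ) => [|x|l].
  - exact: measurable_funeM.
  - by rewrite mule_ge0// lee_fin.
  - rewrite (le_trans (trace_norm_sandwich _ ae be _ _))//.
    + by apply: bnd_le (La l) _; rewrite lerDl ltW.
    + by apply: bnd_le (Rb l) _; rewrite lerDl ltW.
    + by rewrite lee_wpmul2l// lee_fin.
have Jf : trace_norm J \is a fin_num.
  by rewrite ge0_fin_numE ?trace_norm_ge0// (le_lt_trans (e1 1 ltr01))// ltry.
rewrite -(fineK Jf) lee_fin; set k := fine (integral _ _ _) in e1 *.
have k0 : 0 <= k by rewrite fine_ge0// integral_ge0.
(* For d = [dd] <= 1, (a + d) (b + d) k exceeds a b k by at most (a + b + 1) k d, which is at most
   e. *)
apply/ler_addgt0Pr => e e0; pose dd := Num.min 1 (e / ((a + b + 1) * k + 1)).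
have p0 : 0 < (a + b + 1) * k + 1 by rewrite ltr_wpDl// mulr_ge0// !addr_ge0.
have dd0 : 0 < dd by rewrite lt_min ltr01 divr_gt0.
have := e1 dd dd0; rewrite -(fineK Jf) lee_fin => /le_trans; apply.
have d1 : dd <= 1 by rewrite ge_min lexx.
have : dd <= e / ((a + b + 1) * k + 1) by rewrite ge_min lexx orbT.
rewrite ler_pdivlMr// => d2.
have d3 : dd * dd <= dd by rewrite -[leRHS]mulr1 ler_pM2l.
have d4 : dd * dd * k <= dd * k by rewrite ler_wpM2r.
by move: d2 d4; move: (dd) dd0 => z z0; nra.
Qed.

End form.

End operator_integrals.

(** * The two measures on the torus *)

Section leb_torus_measure.
Context {K : realType}.

Lemma measurable_torus_pi (A : set (torusB K)) : measurable A ->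
  measurable (@torus_pi K @^-1` A).
Proof.
move=> mA; have mf : measurable_fun setT (@torus_pi K : K -> torusB K).
  apply: (@measurability _ _ _ (torusB K) setT (@torus_pi K) (@open (torus K))) => // _ [B oB <-].
  rewrite setTI; apply: open_measurable.
  by have /continuousP := @torus_pi_continuous K; apply.
by have := mf measurableT _ mA; rewrite setTI.
Qed.

Lemma leb_torus0 : leb_torus (set0 : set (torusB K)) = 0%E.
Proof. by rewrite /leb_torus preimage_set0 setI0 measure0 mule0. Qed.

Lemma inv2pi_ge0 : (0 <= ((2 * pi)^-1)%R%:E :> \bar K)%E.
Proof. by rewrite lee_fin invr_ge0; exact/ltW/pi2_gt0. Qed.

Lemma leb_torus_ge0 (A : set (torusB K)) : (0 <= leb_torus A)%E.
Proof. by rewrite mule_ge0// inv2pi_ge0. Qed.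

Lemma leb_torus_sigma_additive : semi_sigma_additive (@leb_torus K).
Proof.
move=> F mF tF _; rewrite /leb_torus preimage_bigcup setI_bigcupr.
have mG i : measurable (`[0%R, (2 * pi)%R[ `&` @torus_pi K @^-1` F i : set K).
  by apply: measurableI => //; exact: measurable_torus_pi.
rewrite (_ : (fun n => _) = fun n => (((2 * pi)^-1)%R%:E *
    \sum_(0 <= i < n) lebesgue_measure (`[0%R, (2 * pi)%R[ `&` @torus_pi K @^-1` F i))%E).
  apply: cvgeZl => //; apply: measure_semi_sigma_additive => //.
  - apply/trivIsetP => i j _ _ ij; move/trivIsetP : tF => /(_ i j Logic.I Logic.I ij) h.
    by rewrite setIACA setIid -preimage_setI h preimage_set0 setI0.
  - exact: bigcupT_measurable.
by apply/funext => n; rewrite ge0_sume_distrr.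
Qed.

HB.instance Definition _ := isMeasure.Build _ (torusB K) K (@leb_torus K)
  leb_torus0 leb_torus_ge0 leb_torus_sigma_additive.

Lemma leb_torusT : (leb_torus [set: torusB K] < +oo)%E.
Proof.
rewrite /leb_torus preimage_setT setIT lebesgue_measure_itv /= lte_fin pi2_gt0.
by rewrite -EFinB -EFinM ltry.
Qed.

Lemma leb_torus_arc M j : (j < M)%N ->
  leb_torus (torus_arc M @^-1` [set j] : set (torusB K)) = (M%:R^-1)%:E.
Proof.
move=> jM; have M0 : (0 < M)%N by exact: leq_ltn_trans jM.
have [b0 b1] := node_bound (K := K) jM.
have e : torus_node M j.+1 - torus_node M j = 2 * pi / M%:R :> K.
  by rewrite /torus_node -natr1 mulrDl mul1r addrAC subrr add0r.
have lt : torus_node M j < torus_node M j.+1 :> K.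
  by rewrite -subr_gt0 e divr_gt0 ?pi2_gt0// ltr0n.
rewrite /leb_torus (_ : _ `&` _ = `[torus_node M j, torus_node M j.+1[%classic).
  rewrite lebesgue_measure_itv /= lte_fin lt -EFinB e -EFinM mulrA mulVf ?mul1r//.
  by rewrite gt_eqF// pi2_gt0.
apply/seteqP; split=> [x [/=]|x /=]; rewrite !in_itv /=.
  by move=> xb /(torus_arcP _ _ M0); rewrite nrep_pi.
move=> /andP[h1 h2]; have xb : 0 <= x < 2 * pi by apply/andP; split; lra.
by split=> //; apply/(torus_arcP _ _ M0); rewrite nrep_pi// h1.
Qed.

End leb_torus_measure.

Section norm_measure_measure.
Context {K : realType} {H : hilbertType K}.
Variable nu : set (torusB K) -> H -> H.
Hypothesis hnu : trace_class_measure nu.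

Lemma nu_tn A : measurable A -> tnle (nu A) (fine (trace_norm (nu A))).
Proof. by move=> mA; apply: trace_norm_fin; case: (hnu.1 _ mA). Qed.

Lemma nu_bounded A : measurable A -> bounded_op (nu A).
Proof.
move=> mA; apply/bounded_opP; exists (fine (trace_norm (nu A))).
  exact: tnle_ge0 (nu_tn mA).
exact: tnle_bnd (nu_tn mA).
Qed.

Lemma nu_sum (A : nat -> set (torusB K)) n : (forall k, measurable (A k)) ->
  [/\ bounded_op (\sum_(k < n) nu (A k)), positive_op (\sum_(k < n) nu (A k)) &
    trace_norm (\sum_(k < n) nu (A k)) = (\sum_(k < n) trace_norm (nu (A k)))%E].
Proof.
move=> mA; elim: n => [|n [IHb IHp IHt]].
  rewrite !big_ord0 trace_norm0; split=> //.
    by apply/bounded_opP; exists 0 => //; exact: bnd0.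
  by move=> x; rewrite [(0 : H -> H) x]/(0 : H) hdot0l.
have [_ pn] := hnu.1 _ (mA n); have bn := nu_bounded (mA n).
rewrite !big_ord_recr /=; split.
- have /bounded_opP[c c0 hc] := IHb; have /bounded_opP[c' c'0 hc'] := bn.
  by apply/bounded_opP; exists (c + c'); [exact: addr_ge0|exact: bndD].
- by move=> x; rewrite fctE hdotDl addr_ge0.
- by rewrite trace_normD_positive// IHt.
Qed.

(** Sigma-additivity on the constant sequence of empty sets makes nu set0 - n nu set0 small for
    large n; two consecutive terms differ by nu set0. *)
Lemma norm_measure0 : norm_measure nu set0 = 0%E.
Proof.
have m0 (k : nat) : measurable (set0 : set (torusB K)) by exact: measurable0.
have t0 : trivIset setT (fun _ : nat => set0 : set (torusB K)).
  by apply/trivIsetP => i j _ _ _; rewrite setI0.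
have [_ /(_ (fun=> set0) m0 t0)] := hnu; rewrite bigcup0// => h.
apply/eqP; rewrite eq_le; apply/andP; split; last exact: trace_norm_ge0.
apply/lee_addgt0Pr => e e0; rewrite add0e.
have e20 : 0 < e / 2 by rewrite divr_gt0.
have [n _ hn] := cvge0_lt (fun n => trace_norm_ge0 _) h e20.
have h1 := hn n (leqnn n); have h2 := hn n.+1 (leqnSn n).
rewrite /norm_measure [e]splitr EFinD.
have -> : nu set0 = (nu set0 - \sum_(k < n) nu set0) - (nu set0 - \sum_(k < n.+1) nu set0).
  by rewrite big_ord_recr /= !opprD !opprK addrACA subrr add0r addrA addNr add0r.
rewrite (le_trans (trace_normD _ _))// trace_normN leeD//; exact: ltW.
Qed.

Lemma norm_measure_ge0 A : (0 <= norm_measure nu A)%E.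
Proof. exact: trace_norm_ge0. Qed.

(** By positivity the trace norms of the nu (F i) add up to that of the partial sum, which differs
    from the trace norm on the union by at most a remainder tending to 0. *)
Lemma norm_measure_sigma_additive : semi_sigma_additive (norm_measure nu).
Proof.
move=> F mF tF mUF; have [_ /(_ F mF tF) h] := hnu.
have fU : norm_measure nu (\bigcup_n F n) \is a fin_num.
  by rewrite ge0_fin_numE ?norm_measure_ge0//; case: (hnu.1 _ mUF).
have e n : (\sum_(0 <= i < n) norm_measure nu (F i))%E = trace_norm (\sum_(k < n) nu (F k)).
  by rewrite big_mkord; have [_ _ ->] := nu_sum n mF.
under eq_fun do rewrite e.
set U := \bigcup_n F n in fU h *.
apply: (@squeezee _ (fun n => norm_measure nu U - trace_norm (nu U - \sum_(k < n) nu (F k))%R)%E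
   _ (fun n => norm_measure nu U + trace_norm (nu U - \sum_(k < n) nu (F k))%R)%E).
- have h1 := cvge0_lt (fun n => trace_norm_ge0 _) h ltr01.
  move: h1; apply: filterS => n hn.
  have fn : trace_norm (nu U - \sum_(k < n) nu (F k)) \is a fin_num.
    by rewrite ge0_fin_numE ?trace_norm_ge0// (lt_trans hn)// ltry.
  apply/andP; split.
    rewrite leeBlDr// /norm_measure.
    have {1}-> : nu U = (\sum_(k < n) nu (F k)) + (nu U - \sum_(k < n) nu (F k)).
      by rewrite addrC subrK.
    exact: trace_normD.
  have {1}-> : \sum_(k < n) nu (F k) = nu U - (nu U - \sum_(k < n) nu (F k)).
    by rewrite opprB addrC subrK.
  by rewrite (le_trans (trace_normD _ _))// trace_normN.
- rewrite -[X in _ --> X]sube0; apply: cvgeB => //; last exact: cvg_cst.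
  by rewrite fin_num_adde_defr.
- rewrite -[X in _ --> X]adde0; apply: cvgeD => //; last exact: cvg_cst.
  by rewrite fin_num_adde_defl.
Qed.

Definition norm_measure_of : {measure set (torusB K) -> \bar K} :=
  HB.pack (norm_measure nu) (isMeasure.Build _ (torusB K) K (norm_measure nu)
    norm_measure0 norm_measure_ge0 norm_measure_sigma_additive).

Lemma norm_measureT : (norm_measure_of setT < +oo)%E.
Proof. by case: (hnu.1 _ measurableT). Qed.

End norm_measure_measure.

(** * Riemann sums and Fourier coefficients of the periodogram *)

Section periodogram_integrals.
Context {K : realType} {H : hilbertType K}.
Implicit Types (u v : torus K -> H) (Y : nat -> H) (e : K).
Local Notation NN := (@trace_norm_extended K H).
Local Notation approx := (approx_integral (@leb_torus K) (@trace_norm K H)).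

Definition vcont v :=
  (exists b : K, 0 <= b /\ forall l, rn (v l) <= b) /\
  (forall e, 0 < e -> exists M0, forall M, (M0 <= M)%N -> forall l,
     rn (v l - v (torus_step M l)) <= e).

Lemma vcont_cst (x : H) : vcont (fun=> x).
Proof.
split; first by exists (rn x); split=> // ; exact: rn_ge0.
by move=> e e0; exists 0%N => M _ l; rewrite subrr rn0 ltW.
Qed.

Lemma vcontD u v : vcont u -> vcont v -> vcont (fun l => u l + v l).
Proof.
move=> [[B [B0 hB]] h] [[B' [B'0 hB']] h']; split.
  exists (B + B'); split=> [|l]; first exact: addr_ge0.
  by rewrite (le_trans (rnD _ _))// lerD.
move=> e e0; have e20 : 0 < e / 2 by rewrite divr_gt0.
have [M0 h1] := h _ e20; have [M1 h2] := h' _ e20.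
exists (maxn M0 M1) => M; rewrite geq_max => /andP[MM0 MM1] l.
rewrite opprD addrACA [e]splitr (le_trans (rnD _ _))// lerD//.
  exact: h1.
exact: h2.
Qed.

Lemma vcont_op (L : torus K -> H -> H) v : ucont L -> vcont v ->
  vcont (fun l => L l (v l)).
Proof.
move=> [[B [B0 hB]] h] [[B' [B'0 hB']] h']; split.
  exists (B * B'); split=> [|l]; first exact: mulr_ge0.
  by rewrite (le_trans ((hB l).2 _))// ler_wpM2l.
move=> e e0; have e20 : 0 < e / 2 by rewrite divr_gt0.
have d0 : 0 < e / 2 / (B' + 1) by rewrite divr_gt0// ltr_wpDl.
have d0' : 0 < e / 2 / (B + 1) by rewrite divr_gt0// ltr_wpDl.
have [M0 h1] := h _ d0; have [M1 h2] := h' _ d0'.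
exists (maxn M0 M1) => M; rewrite geq_max => /andP[MM0 MM1] l.
rewrite (_ : _ - _ = (L l - L (torus_step M l)) (v l) +
   L (torus_step M l) (v l - v (torus_step M l))); last first.
  by rewrite (linB _ _ (hB _).1) fctE addrA subrK.
rewrite (le_trans (rnD _ _))// [leRHS]splitr lerD//.
  rewrite (le_trans ((h1 M MM0 l).2 _))// (le_trans (ler_wpM2l (ltW d0) (hB' l)))//.
  by rewrite mulrAC ler_pdivrMr ?ltr_wpDl// ler_pM2l//; lra.
rewrite (le_trans ((hB _).2 _))// (le_trans (ler_wpM2l B0 (h2 M MM1 l)))//.
by rewrite mulrA ler_pdivrMr ?ltr_wpDl// mulrC ler_pM2l//; lra.
Qed.

Lemma vcont_exp (h : int) v : vcont v -> vcont (fun l => torus_exp h l *: v l).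
Proof.
have := ucont_exp h (ucont_cst (@ler01 K) (@bnd_id K H)).
by move=> /vcont_op; apply.
Qed.

Lemma vcontZ (a : K[i]) v : vcont v -> vcont (fun l => a *: v l).
Proof.
have := ucont_cst (mulr_ge0 (normc_ge0 a) ler01) (bndZ a (@bnd_id K H)).
by move=> /vcont_op; apply.
Qed.

Lemma vcont_sum I (r : seq I) (F : I -> torus K -> H) :
  (forall i, vcont (F i)) -> vcont (fun l => \sum_(i <- r) F i l).
Proof.
move=> h; elim: r => [|i r IH].
  under eq_fun do rewrite big_nil; exact: vcont_cst.
by under eq_fun do rewrite big_cons; exact: vcontD.
Qed.

Lemma vcont_dft n Y : vcont (dft n Y).
Proof.
by apply: vcontZ; apply: vcont_sum => k; apply: vcont_exp; exact: vcont_cst.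
Qed.

Lemma tensorB (x y x' y' : H) :
  tensor x y - tensor x' y' = tensor (x - x') y + tensor x' (y - y').
Proof.
apply/funext => z; rewrite !fctE /tensor hdotBr scalerBr scalerBl.
by rewrite addrA subrK.
Qed.

Lemma tensorZl (a : K[i]) (x y : H) : tensor (a *: x) y = a *: tensor x y.
Proof. by apply/funext => z; rewrite fctE /tensor !scalerA mulrC. Qed.

Lemma tensor_sandwich (A B : H -> H) (x y : H) c : lin A -> bnd B c ->
  A \o tensor x y \o adjoint B = tensor (A x) (B y).
Proof.
move=> Al Bc; apply/funext => z.
by rewrite /= /tensor (linZ _ _ Al) (adjointPr Bc).
Qed.

Definition torus_node_pi (M j : nat) : torus K := torus_pi (torus_node M j).

(** Each of the M arcs has mass 1 / M, so step approximations integrate to Riemann sums. Their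
    convergence in trace norm transfers to the integral the identities that the discrete Fourier
    transform satisfies exactly at the nodes. *)
Lemma approx_integral_tensor u v : vcont u -> vcont v -> exists J,
  approx (fun l => tensor (u l) (v l)) J /\
  forall e, 0 < e -> exists M0, forall M, (M0 <= M)%N ->
    (trace_norm (J - \sum_(j < M) (M%:R^-1)%:C *:
        tensor (u (torus_node_pi M j)) (v (torus_node_pi M j)))%R <= e%:E)%E.
Proof.
move=> [[B [B0 hB]] hu] [[B' [B'0 hB']] hv].
have mufin := @leb_torusT K.
apply: (@approx_integral_complete _ _ _ _ (@leb_torus K) mufin
    (fun l => tensor (u l) (v l))
    (fun M l => tensor (u (torus_step M l)) (v (torus_step M l)))
    (fun M => \sum_(j < M) (M%:R^-1)%:C *:
        tensor (u (torus_node_pi M j)) (v (torus_node_pi M j))) (fun=> 1%E)).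
- exact: measurable_cst.
- by move=> x; rewrite lee01.
- by rewrite integral_cst// mul1e.
- move=> M M0; pose phi j := tensor (u (torus_node_pi M j)) (v (torus_node_pi M j)).
  have fp := @arc_finite_partition K M M0.
  have hs : simple_fun (@leb_torus K) (@trace_norm K H) (phi \o torus_arc M).
    apply: (simple_fun_comp mufin fp) => j _; exact: tnle_fin (tnle_tensor _ _).
  have -> : \sum_(j < M) (M%:R^-1)%:C *: phi j =
      simple_integral (@leb_torus K) (phi \o torus_arc M).
    rewrite (simple_integral_comp mufin phi fp).
    rewrite (sum_arc (fun j => (fine (leb_torus (torus_arc M @^-1` [set j] : set (torusB K))))%:C *: phi j) M0).
    by apply: eq_bigr => j _; rewrite leb_torus_arc.
  move=> e e0; exists (phi \o torus_arc M), (fun=> 0%E); split=> //.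
  + by move=> x; rewrite /= subrr trace_norm0.
  + by rewrite integral0 lee_fin ltW.
  + by rewrite subrr trace_norm0 lee_fin ltW.
- move=> e e0; have e20 : 0 < e / 2 by rewrite divr_gt0.
  have d0 : 0 < e / 2 / (B' + 1) by rewrite divr_gt0// ltr_wpDl.
  have d0' : 0 < e / 2 / (B + 1) by rewrite divr_gt0// ltr_wpDl.
  have [M0 h1] := hu _ d0; have [M1 h2] := hv _ d0'.
  exists (maxn M0 M1) => M; rewrite geq_max => /andP[MM0 MM1] l.
  rewrite mule1 tensorB; apply/trace_normP.
  apply: tnle_le (tnleD (tnle_tensor _ _) (tnle_tensor _ _)) _.
  rewrite [leRHS]splitr lerD//.
    apply: (@le_trans _ _ (e / 2 / (B' + 1) * B')).
      by apply: ler_pM; rewrite ?rn_ge0//; exact: h1.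
    by rewrite mulrAC ler_pdivrMr ?ltr_wpDl// ler_pM2l//; lra.
  apply: (@le_trans _ _ (B * (e / 2 / (B + 1)))).
    by apply: ler_pM; rewrite ?rn_ge0//; exact: h2.
  by rewrite mulrA ler_pdivrMr ?ltr_wpDl// mulrC ler_pM2l//; lra.
Qed.

Lemma discrete_orthogonality (h : int) M : (`|h| < M)%N ->
  (M%:R^-1)%:C * \sum_(j < M) torus_exp h (torus_node_pi M j) = (h == 0)%:R :> K[i].
Proof.
move=> hM; have M0 : (0 < M)%N by exact: leq_ltn_trans hM.
under eq_bigr do rewrite torus_exp_cis.
have [->|h0] := eqVneq h 0.
  under eq_bigr do rewrite mul0r cis0.
  rewrite sumr_const card_ord (_ : 1 *+ M = (M%:R : K)%:C); last by rewrite rmorph_nat.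
  by rewrite -rmorphM mulVf ?rmorph1// pnatr_eq0 -lt0n.
by rewrite sum_root_of_unity ?mulr0// absz_gt0 h0.
Qed.

(* Exact quadrature for the sesquilinear expressions Psi (d, d) in the discrete
   Fourier transform d: used for the tensor product and the inner product. *)
Lemma dft_quadrature (V : lmodType K[i]) (Psi : H -> H -> V) n Y (h : int) M :
  (forall a x y z, Psi (a *: x + y) z = a *: Psi x z + Psi y z) ->
  (forall a x y z, Psi z (a *: x + y) = conjc a *: Psi z x + Psi z y) ->
  (`|h| + n < M)%N ->
  \sum_(j < M) (M%:R^-1)%:C *: (torus_exp h (torus_node_pi M j) *:
     Psi (dft n Y (torus_node_pi M j)) (dft n Y (torus_node_pi M j))) =
  (n%:R^-1)%:C *: \sum_(1 <= k < n.+1) \sum_(1 <= k' < n.+1)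
     (k%:Z - k'%:Z == h)%:R *: Psi (Y k) (Y k').
Proof.
move=> Pl Pr hM.
have Pl0 z : Psi 0 z = 0.
  by have := Pl (-1) 0 0 z; rewrite scaler0 addr0 scaleN1r addNr.
have Pr0 z : Psi z 0 = 0.
  have := Pr (-1) 0 0 z; rewrite scaler0 addr0 => ->.
  by rewrite rmorphN rmorph1 scaleN1r addNr.
have PlZ a x z : Psi (a *: x) z = a *: Psi x z by have := Pl a x 0 z; rewrite Pl0 !addr0.
have PrZ a x z : Psi z (a *: x) = conjc a *: Psi z x by have := Pr a x 0 z; rewrite Pr0 !addr0.
have Plsum (r : seq nat) (F : nat -> H) z :
    Psi (\sum_(k <- r) F k) z = \sum_(k <- r) Psi (F k) z.
  elim/big_rec2 : _ => [|i x y _ <-]; first exact: Pl0.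
  by have := Pl 1 (F i) y z; rewrite !scale1r.
have Prsum (r : seq nat) (F : nat -> H) z :
    Psi z (\sum_(k <- r) F k) = \sum_(k <- r) Psi z (F k).
  elim/big_rec2 : _ => [|i x y _ <-]; first exact: Pr0.
  by have := Pr 1 (F i) y z; rewrite rmorph1 !scale1r.
pose c : K[i] := ((Num.sqrt n%:R)^-1)%:C.
have cc : c * conjc c = (n%:R^-1)%:C.
  by rewrite /c conjcR -rmorphM -invfM -expr2 sqr_sqrtr.
have E j : torus_exp h (torus_node_pi M j) *:
     Psi (dft n Y (torus_node_pi M j)) (dft n Y (torus_node_pi M j)) =
   (n%:R^-1)%:C *: \sum_(1 <= k < n.+1) \sum_(1 <= k' < n.+1)
     torus_exp (h - (k%:Z - k'%:Z)) (torus_node_pi M j) *: Psi (Y k) (Y k').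
  rewrite /dft -/c PlZ PrZ [c *: _]scalerA cc scalerA mulrC -scalerA; congr (_ *: _).
  rewrite Plsum scaler_sumr; apply: eq_bigr => k _.
  rewrite PlZ Prsum !scaler_sumr; apply: eq_bigr => k' _.
  rewrite PrZ !scalerA -torus_expN -!torus_expD; congr (torus_exp _ _ *: _).
  by rewrite opprK opprB; lia.
under eq_bigr do rewrite E scalerA mulrC -scalerA scaler_sumr.
rewrite -scaler_sumr exchange_big; congr (_ *: _); rewrite big_nat [RHS]big_nat.
apply: eq_bigr => k /andP[k1 kn].
under eq_bigr do rewrite scaler_sumr.
rewrite exchange_big big_nat [RHS]big_nat; apply: eq_bigr => k' /andP[k'1 k'n].
under eq_bigr do rewrite scalerA.
(* The frequency h - (k - k') is below M in modulus, because |k - k'| < n. *)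
rewrite -scaler_suml -mulr_sumr discrete_orthogonality; last by lia.
by congr (_%:R *: _); congr nat_of_bool; apply/eqP/eqP; lia.
Qed.

Lemma tensor_lin_l a (x y z : H) : tensor (a *: x + y) z = a *: tensor x z + tensor y z.
Proof. by apply/funext => w; rewrite !fctE /tensor scalerDr !scalerA mulrC. Qed.

Lemma tensor_lin_r a (x y z : H) :
  tensor z (a *: x + y) = conjc a *: tensor z x + tensor z y.
Proof.
by apply/funext => w; rewrite !fctE /tensor hdotDr hdotZr scalerDl scalerA.
Qed.

Lemma dft_parseval n Y M : (n < M)%N ->
  \sum_(j < M) M%:R^-1 * rn (dft n Y (torus_node_pi M j)) ^+ 2 =
  n%:R^-1 * \sum_(1 <= k < n.+1) rn (Y k) ^+ 2.
Proof.
move=> nM; apply: complexI.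
have Pr (a : K[i]) (x y z : H) : hdot z (a *: x + y) = conjc a * hdot z x + hdot z y.
  by rewrite hdotDr hdotZr.
have e := @dft_quadrature K[i]^o hdot n Y 0 M hdotDZl Pr nM.
rewrite rmorph_sum rmorphM rmorph_sum.
transitivity (\sum_(j < M) (M%:R^-1)%:C *: (torus_exp 0 (torus_node_pi M j) *:
     (hdot (dft n Y (torus_node_pi M j)) (dft n Y (torus_node_pi M j)) : K[i]^o))).
  by apply: eq_bigr => j _; rewrite torus_exp0 scale1r hdotxx rmorphM.
rewrite e; congr (_ * _); apply: eq_big_nat => k /andP[k1 kn].
rewrite (bigD1_seq k) ?iota_uniq ?mem_index_iota ?k1//= subrr eqxx scale1r hdotxx.
rewrite big1 ?addr0// => k' /eqP kk'; rewrite subr_eq0 eqz_nat.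
by case: eqP => [e'|]; [case: kk'|rewrite scale0r].
Qed.

(** The identity [dft_parseval] is exact for every M > n, so the Riemann sums obey the bound and the
    integral inherits it. *)
Lemma periodogram_form n Y : integrable_form (@leb_torus K) (periodogram n Y)
  (n%:R^-1 * \sum_(1 <= k < n.+1) rn (Y k) ^+ 2).
Proof.
move=> L R uL uR.
have [[BL [BL0 hBL]] _] := uL; have [[BR [BR0 hBR]] _] := uR.
have [J [aJ cJ]] := approx_integral_tensor (vcont_op uL (vcont_dft n Y))
   (vcont_op uR (vcont_dft n Y)).
exists J; split.
  move: aJ; congr approx_integral; apply/funext => l.
  by rewrite /periodogram (tensor_sandwich _ _ (hBL l).1 (hBR l)).
move=> a b a0 b0 La Rb; apply/lee_addgt0Pr => e e0.
have [M0 hM] := cJ e e0; pose M := (M0 + n).+1.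
have {}hM := hM M (leq_trans (leq_addr n M0) (leqnSn _)).
set S := \sum_(j < M) _ in hM.
have -> : J = S + (J - S) by rewrite addrC subrK.
rewrite (le_trans (trace_normD _ _))// leeD//; apply/trace_normP.
have nM : (n < M)%N by rewrite ltnS leq_addl.
rewrite -(dft_parseval Y nM) mulr_sumr; apply: tnle_sum => j.
apply: tnle_le (tnleZ _ (tnle_tensor _ _)) _.
rewrite normc_real ger0_norm ?invr_ge0// [leRHS]mulrCA ler_wpM2l ?invr_ge0//.
rewrite expr2 mulrACA; apply: ler_pM; rewrite ?rn_ge0//.
  exact: (La _).2.
exact: (Rb _).2.
Qed.

(** The double sum form is the one that [dft_quadrature] produces; [autocov_gram] turns it into a
    single sum. *)
Definition autocov n Y (h : int) : H -> H :=
  (n%:R^-1)%:C *: \sum_(1 <= k < n.+1) \sum_(1 <= k' < n.+1)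
     (k%:Z - k'%:Z == h)%:R *: tensor (Y k) (Y k').

(** Once M > |h| + n the Riemann sums all equal the autocovariance, so their limit does. *)
Lemma periodogram_fourier n Y (h : int) :
  approx (fun l => torus_exp h l *: periodogram n Y l) (autocov n Y h).
Proof.
have [J [aJ cJ]] := approx_integral_tensor (vcont_exp h (vcont_dft n Y)) (vcont_dft n Y).
have -> : autocov n Y h = J.
  apply/esym/subr0_eq/(en_eq0 NN)/eqP; rewrite eq_le trace_norm_ge0 andbT.
  apply/lee_addgt0Pr => e e0; rewrite add0e.
  have [M0 hM] := cJ e e0; pose M := (M0 + (`|h| + n)).+1.
  have {}hM := hM M (leq_trans (leq_addr _ M0) (leqnSn _)).
  move: hM; under eq_bigr do rewrite tensorZl.
  rewrite (dft_quadrature _ tensor_lin_l tensor_lin_r)//.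
  by rewrite ltnS leq_addl.
move: aJ; congr approx_integral; apply/funext => l.
by rewrite tensorZl.
Qed.

End periodogram_integrals.
(** * The ergodic theorem *)

Section ergodic_theorem.
Context {d : measure_display} {T : measurableType d} {K : realType}.
Variables (mu : {measure set T -> \bar K}) (theta : T -> T).
Hypothesis mu1 : mu setT = 1%E.
Hypothesis mtheta : measurable_fun setT theta.
Hypothesis preserving : forall A, measurable A -> mu (theta @^-1` A) = mu A.
Hypothesis ergodicity : forall A, measurable A -> theta @^-1` A = A ->
  mu A = 0%E \/ mu A = 1%E.

Let theta_mixin := isMeasurableFun.Build _ _ _ _ _ mtheta.
Let theta_mfun : {mfun T >-> T} := HB.pack theta theta_mixin.

Lemma integral_preserving_ge0 (f : T -> \bar K) : measurable_fun setT f ->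
  (forall x, 0 <= f x)%E -> (\int[mu]_x f (theta x) = \int[mu]_x f x)%E.
Proof.
move=> mf f0.
have <- : (\int[pushforward mu theta_mfun]_x f x = \int[mu]_x f x)%E.
  by apply: eq_measure_integral => A mA _; exact: preserving.
by rewrite ge0_integral_pushforward// preimage_setT.
Qed.

Lemma integrable_preserving (f : T -> \bar K) : mu.-integrable setT f ->
  mu.-integrable setT (f \o theta).
Proof.
move=> /integrableP[mf hf]; apply/integrableP; split; first exact: measurableT_comp.
have := @integral_preserving_ge0 (abse \o f) _ _; rewrite /= => -> //.
exact: measurableT_comp.
Qed.

Lemma integral_preserving (f : T -> \bar K) : mu.-integrable setT f ->
  (\int[mu]_x f (theta x) = \int[mu]_x f x)%E.
Proof.
move=> hf; have mf : measurable_fun setT f by case/integrableP : hf.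
have <- : (\int[pushforward mu theta_mfun]_x f x = \int[mu]_x f x)%E.
  by apply: eq_measure_integral => A mA _; exact: preserving.
by rewrite integral_pushforward// preimage_setT//; exact: integrable_preserving.
Qed.

Definition birkhoff_sum (h : T -> K) n x : K := \sum_(k < n) h (iter k theta x).

Lemma birkhoff_sumS h n x : birkhoff_sum h n.+1 x = h x + birkhoff_sum h n (theta x).
Proof.
rewrite /birkhoff_sum big_ord_recl /=; congr (_ + _).
by apply: eq_bigr => k _ /=; rewrite -iterS iterSr.
Qed.

Lemma measurable_iter n : measurable_fun setT (fun x => iter n theta x).
Proof. by elim: n => [|n IH]; [exact: measurable_id|exact: (measurableT_comp mtheta IH)]. Qed.

Lemma measurable_birkhoff_sum h n : measurable_fun setT h ->
  measurable_fun setT (birkhoff_sum h n).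
Proof.
move=> mh; apply: measurable_sum => k.
by apply: measurableT_comp => //; exact: measurable_iter.
Qed.

Variable h : T -> K.
Hypothesis ih : mu.-integrable setT (EFin \o h).

Let mh : measurable_fun setT h.
Proof. by case/integrableP : ih => /measurable_EFinP. Qed.

(** This is max (0, S_1, ..., S_n) with S_k the k-th Birkhoff sum of h, written recursively because
    S_{k+1} = h + S_k o theta. *)
Fixpoint birkhoff_max n x : K :=
  if n is m.+1 then Num.max 0 (h x + birkhoff_max m (theta x)) else 0.

Lemma birkhoff_max_ge0 n x : 0 <= birkhoff_max n x.
Proof. by case: n => //= n; rewrite le_max lexx. Qed.

Lemma birkhoff_maxS n x : birkhoff_max n x <= birkhoff_max n.+1 x.
Proof.
elim: n x => [|n IH] x; first by rewrite /= le_max lexx.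
by rewrite /= ge_max le_max lexx /= le_max lerD2l IH orbT.
Qed.

Lemma birkhoff_sum_le_max n x : birkhoff_sum h n x <= birkhoff_max n x.
Proof.
elim: n x => [|n IH] x; first by rewrite /birkhoff_sum big_ord0.
by rewrite birkhoff_sumS /= le_max lerD2l IH orbT.
Qed.

Lemma integrable_birkhoff_max n : mu.-integrable setT (EFin \o birkhoff_max n).
Proof.
elim: n => [|n IH]; first exact: integrable0.
have i2 : mu.-integrable setT (fun x => (h x)%:E + (birkhoff_max n (theta x))%:E)%E.
  apply: integrableD => //; exact: (integrable_preserving IH).
apply: le_integrable i2 => //=.
  apply/measurable_EFinP; apply: measurable_maxr => //.
  apply: measurable_funD => //.
  by have := integrable_preserving IH => /integrableP[/measurable_EFinP].
move=> x _; rewrite lee_fin ger0_norm ?le_max ?lexx// ge_max normr_ge0 /=.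
exact: ler_norm.
Qed.

Let P n := [set x | 0 < birkhoff_max n x].

Let mP n : measurable (P n).
Proof.
have /integrableP[/measurable_EFinP mm _] := integrable_birkhoff_max n.
rewrite (_ : P n = birkhoff_max n @^-1` `]0, +oo[); last first.
  by apply/seteqP; split=> x /=; rewrite in_itv /= andbT.
by rewrite -[X in measurable X]setTI; exact: mm.
Qed.

(** Garsia's argument, with M_n = [birkhoff_max n]: where M_{n+1} > 0, h = M_{n+1} - M_n o theta >=
    M_{n+1} - M_{n+1} o theta; elsewhere M_{n+1} = 0 and the right side is nonpositive. That side
    has integral 0 because theta preserves mu. *)
Lemma maximal_ergodic n : (0 <= \int[mu]_x (h x * \1_(P n.+1) x)%:E)%E.
Proof.
have iM := integrable_birkhoff_max n.+1; have iMt := integrable_preserving iM.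
have i1 : mu.-integrable setT (fun x => (h x * \1_(P n.+1) x)%:E).
  apply: le_integrable ih => //=.
    by apply/measurable_EFinP; apply: measurable_funM => //; exact: measurable_indic.
  move=> x _; rewrite lee_fin normrM ler_piMr//.
  by rewrite indicE; case: (_ \in _); rewrite ?normr1 ?normr0.
apply: (@le_trans _ _ (\int[mu]_x ((birkhoff_max n.+1 x)%:E - (birkhoff_max n.+1 (theta x))%:E))%E).
  rewrite integralB//; have := integral_preserving iM => /= ->.
  rewrite subee//; exact: integrable_fin_num iM.
apply: le_integral => //; first exact: integrableB.
move=> x _; rewrite -EFinB lee_fin indicE; have [xP|xP] := boolP (x \in P n.+1).
  have h0 : 0 < h x + birkhoff_max n (theta x).
    by move: xP; rewrite inE /P /= lt_max ltxx.
  have -> : birkhoff_max n.+1 x = h x + birkhoff_max n (theta x) by rewrite /= max_r ?ltW.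
  by rewrite mulr1 lerBlDr lerD2l birkhoff_maxS.
rewrite mulr0; have /negP := xP; rewrite inE /P => h0.
have -> : birkhoff_max n.+1 x = 0.
  by apply/eqP; rewrite eq_le birkhoff_max_ge0 andbT leNgt; apply/negP.
by rewrite sub0r oppr_le0 birkhoff_max_ge0.
Qed.

Definition unbounded_sums := [set x | forall b : nat, exists n, b%:R < birkhoff_sum h n x].

Lemma measurable_unbounded_sums : measurable unbounded_sums.
Proof.
rewrite (_ : unbounded_sums =
  \bigcap_(b in [set: nat]) \bigcup_(n in [set: nat]) (birkhoff_sum h n @^-1` `]b%:R, +oo[)).
  apply: bigcapT_measurable => b; apply: bigcupT_measurable => n.
  by rewrite -[X in measurable X]setTI; apply: measurable_birkhoff_sum.
apply/seteqP; split=> x /= hx b.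
  by move=> _; have [n hn] := hx b; exists n => //=; rewrite in_itv /= hn.
by have [n _ /=] := hx b Logic.I; rewrite in_itv /= andbT => hn; exists n.
Qed.

Lemma unbounded_sums_invariant : theta @^-1` unbounded_sums = unbounded_sums.
Proof.
apply/seteqP; split=> x /= hx b.
  have [b' hb'] := nat_ge (b%:R - h x); have [n hn] := hx b'.
  by exists n.+1; rewrite birkhoff_sumS; lra.
have [b' hb'] := nat_ge (b%:R + h x); have [[|n] hn] := hx b'.
  by move: hn; rewrite /birkhoff_sum big_ord0 ltNge ler0n.
by exists n; move: hn; rewrite birkhoff_sumS; lra.
Qed.

(** Unboundedness above is an invariant event. If it had measure 1, almost every point would lie in
    P n for all large n, and the maximal inequality would give h a nonnegative integral in the
    limit. *)
Lemma bounded_birkhoff_sums : (\int[mu]_x (h x)%:E < 0)%E ->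
  {ae mu, forall x, exists b : K, forall n, birkhoff_sum h n x <= b}.
Proof.
move=> hneg; exists unbounded_sums; split.
- exact: measurable_unbounded_sums.
- have [//|D1] := ergodicity measurable_unbounded_sums unbounded_sums_invariant.
  exfalso; move: hneg; apply/negP; rewrite -leNgt.
  have mD := measurable_unbounded_sums.
  have DC0 : mu (~` unbounded_sums) = 0%E.
    have fT : (mu setT < +oo)%E by rewrite mu1 ltry.
    have := measureD measurableT mD fT.
    rewrite setTD setTI => ->; transitivity (1 - 1 : \bar K)%E; last by rewrite subee.
    by congr (_ - _)%E; [exact: mu1|exact: D1].
  have mf n : measurable_fun setT (fun x => (h x * \1_(P n.+1) x)%:E).
    by apply/measurable_EFinP; apply: measurable_funM => //; exact: measurable_indic.
  have cf : {ae mu, forall x, setT x ->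
      (fun n => (h x * \1_(P n.+1) x)%:E) @ \oo --> (h x)%:E}.
    exists (~` unbounded_sums); split=> //; first exact: measurableC.
    apply: subsetC => x xD _; have [n hn] := xD 0%N.
    have PM m : (n <= m)%N -> x \in P m.
      move=> nm; rewrite inE /P /=; apply: (@lt_le_trans _ _ (birkhoff_max n x)).
        exact: lt_le_trans hn (birkhoff_sum_le_max n x).
      elim: m nm => [|m IH]; first by rewrite leqn0 => /eqP ->.
      rewrite leq_eqVlt ltnS => /orP[/eqP -> //|/IH hm].
      exact: le_trans hm (birkhoff_maxS m x).
    apply: cvg_near_cst; exists n => // m /= nm.
    by rewrite indicE PM ?mulr1// (leq_trans nm).
  have ig : mu.-integrable setT (abse \o (EFin \o h)) by exact: integrable_abse.
  have mEh : measurable_fun setT (EFin \o h) by exact/measurable_EFinP.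
  have dom : {ae mu, forall x n, setT x ->
      (`|(h x * \1_(P n.+1) x)%:E| <= (abse \o (EFin \o h)) x)%E}.
    apply: aeW => x n _ /=; rewrite lee_fin normrM ler_piMr//.
    by rewrite indicE; case: (_ \in _); rewrite ?normr1 ?normr0.
  have [_ _ lim] := dominated_convergence measurableT mf mEh cf ig dom.
  rewrite -(cvg_lim _ lim)//; apply: lime_ge; first by apply/cvg_ex; eexists; exact: lim.
  by apply: nearW => n; exact: maximal_ergodic.
- move=> x /= nb b; apply: contrapT => hb; apply: nb; exists b%:R => n.
  by rewrite leNgt; apply/negP => hn; apply: hb; exists n.
Qed.

End ergodic_theorem.
Section birkhoff.
Context {d : measure_display} {T : measurableType d} {K : realType}.
Variables (mu : {measure set T -> \bar K}) (theta : T -> T).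
Hypothesis mu1 : mu setT = 1%E.
Hypothesis mtheta : measurable_fun setT theta.
Hypothesis preserving : forall A, measurable A -> mu (theta @^-1` A) = mu A.
Hypothesis ergodicity : forall A, measurable A -> theta @^-1` A = A ->
  mu A = 0%E \/ mu A = 1%E.

Lemma birkhoff_sum_bound (g : T -> K) (c : K) :
  mu.-integrable setT (EFin \o g) -> (\int[mu]_x (g x)%:E < c%:E)%E ->
  {ae mu, forall x, exists b : K, forall n, birkhoff_sum theta g n x <= n%:R * c + b}.
Proof.
move=> ig gc.
have ic : mu.-integrable setT (cst (- c)%:E).
  apply/integrableP; split=> //=; rewrite integral_cst//.
  by rewrite (_ : mu _ = 1%E) ?mule1 ?ltry//; exact: mu1.
have ih : mu.-integrable setT (EFin \o (fun x => g x - c)).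
  exact: (integrableD measurableT ig ic).
have hneg : (\int[mu]_x (g x - c)%:E < 0)%E.
  under eq_integral => x _ do rewrite EFinD.
  rewrite integralD// integral_cst//.
  rewrite (_ : (_ * _)%E = (- c%:E)%E); last first.
    by rewrite (_ : mu _ = 1%E) ?mule1//; exact: mu1.
  by rewrite subre_lt0//; exact: integrable_fin_num ig.
have bs := bounded_birkhoff_sums mu1 mtheta preserving ergodicity ih hneg.
apply: filterS bs => x [b hb]; exists b => n.
have := hb n; rewrite /birkhoff_sum sumrB sumr_const card_ord.
by rewrite lerBlDl mulr_natl.
Qed.

(** The linear bounds for g with slope m + 1/(k+1) and for - g with slope - m + 1/(k+1) squeeze the
    averages; k ranges over the integers, so one null set serves. *)
Theorem birkhoff (g : T -> K) : mu.-integrable setT (EFin \o g) ->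
  {ae mu, forall x, (fun n => n%:R^-1 * birkhoff_sum theta g n x) @ \oo -->
    fine (\int[mu]_x (g x)%:E)%E}.
Proof.
move=> ig; set m := fine _.
have mE : (\int[mu]_x (g x)%:E = m%:E)%E.
  by rewrite /m fineK//; exact: integrable_fin_num ig.
have ig' : mu.-integrable setT (EFin \o (fun x => - g x)) by rewrite (_ : _ \o _ = (-%E \o (EFin \o g)))%E; [exact: integrableN ig|exact: funext].
have up (k : nat) := @birkhoff_sum_bound g (m + k.+1%:R^-1) ig _.
have dn (k : nat) := @birkhoff_sum_bound (fun x => - g x) (- m + k.+1%:R^-1) ig' _.
have {}up k : {ae mu, forall x, exists b : K, forall n, birkhoff_sum theta g n x <= n%:R * (m + k.+1%:R^-1) + b}.
  by apply: up => j; rewrite mE lte_fin ltrDl invr_gt0.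
have {}dn k : {ae mu, forall x, exists b : K, forall n, birkhoff_sum theta (fun x => - g x) n x <= n%:R * (- m + k.+1%:R^-1) + b}.
  apply: dn => j; under eq_integral => x _ do rewrite EFinN.
  by rewrite integralN ?integrable_add_def// mE -EFinN lte_fin ltrDl invr_gt0.
have {}up : {ae mu, forall x k, exists b : K, forall n, birkhoff_sum theta g n x <= n%:R * (m + k.+1%:R^-1) + b} by exact: ae_foralln.
have {}dn : {ae mu, forall x k, exists b : K, forall n, birkhoff_sum theta (fun x => - g x) n x <= n%:R * (- m + k.+1%:R^-1) + b} by exact: ae_foralln.
apply: filterS2 up dn => x hu hd.
apply/cvgrPdist_le => e e0.
have [k hk] := nat_ge (2 / e).
have ek : k.+1%:R^-1 <= e / 2.
  rewrite -[e / 2]invrK invf_div lef_pV2 ?posrE ?divr_gt0//.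
  by apply: le_trans hk _; rewrite ler_nat.
have [b hb] := hu k; have [b' hb'] := hd k.
have [N hN] := nat_ge ((`|b| + `|b'|) * 2 / e).
exists N.+1 => // n /= Nn.
have n0 : (0 : K) < n%:R by rewrite ltr0n (leq_ltn_trans _ Nn).
have bn : `|b| + `|b'| <= n%:R * (e / 2).
  have : (`|b| + `|b'|) * 2 / e <= n%:R by apply: le_trans hN _; rewrite ler_nat ltnW.
  by rewrite ler_pdivrMr//; lra.
set S := birkhoff_sum _ _ _ _.
have h2 : - S <= n%:R * (- m + k.+1%:R^-1) + b'.
  by have := hb' n; rewrite {1}/birkhoff_sum sumrN.
have h1 : S <= n%:R * (m + k.+1%:R^-1) + b := hb n.
have nk : n%:R * k.+1%:R^-1 <= n%:R * (e / 2) by rewrite ler_pM2l.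
have b1 := ler_norm b; have b2 := ler_norm b'.
have b3 := normr_ge0 b; have b4 := normr_ge0 b'.
clear -h1 h2 nk bn b1 b2 b3 b4 n0.
move: (k.+1%:R^-1 : K) n%:R n0 h1 h2 nk bn => ik nr n0 h1 h2 nk bn.
have h3 : S - nr * m <= nr * e by lra.
have h4 : nr * m - S <= nr * e by lra.
rewrite ler_norml; apply/andP; split.
  by rewrite lerBrDr -(ler_pM2l n0) mulrDr mulVKf ?gt_eqF// mulrN; lra.
by rewrite lerBlDr -(ler_pM2l n0) mulrDr mulVKf ?gt_eqF//; lra.
Qed.

End birkhoff.
(** * Convergence of empirical autocovariances *)

Section paths.
Context {K : realType} {H : hilbertType K}.
#[local] Notation rn := (dot_norm hdot).

Definition cylinders : set_system (int -> H) :=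
  [set C | exists (t : int) (A : set H), <<s @open H >> A /\ C = [set x | A (x t)]].

#[local] Notation paths := (g_sigma_algebraType cylinders).
#[local] Notation borelH := (g_sigma_algebraType (@open H)).

Lemma measurable_coord (t : int) : measurable_fun setT ((fun x => x t) : paths -> borelH).
Proof.
move=> _ A mA; rewrite setTI; apply: sub_sigma_algebra.
by exists t, A.
Qed.

Lemma measurable_shift (t : int) : measurable_fun setT (@Defs.shift K H t : paths -> paths).
Proof.
have h := @measurability _ _ paths paths setT (@Defs.shift K H t) cylinders erefl; apply: h.
move=> _ [_ [u [A [mA ->]] <-]]; rewrite setTI.
by apply: sub_sigma_algebra; exists (u + t), A.
Qed.

Lemma lipschitz_measurable (g : H -> K) (c : K) :
  (forall x y, `|g x - g y| <= c * rn (x - y)) ->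
  measurable_fun setT (g : borelH -> K).
Proof.
move=> gc; apply: (@measurability _ _ _ _ _ _ _ (RGenOpens.measurableE K)).
move=> _ [_ [a [b ->]] <-]; rewrite setTI; apply: sub_sigma_algebra.
suff cg : continuous g by apply: ((continuousP _).1 cg); exact: interval_open.
move=> x; apply/cvgrPdist_le => e e0.
have e0' : 0 < (e / (`|c| + 1))%:C :> K[i].
  by rewrite ltcR divr_gt0// ltr_pwDr.
have near_x : \forall y \near x, `|x - y| < (e / (`|c| + 1))%:C.
  exact: (@cvgr_dist_lt _ _ _ (nbhs x) _ id x (fun A h => h) _ e0').
apply: filterS near_x => y /=; rewrite norm_rn ltcR => xy.
apply: le_trans (gc x y) _; apply: (@le_trans _ _ (`|c| * rn (x - y))).
  by rewrite ler_wpM2r ?rn_ge0 ?ler_norm.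
have c1 : 0 < `|c| + 1 by rewrite ltr_pwDr.
move: xy; rewrite ltr_pdivlMr// => xy.
have := rn_ge0 (x - y); have := normr_ge0 c; nra.
Qed.

Section process.
Context {d : measure_display} {Omega : measurableType d}.
Variables (P : probability Omega K) (X : int -> Omega -> H).
Hypotheses (pX : is_process X) (sX : stationary P X) (eX : ergodic P X).

Let path_of (w : Omega) : paths := X ^~ w.

Let mpath : measurable_fun setT path_of.
Proof.
have h := @measurability _ _ Omega paths setT path_of cylinders erefl; apply: h.
move=> _ [_ [t [A [mA ->]] <-]].
exact: pX.
Qed.

(** Omega carries no shift, so the ergodic theorem is applied to the law of X on path space and the
    null set is pulled back. *)
Theorem process_birkhoff (g : paths -> K) : measurable_fun setT g ->
  P.-integrable setT (fun w => (g (X ^~ w))%:E) ->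
  {ae P, forall w, (fun n => n%:R^-1 * \sum_(k < n) g (Defs.shift k%:Z (X ^~ w))) @ \oo -->
    fine (\int[P]_w (g (X ^~ w))%:E)%E}.
Proof.
move=> mg ig.
pose pf := (pushforward P path_of : {measure set paths -> \bar K}); pose mu := pf mpath.
have mu1 : mu setT = 1%E by exact: (probability_setT P).
have pres (A : set paths) : measurable A -> mu (@Defs.shift K H 1 @^-1` A) = mu A by move=> mA; exact: (sX 1 mA).
have erg (A : set paths) : measurable A -> @Defs.shift K H 1 @^-1` A = A -> mu A = 0%E \/ mu A = 1%E.
  by move=> mA sA; exact: (eX mA sA).
have mEg : measurable_fun setT (EFin \o g) by exact/measurable_EFinP.
have imu : mu.-integrable setT (EFin \o g).
  by apply: integrable_pushforward => //; rewrite preimage_setT.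
have [N [mN N0 hN]] := birkhoff mu1 (measurable_shift 1) pres erg imu.
exists (path_of @^-1` N); split.
- by rewrite -[X in measurable X]setTI; exact: mpath.
- exact: N0.
move=> w /= hw; apply: hN => /= hx; apply: hw.
have := hx; rewrite /mu integral_pushforward ?preimage_setT// => hc.
apply: cvg_trans hc; apply: near_eq_cvg; apply: nearW => n; congr (_ * _).
apply: eq_bigr => k _; congr (g _); apply/funext => t.
suff itE m u : iter m (@Defs.shift K H 1) (X^~ w) u = Defs.shift m%:Z (X^~ w) u by rewrite itE.
elim: m u => [|m IH] u; first by rewrite /Defs.shift addr0.
by rewrite iterS {1}/Defs.shift IH /Defs.shift -addrA -PoszD add1n.
Qed.

Lemma stationary_integral (g : paths -> \bar K) (t : int) : measurable_fun setT g ->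
  (forall x, 0 <= g x)%E ->
  (\int[P]_w g (Defs.shift t (X ^~ w)) = \int[P]_w g (X ^~ w))%E.
Proof.
move=> mg g0.
pose pf := (pushforward P path_of : {measure set paths -> \bar K}); pose mu := pf mpath.
have mgt : measurable_fun setT (g \o Defs.shift t : paths -> \bar K) := measurableT_comp mg (measurable_shift t).
have -> : (\int[P]_w g (Defs.shift t (X ^~ w)) = \int[mu]_x g (Defs.shift t x))%E.
  by rewrite ge0_integral_pushforward// preimage_setT.
have -> : (\int[P]_w g (X ^~ w) = \int[mu]_x g x)%E.
  by rewrite ge0_integral_pushforward// preimage_setT.
pose pf' := (pushforward mu (@Defs.shift K H t : paths -> paths) : {measure set paths -> \bar K}).
pose nu := pf' (measurable_shift t).
have -> : (\int[mu]_x g (Defs.shift t x) = \int[nu]_x g x)%E.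
  by rewrite [RHS]ge0_integral_pushforward//; exact: measurable_shift.
apply: eq_measure_integral => A mA _; exact: (sX t mA).
Qed.

Lemma measurable_path : measurable_fun setT (fun w => X ^~ w : paths).
Proof. exact: mpath. Qed.

Lemma stationary_integral_real (g : paths -> K) (t : int) : measurable_fun setT g ->
  (\int[P]_w (g (Defs.shift t (X ^~ w)))%:E = \int[P]_w (g (X ^~ w))%:E)%E.
Proof.
move=> mg; have mEg : measurable_fun setT (EFin \o g) by exact/measurable_EFinP.
rewrite [LHS]integralE [RHS]integralE; congr (_ - _)%E.
  transitivity (\int[P]_w ((EFin \o g)^\+ (Defs.shift t (X ^~ w))))%E.
    by apply: eq_integral => w _; rewrite !funeposE.
  rewrite stationary_integral//; last exact: measurable_funepos.
  by apply: eq_integral => w _; rewrite !funeposE.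
transitivity (\int[P]_w ((EFin \o g)^\- (Defs.shift t (X ^~ w))))%E.
  by apply: eq_integral => w _; rewrite !funenegE.
rewrite stationary_integral//; last exact: measurable_funeneg.
by apply: eq_integral => w _; rewrite !funenegE.
Qed.

End process.
End paths.

(** * Truncation of empirical autocovariances *)

Section gram_operators.
Context {K : realType} {H : hilbertType K}.
Implicit Types (Y : nat -> H) (n p q : nat).
Notation rn := (dot_norm hdot).

Lemma sum_delta_shift (V : lmodType K[i]) n m (G : nat -> nat -> V) :
  \sum_(1 <= k' < n.+1) \sum_(1 <= k < n.+1) (k == (k' + m)%N)%:R *: G k k' =
  \sum_(i < n - m) G (i.+1 + m)%N i.+1.
Proof.
have inner k' : (0 < k')%N -> \sum_(1 <= k < n.+1) (k == (k' + m)%N)%:R *: G k k' =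
    if (k' < (n - m).+1)%N then G (k' + m)%N k' else 0.
  move=> k0; case: ifP => hk.
    rewrite (bigD1_seq (k' + m)%N) ?iota_uniq//=; last by rewrite mem_index_iota; lia.
    rewrite eqxx scale1r big1 ?addr0// => k /negPf ->; exact: scale0r.
  rewrite big_nat_cond big1// => k /andP[/andP[k1 kn] _].
  by case: eqP => [e|]; [lia|rewrite scale0r].
rewrite -(big_mkord xpredT (fun i => G (i.+1 + m)%N i.+1)).
rewrite -(big_add1 _ _ 0 (n - m).+1 xpredT (fun i => G (i + m)%N i)).
rewrite (@big_nat_widen _ _ _ 1 (n - m).+1 n.+1) ?ltnS ?leq_subr// [RHS]big_mkcond /=.
by apply: eq_big_nat => k' /andP[k1 _]; exact: inner.
Qed.

(** The autocovariance at lag p - q, meant for p or q equal to 0, which treats both signs of the lag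
    at once. Natural subtraction makes the sum empty once p + q >= n. *)
Definition gram n p q Y : H -> H :=
  (n%:R^-1)%:C *: \sum_(i < n - (p + q)) tensor (Y (i.+1 + p)%N) (Y (i.+1 + q)%N).

Lemma autocov_gram n p q Y : (p * q = 0)%N -> autocov n Y (p%:Z - q%:Z) = gram n p q Y.
Proof.
rewrite /autocov /gram => /eqP; rewrite muln_eq0 => /orP[] /eqP ->; congr (_ *: _).
- rewrite add0n; under [RHS]eq_bigr do rewrite addn0.
  rewrite -(@sum_delta_shift _ n q (fun k k' => tensor (Y k') (Y k))).
  apply: eq_bigr => k _; apply: eq_bigr => k' _; congr (_%:R *: _).
  by apply/eqP/eqP; lia.
rewrite addn0; under [RHS]eq_bigr do rewrite addn0.
rewrite exchange_big /= -(@sum_delta_shift _ n p (fun k k' => tensor (Y k) (Y k'))).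
apply: eq_bigr => k _; apply: eq_bigr => k' _; congr (_%:R *: _).
by apply/eqP/eqP; lia.
Qed.

Lemma sum_shift_le n m p (F : nat -> K) : (forall k, 0 <= F k) -> (m + p <= n)%N ->
  \sum_(i < m) F (i.+1 + p)%N <= \sum_(1 <= k < n.+1) F k.
Proof.
move=> F0 mp; rewrite -(big_mkord xpredT (fun i => F (i.+1 + p)%N)).
rewrite -(big_add1 _ _ 0 m.+1 xpredT (fun i => F (i + p)%N)).
have -> : \sum_(1 <= i < m.+1) F (i + p)%N = \sum_(1 + p <= i < m.+1 + p) F i.
  by rewrite big_addn addnK.
have h1 : (1 <= 1 + p)%N by lia.
have h2 : (1 + p <= m.+1 + p)%N by lia.
have h3 : (m.+1 + p <= n.+1)%N by lia.
rewrite (big_cat_nat h1 (leq_trans h2 h3)) /= (big_cat_nat h2 h3) /=.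
by rewrite addrCA lerDl addr_ge0// sumr_ge0.
Qed.

Lemma amgm (t d y : K) : 0 < t -> d * y <= 2^-1 * (t * y ^+ 2 + t^-1 * d ^+ 2).
Proof.
move=> t0; rewrite -subr_ge0.
rewrite (_ : _ - _ = 2^-1 * t^-1 * (t * y - d) ^+ 2); last by field; rewrite gt_eqF.
by rewrite mulr_ge0 ?sqr_ge0// mulr_ge0 ?invr_ge0 ?(ltW t0).
Qed.

(** The map A covers two cases: the identity, which gives the truncation error, and a larger
    projection, which compares truncations with each other. Products of an energy and a tail are
    split by [amgm]. *)
Lemma gram_diff n p q Y (A B : H -> H) (t : K) : 0 < t ->
  (forall y, rn (A y) <= rn y) -> (forall y, rn (B y) <= rn y) ->
  (forall y, rn (A y - B y) <= rn (y - B y)) ->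
  tnle (gram n p q (A \o Y) - gram n p q (B \o Y))
    (t * (n%:R^-1 * \sum_(1 <= k < n.+1) rn (Y k) ^+ 2) +
     t^-1 * (n%:R^-1 * \sum_(1 <= k < n.+1) rn (Y k - B (Y k)) ^+ 2)).
Proof.
move=> t0 hA hB hAB; rewrite /gram -scalerBr -sumrB.
pose y k := rn (Y k); pose e k := rn (Y k - B (Y k)).
have term a b : tnle (tensor (A (Y a)) (A (Y b)) - tensor (B (Y a)) (B (Y b)))
    (2^-1 * (t * (y a ^+ 2 + y b ^+ 2) + t^-1 * (e a ^+ 2 + e b ^+ 2))).
  rewrite (_ : _ - _ = tensor (A (Y a) - B (Y a)) (A (Y b)) + tensor (B (Y a)) (A (Y b) - B (Y b))); last first.
    by apply/funext => z; rewrite !fctE /tensor hdotBr scalerBr scalerBl addrA subrK.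
  apply: tnle_le (tnleD (tnle_tensor _ _) (tnle_tensor _ _)) _.
  have h1 : rn (A (Y a) - B (Y a)) * rn (A (Y b)) <= e a * y b.
    by apply: ler_pM; rewrite ?rn_ge0 ?hAB ?hA.
  have h2 : rn (B (Y a)) * rn (A (Y b) - B (Y b)) <= e b * y a.
    by rewrite mulrC; apply: ler_pM; rewrite ?rn_ge0 ?hAB ?hB.
  by have := amgm (e a) (y b) t0; have := amgm (e b) (y a) t0; lra.
apply: tnle_le (tnleZ _ (tnle_sum _ (fun i : 'I_ _ => term _ _))) _.
rewrite normc_real ger0_norm ?invr_ge0// mulrCA (mulrCA t^-1) -mulrDr ler_wpM2l ?invr_ge0//.
rewrite -mulr_sumr big_split /= -!mulr_sumr !big_split /=.
have pq : (n - (p + q) + p <= n)%N || (n <= p + q)%N by lia.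
have Z (F : nat -> K) s : (forall k, 0 <= F k) -> (s <= p + q)%N ->
    \sum_(i < n - (p + q)) F (i.+1 + s)%N <= \sum_(1 <= k < n.+1) F k.
  move=> F0 sp; have [npq|npq] := leqP n (p + q).
    by rewrite (eqP npq) big_ord0 sumr_ge0.
  by apply: sum_shift_le => //; lia.
have sq0 (g : nat -> K) k : 0 <= g k ^+ 2 by exact: sqr_ge0.
have y1 := Z (fun k => y k ^+ 2) p (sq0 y) (leq_addr _ _).
have y2 := Z (fun k => y k ^+ 2) q (sq0 y) (leq_addl _ _).
have e1 := Z (fun k => e k ^+ 2) p (sq0 e) (leq_addr _ _).
have e2 := Z (fun k => e k ^+ 2) q (sq0 e) (leq_addl _ _).
have ti : 0 < t^-1 by rewrite invr_gt0.
rewrite -/y; move: (\sum_(i < _) y _ ^+ 2) (\sum_(i < _) y (_ + q)%N ^+ 2) y1 y2.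
move: (\sum_(i < _) e _ ^+ 2) (\sum_(i < _) e (_ + q)%N ^+ 2) e1 e2.
rewrite -/(y _) => /= a b; rewrite -/(e _).
move: (\sum_(1 <= k < n.+1) e k ^+ 2) (\sum_(1 <= k < n.+1) y k ^+ 2) => E W aE bE c dd cW dW.
have : t * (c + dd) <= t * (W + W) by rewrite ler_pM2l// lerD.
have : t^-1 * (a + b) <= t^-1 * (E + E) by rewrite ler_pM2l// lerD.
by rewrite !mulrDr; lra.
Qed.

(** Centering subtracts n times the squared norm of the mean from the energy. *)
Lemma sum_centered n Y :
  \sum_(1 <= k < n.+1) rn (centered n Y k) ^+ 2 <= \sum_(1 <= k < n.+1) rn (Y k) ^+ 2.
Proof.
case: n => [|n]; first by rewrite !big_geq.
set N := n.+1; set m := (N%:R^-1 : K[i]) *: \sum_(1 <= j < N.+1) Y j.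
have mE : \sum_(1 <= j < N.+1) Y j = N%:R *: m.
  by rewrite /m scalerA divff ?scale1r// pnatr_eq0.
rewrite /centered -/m; under eq_bigr do rewrite rn_sqrB.
rewrite big_split sumrB /= -mulr_sumr.
have -> : \sum_(1 <= k < N.+1) rdot (Y k) m = N%:R * rn m ^+ 2.
  transitivity (rdot (\sum_(1 <= j < N.+1) Y j) m).
    by rewrite /rdot hdot_suml Re_sum.
  by rewrite mE /rdot hdotZl hdotxx -(rmorph_nat (real_complex K)) -rmorphM.
rewrite sumr_const_nat subSS subn0 -mulr_natl.
have := sqr_ge0 (rn m); have : (0 : K) <= N%:R by [].
move=> h1 h2; have := mulr_ge0 h1 h2; lra.
Qed.

End gram_operators.
Section gram_limits.
Context {K : realType} {H : hilbertType K}.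
Variable phi : nat -> H.
Hypothesis ophi : orthonormal_seq phi.
Implicit Types (Y : nat -> H) (n p q N : nat).
Notation rn := (dot_norm hdot).

Definition head_proj N : H -> H := span_proj (mkseq phi N).

Lemma phi_inj : injective phi.
Proof.
move=> j k jk; have := ophi j k; rewrite jk ophi eqxx; case: eqP => // _ /eqP.
by rewrite oner_eq0.
Qed.

Lemma ons_head N : ons (mkseq phi N).
Proof.
split=> [|x y /mapP[j _ ->] /mapP[k _ ->]].
  by rewrite map_inj_uniq ?iota_uniq//; exact: phi_inj.
by rewrite ophi (inj_eq phi_inj).
Qed.

Lemma head_subset N N' : (N <= N')%N -> {subset mkseq phi N <= mkseq phi N'}.
Proof.
move=> NN x /mapP[j]; rewrite mem_iota add0n => /andP[_ jN] ->.
by apply/mapP; exists j; rewrite // mem_iota add0n (leq_trans jN).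
Qed.

Lemma head_projE N x : head_proj N x = \sum_(i < N) hdot x (phi i) *: phi i.
Proof. by rewrite /head_proj /span_proj big_map -[N in iota 0 N]subn0 -/(index_iota 0 N) big_mkord. Qed.

Lemma rn_head N x : rn (head_proj N x) <= rn x.
Proof. by have := (bnd_proj (ons_head N)).2 x; rewrite mul1r. Qed.

Lemma rn_head_sub N N' x : (N <= N')%N ->
  rn (head_proj N' x - head_proj N x) <= rn (x - head_proj N x).
Proof.
move=> NN; rewrite -{1}[head_proj N x](proj_sub x (ons_head N') (head_subset NN)).
by rewrite -(linB _ _ (lin_proj (mkseq phi N'))) rn_head.
Qed.

Definition matrix_op (c : nat -> nat -> K[i]) N : H -> H :=
  \sum_(i < N) \sum_(j < N) c i j *: tensor (phi i) (phi j).

Lemma matrix_op_diff a b N :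
  tnle (matrix_op a N - matrix_op b N) (\sum_(i < N) \sum_(j < N) normc (a i j - b i j)).
Proof.
have r1 i : rn (phi i) = 1.
  by apply/eqP; rewrite -(@pexpr_eq1 _ _ 2)// ?rn_ge0// rn_sqr /rdot ophi eqxx.
rewrite /matrix_op -sumrB; apply: tnle_sum => i; rewrite -sumrB; apply: tnle_sum => j.
by rewrite -scalerBl; apply: tnle_le (tnleZ _ (tnle_tensor _ _)) _; rewrite !r1 !mulr1.
Qed.

Lemma op_sumE I (r : seq I) (F : I -> H -> H) x : (\sum_(i <- r) F i) x = \sum_(i <- r) F i x.
Proof. by elim/big_rec2 : _ => // i u v _ <-. Qed.

(** After truncation only finitely many scalar entries remain, so trace norm convergence reduces to
    entrywise convergence. *)
Lemma gram_head n p q Y N : gram n p q (head_proj N \o Y) =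
  matrix_op (fun i j => hdot (gram n p q Y (phi j)) (phi i)) N.
Proof.
apply/funext => z; rewrite /matrix_op /gram !fctE !op_sumE scaler_sumr.
have ht x y : tensor (head_proj N x) (head_proj N y) z =
    \sum_(i < N) \sum_(j < N) hdot (tensor x y (phi j)) (phi i) *: tensor (phi i) (phi j) z.
  rewrite /tensor !head_projE hdot_sumr scaler_sumr; apply: eq_bigr => i _.
  rewrite scaler_suml; apply: eq_bigr => j _.
  by rewrite hdotZr hdotZl -hdotC !scalerA; congr (_ *: _); ring.
under eq_bigr do rewrite /= ht scaler_sumr.
rewrite exchange_big /=; apply: eq_bigr => i _; rewrite op_sumE.
under eq_bigr do rewrite scaler_sumr.
rewrite exchange_big /=; apply: eq_bigr => j _.
rewrite !fctE op_sumE hdotZl hdot_suml mulr_sumr scaler_suml.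
by apply: eq_bigr => k _; rewrite scalerA.
Qed.

Lemma tnle_eps (T : H -> H) c : (forall e, 0 < e -> tnle T (c + e)) -> tnle T c.
Proof.
move=> h; split=> [|r pr]; first exact: (h 1 ltr01).1.
by apply/ler_addgt0Pr => e e0; exact: (h e e0).2.
Qed.

Section limit.
Variables (p q : nat) (Y : nat -> nat -> H) (c : nat -> nat -> K[i]) (M : K) (tau : nat -> K).
Hypothesis entries : forall i j,
  (fun n => normc (c i j - hdot (gram n p q (Y n) (phi j)) (phi i))) @ \oo --> (0 : K).
Hypothesis energy : \forall n \near \oo, n%:R^-1 * \sum_(1 <= k < n.+1) rn (Y n k) ^+ 2 <= M.
Hypothesis tail : forall N, \forall n \near \oo,
  n%:R^-1 * \sum_(1 <= k < n.+1) rn (Y n k - head_proj N (Y n k)) ^+ 2 <= tau N.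
Hypothesis tau_gt0 : forall N, 0 < tau N.

(** The bound of [gram_diff] for t = sqrt tau, with energy M and tail tau: sqrt tau M + tau / sqrt
    tau. *)
Definition tail_error N := (M + 1) * Num.sqrt (tau N).

Let entry n i j := hdot (gram n p q (Y n) (phi j)) (phi i).

Lemma entries_near N e : 0 < e ->
  \forall n \near \oo, tnle (matrix_op c N - matrix_op (entry n) N) e.
Proof.
move=> e0.
have h : (fun n => \sum_(i < N) \sum_(j < N) normc (c i j - entry n i j)) @ \oo -->
    \sum_(i < N) \sum_(j < N) (0 : K).
  apply: cvg_sum_seq => i; apply: cvg_sum_seq => j; exact: entries.
rewrite big1 in h => [|i _]; last by rewrite big1.
move/cvgrPdist_le : h => /(_ e e0); apply: filterS => n.
rewrite sub0r normrN => hn; apply: tnle_le (matrix_op_diff _ _ _) _.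
exact: le_trans (ler_norm _) hn.
Qed.

Lemma gram_diff_near N (A : H -> H) : (forall y, rn (A y) <= rn y) ->
  (forall y, rn (A y - head_proj N y) <= rn (y - head_proj N y)) ->
  \forall n \near \oo, tnle (gram n p q (A \o Y n) - matrix_op (entry n) N) (tail_error N).
Proof.
move=> hA hAN; apply: filterS2 energy (tail N) => n en tn.
rewrite -gram_head; have s0 : 0 < Num.sqrt (tau N) by rewrite sqrtr_gt0.
apply: tnle_le (gram_diff n p q (Y n) s0 hA (rn_head N) hAN) _.
rewrite /tail_error mulrDl mul1r [M * _]mulrC lerD//; first by rewrite ler_pM2l.
rewrite mulrC ler_pdivrMr//; apply: le_trans tn _.
by rewrite -expr2 sqr_sqrtr// ltW.
Qed.

(** The operators compared do not depend on n, so one n suffices at which both truncations are close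
    to their limits; there the difference is a truncation error of the same data. *)
Lemma matrix_op_cauchy N N' : (N <= N')%N ->
  tnle (matrix_op c N' - matrix_op c N) (tail_error N).
Proof.
move=> NN; apply: tnle_eps => e e0.
have e2 : 0 < e / 2 by rewrite divr_gt0.
have h1 := entries_near N' e2; have h2 := entries_near N e2.
have h3 := gram_diff_near (rn_head N') (fun y => rn_head_sub y NN).
have [n [[k1 k2] k3]] := filter_ex (filterI (filterI h1 h2) h3).
rewrite gram_head in k3.
apply: tnle_le (_ : tnle _ (e / 2 + tail_error N + e / 2)) _; last lra.
rewrite (_ : _ - _ = (matrix_op c N' - matrix_op (entry n) N') +
  (matrix_op (entry n) N' - matrix_op (entry n) N) - (matrix_op c N - matrix_op (entry n) N)).
  by apply: tnleB k2; exact: tnleD.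
by rewrite opprB !subrKA.
Qed.

Lemma gram_near (C : H -> H) N : tnle (C - matrix_op c N) (tail_error N) ->
  forall e, 0 < e ->
  \forall n \near \oo, tnle (gram n p q (Y n) - C) (2 * tail_error N + e).
Proof.
move=> hC e e0; have h1 := entries_near N e0.
have h2 := @gram_diff_near N id (fun=> lexx _) (fun=> lexx _).
apply: filterS2 h1 h2 => n k1 k2.
apply: tnle_le (_ : tnle _ (tail_error N + e + tail_error N)) _; last lra.
rewrite (_ : _ - C = (gram n p q (id \o Y n) - matrix_op (entry n) N)
   - (matrix_op c N - matrix_op (entry n) N) - (C - matrix_op c N)).
  by apply: tnleB hC; exact: tnleB.
by rewrite !opprB !subrKA.
Qed.

End limit.
End gram_limits.

(** * Limits of scalar averages and covariances *)

Section complex_limits.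
Context {K : realType}.
Implicit Types (a b : nat -> K[i]) (l m : K[i]).

Definition ccvg a l := (fun n => normc (a n - l)) @ \oo --> (0 : K).

Lemma ccvg_le a l (g : nat -> K) : (forall n, normc (a n - l) <= g n) ->
  g @ \oo --> (0 : K) -> ccvg a l.
Proof.
by move=> h g0; apply: squeeze0 g0 => [n|]; [exact: normc_ge0|exact: nearW].
Qed.

Lemma ccvg_ReIm a l : (fun n => complex.Re (a n)) @ \oo --> complex.Re l ->
  (fun n => complex.Im (a n)) @ \oo --> complex.Im l -> ccvg a l.
Proof.
move=> h1 h2; apply: (@ccvg_le _ _ (fun n => `|complex.Re (a n) - complex.Re l| + `|complex.Im (a n) - complex.Im l|)) => [n|].
  by apply: le_trans (normc_le_ReIm _) _; case: (a n) (l) => [x y] [x' y'].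
have z (f : nat -> K) (c : K) : f @ \oo --> c -> (fun n => `|f n - c|) @ \oo --> (0 : K).
  move=> /cvgrPdist_le fc; apply/cvgrPdist_le => e e0; apply: filterS (fc e e0) => n.
  by rewrite sub0r normrN normr_id distrC.
rewrite -[0](addr0 (0 : K)); apply: cvgD; exact: z.
Qed.

Lemma ccvg_cst l : ccvg (fun=> l) l.
Proof. by rewrite /ccvg; under eq_fun do rewrite subrr Normc.normc0; exact: cvg_cst. Qed.

Lemma ccvgD a b l m : ccvg a l -> ccvg b m -> ccvg (fun n => a n + b n) (l + m).
Proof.
move=> h1 h2; apply: (@ccvg_le _ _ (fun n => normc (a n - l) + normc (b n - m))) => [n|].
  by rewrite opprD addrACA normcD_le.
by rewrite -[0](addr0 (0 : K)); exact: cvgD.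
Qed.

Lemma ccvgN a l : ccvg a l -> ccvg (fun n => - a n) (- l).
Proof.
by move=> h; apply: ccvg_le h => n; rewrite -opprD normcN.
Qed.

Lemma ccvgJ a l : ccvg a l -> ccvg (fun n => conjc (a n)) (conjc l).
Proof.
by move=> h; apply: ccvg_le h => n; rewrite -rmorphB normcJ_.
Qed.

Lemma ccvgM a b l m : ccvg a l -> ccvg b m -> ccvg (fun n => a n * b n) (l * m).
Proof.
move=> h1 h2; apply: (@ccvg_le _ _ (fun n => normc (a n - l) * normc (b n - m) +
   (normc (a n - l) * normc m + normc l * normc (b n - m)))) => [n|].
  rewrite (_ : _ - _ = (a n - l) * (b n - m) + ((a n - l) * m + l * (b n - m))); last by ring.
  by rewrite -!Normc.normcM (le_trans (normcD_le _ _))// lerD2l normcD_le.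
rewrite -[X in _ --> X](_ : 0 * 0 + (0 * normc m + normc l * 0) = 0); last by rewrite !mulr0 mul0r !addr0.
apply: cvgD; first exact: cvgM.
by apply: cvgD; apply: cvgM => //; exact: cvg_cst.
Qed.

Lemma ccvg_near a b l : (\forall n \near \oo, a n = b n) -> ccvg a l -> ccvg b l.
Proof.
move=> ab; rewrite /ccvg => h; apply: cvg_trans h; apply: near_eq_cvg.
by apply: filterS ab => n ->.
Qed.

Lemma ccvg_delay a l k : ccvg a l -> ccvg (fun n => a (n - k)%N) l.
Proof.
move=> h; rewrite /ccvg; apply/cvgrPdist_le => e e0.
have /cvgrPdist_le /(_ e e0) [N _ hN] := h.
by exists (N + k)%N => // n /= nN; apply: hN => /=; lia.
Qed.

(** The ratio (n - k) / n tends to 1, and the average of n - k terms is a delayed copy of the full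
    one. *)
Lemma average_truncate (f : nat -> K[i]) l k :
  ccvg (fun n => n%:R^-1%:C * \sum_(i < n) f i) l ->
  ccvg (fun n => n%:R^-1%:C * \sum_(i < n - k) f i) l.
Proof.
move=> h.
have r1 : ccvg (fun n => ((n - k)%:R / n%:R)%:C) 1.
  rewrite /ccvg; apply/cvgrPdist_le => e e0.
  have [N hN] := nat_ge (k%:R / e).
  exists (N + k).+1 => // n /= nN.
  have n0 : (0 : K) < n%:R by rewrite ltr0n; lia.
  change (`|0 - normc (((n - k)%:R / n%:R)%:C - 1)| <= e).
  rewrite sub0r normrN (_ : _%:C - 1 = ((n - k)%:R / n%:R - 1)%:C); last by rewrite rmorphB rmorph1.
  rewrite normc_real normr_id.
  have -> : (n - k)%:R / n%:R - 1 = - (k%:R / n%:R) :> K.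
    have kn : (k <= n)%N by lia.
    by rewrite natrB//; field; rewrite gt_eqF.
  rewrite normrN ger0_norm ?divr_ge0// ler_pdivrMr//.
  have : (N%:R : K) <= n%:R by rewrite ler_nat; lia.
  by move/(le_trans hN); rewrite ler_pdivrMr// mulrC.
rewrite -[l]mul1r; apply: ccvg_near (ccvgM r1 (ccvg_delay k h)).
apply: nearW => n; rewrite mulrA -rmorphM.
have [nk|nk] := leqP n k.
  by rewrite (eqP nk) big_ord0 !mulr0.
rewrite (_ : _ / _ * _ = n%:R^-1)// mulrAC mulfV ?mul1r// pnatr_eq0; lia.
Qed.

(** Expanding the product leaves the limit c and terms with an empirical mean as a factor, which
    vanish because A and B have average 0. Dropping the last p + q terms does not change limits of
    averages. *)
Lemma centered_product_limit (A B : nat -> K[i]) c p q :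
  ccvg (fun n => n%:R^-1%:C * \sum_(i < n) A (i.+1 + p)%N * conjc (B (i.+1 + q)%N)) c ->
  (forall p, ccvg (fun n => n%:R^-1%:C * \sum_(i < n) A (i.+1 + p)%N) 0) ->
  (forall q, ccvg (fun n => n%:R^-1%:C * \sum_(i < n) B (i.+1 + q)%N) 0) ->
  ccvg (fun n => n%:R^-1%:C * \sum_(i < n - (p + q))
    (A (i.+1 + p)%N - n%:R^-1%:C * \sum_(j < n) A j.+1) *
    conjc (B (i.+1 + q)%N - n%:R^-1%:C * \sum_(j < n) B j.+1)) c.
Proof.
move=> hAB hA hB.
have r1 : ccvg (fun n => n%:R^-1%:C * \sum_(i < n - (p + q)) (1 : K[i])) 1.
  apply: (@average_truncate (fun=> 1) 1 (p + q)); apply: ccvg_near (ccvg_cst 1).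
  exists 1%N => // n /= n0; rewrite sumr_const card_ord -(rmorph_nat (real_complex K)) -rmorphM.
  by rewrite mulVf ?rmorph1// pnatr_eq0; lia.
have a0 := hA 0%N; have b0 := hB 0%N.
have tAB := @average_truncate (fun i => A (i.+1 + p)%N * conjc (B (i.+1 + q)%N)) _ (p + q) hAB.
have tA := @average_truncate (fun i => A (i.+1 + p)%N) _ (p + q) (hA p).
have tB := @average_truncate (fun i => B (i.+1 + q)%N) _ (p + q) (hB q).
have e := ccvgD (ccvgD (ccvgD tAB (ccvgN (ccvgM tA (ccvgJ b0))))
  (ccvgN (ccvgM a0 (ccvgJ tB)))) (ccvgM r1 (ccvgM a0 (ccvgJ b0))).
rewrite !mul0r mulr0 oppr0 !addr0 in e; apply: ccvg_near e.
apply: nearW => n /=.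
have s0 (F : nat -> K[i]) : \sum_(i < n) F (i.+1 + 0)%N = \sum_(i < n) F i.+1.
  by apply: eq_bigr => i _; rewrite addn0.
rewrite !s0; set a := _ * \sum_(i < n) A i.+1; set b := _ * \sum_(i < n) B i.+1.
have conjr (x : K) z : conjc (x%:C * z) = x%:C * conjc z.
  by case: z => u v /=; congr (_ +i* _); ring.
rewrite [conjc (_%:C * \sum_(i < n - _) _)]conjr rmorph_sum.
set r := n%:R^-1%:C.
transitivity (r * (\sum_(i < n - (p + q)) A (i.+1 + p)%N * conjc (B (i.+1 + q)%N)
  - (\sum_(i < n - (p + q)) A (i.+1 + p)%N) * conjc b
  - a * (\sum_(i < n - (p + q)) conjc (B (i.+1 + q)%N))
  + (\sum_(i < n - (p + q)) 1) * (a * conjc b))); first by ring.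
congr (r * _); rewrite mulr_suml mulr_sumr mulr_suml -!sumrB -big_split /=.
by apply: eq_bigr => i _; rewrite rmorphB /=; ring.
Qed.

End complex_limits.
Section covariance_limits.
Context {K : realType} {H : hilbertType K}.
Context {d : measure_display} {Omega : measurableType d}.
Variables (P : probability Omega K) (X : int -> Omega -> H).
Hypotheses (pX : is_process X) (sX : stationary P X) (eX : ergodic P X).
Hypothesis X2 : forall t, square_integrable P (X t).
Notation rn := (dot_norm hdot).
Notation paths := (g_sigma_algebraType (@cylinders K H)).

Definition cmeasurable (g : paths -> K[i]) :=
  measurable_fun setT (fun x => complex.Re (g x)) /\
  measurable_fun setT (fun x => complex.Im (g x)).

Lemma cmeasurable_coord t u m : cmeasurable (fun x => hdot (x t) u - m).
Proof.
have D (y z : H) : hdot y u - m - (hdot z u - m) = hdot (y - z) u.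
  by rewrite hdotBl; ring.
split.
- have lm : measurable_fun setT ((fun y => complex.Re (hdot y u - m)) : g_sigma_algebraType (@open H) -> K).
    apply: (@lipschitz_measurable _ _ _ (rn u)) => y z.
    by rewrite -ReB D (le_trans (absRe_le_normc _))// mulrC cauchy_schwarz.
  exact: (measurableT_comp lm (measurable_coord t)).
- have lm : measurable_fun setT ((fun y => complex.Im (hdot y u - m)) : g_sigma_algebraType (@open H) -> K).
    apply: (@lipschitz_measurable _ _ _ (rn u)) => y z.
    have -> : complex.Im (hdot y u - m) - complex.Im (hdot z u - m) = complex.Im (hdot (y - z) u).
      rewrite -D; case: (hdot y u) (hdot z u) (m) => [? ?] [? ?] [? ?]; reflexivity.
    by rewrite (le_trans (ImRe_le_normc _))// mulrC cauchy_schwarz.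
  exact: (measurableT_comp lm (measurable_coord t)).
Qed.

Lemma cmeasurableMJ f g : cmeasurable f -> cmeasurable g ->
  cmeasurable (fun x => f x * conjc (g x)).
Proof.
move=> [f1 f2] [g1 g2]; split.
- rewrite (_ : (fun x => _) = (fun x => complex.Re (f x) * complex.Re (g x) + complex.Im (f x) * complex.Im (g x))).
    by apply: measurable_funD; exact: measurable_funM.
  by apply/funext => x; case: (f x) (g x) => [a b] [c e] /=; ring.
- rewrite (_ : (fun x => _) = (fun x => complex.Im (f x) * complex.Re (g x) - complex.Re (f x) * complex.Im (g x))).
    by apply: measurable_funB; exact: measurable_funM.
  by apply/funext => x; case: (f x) (g x) => [a b] [c e] /=; ring.
Qed.

Lemma measurable_rn_comp (A : H -> H) t : (forall y z, rn (A y - A z) <= rn (y - z)) ->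
  measurable_fun setT ((fun x => rn (A (x t)) ^+ 2) : paths -> K).
Proof.
move=> hA; apply: measurable_funX.
have lm : measurable_fun setT ((fun y => rn (A y)) : g_sigma_algebraType (@open H) -> K).
  apply: (@lipschitz_measurable _ _ _ 1) => y z; rewrite mul1r; apply: le_trans (hA y z).
  have h1 := rnD (A y - A z) (A z); rewrite subrK in h1.
  have h2 := rnD (A z - A y) (A y); rewrite subrK in h2.
  have h3 := rnN (A y - A z); rewrite opprB in h3.
  by rewrite ler_norml; apply/andP; split; lra.
exact: (measurableT_comp lm (measurable_coord t)).
Qed.

Lemma square_integrable_fun t : P.-integrable setT (fun w => (rn (X t w) ^+ 2)%:E).
Proof.
apply/integrableP; split.
  apply/measurable_EFinP.
  exact: (measurableT_comp (@measurable_rn_comp id t (fun=> fun=> lexx _)) (measurable_path pX)).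
have := X2 t; congr (_ < _)%E; apply: eq_integral => w _.
by rewrite /= ger0_norm ?sqr_ge0.
Qed.

Lemma quadratic_integrable (g : paths -> K) (a b : K) t s : measurable_fun setT g ->
  (forall x, `|g x| <= a + b * (rn (x t) ^+ 2 + rn (x s) ^+ 2)) ->
  P.-integrable setT (fun w => (g (X ^~ w))%:E).
Proof.
move=> mg hg.
have i1 := square_integrable_fun t; have i2 := square_integrable_fun s.
have i3 := integrableZl measurableT b (integrableD measurableT i1 i2).
have i0 : P.-integrable setT (EFin \o cst a).
  exact: finite_measure_integrable_cst.
have i4 := integrableD measurableT i0 i3.
apply: le_integrable i4 => //.
  by apply/measurable_EFinP; exact: (measurableT_comp mg (measurable_path pX)).
move=> w _ /=; rewrite lee_fin; apply: le_trans (hg _) _; exact: ler_norm.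
Qed.

Lemma complex_birkhoff (g : paths -> K[i]) (a b : K) t s : cmeasurable g ->
  (forall x, normc (g x) <= a + b * (rn (x t) ^+ 2 + rn (x s) ^+ 2)) ->
  {ae P, forall w, ccvg (fun n => n%:R^-1%:C * \sum_(i < n) g (Defs.shift i%:Z (X ^~ w)))
    (cexp P (fun w => g (X ^~ w)))}.
Proof.
move=> [m1 m2] hg.
have i1 := quadratic_integrable m1 (fun x => le_trans (absRe_le_normc _) (hg x)).
have i2 := quadratic_integrable m2 (fun x => le_trans (ImRe_le_normc _) (hg x)).
have b1 := process_birkhoff pX sX eX m1 i1; have b2 := process_birkhoff pX sX eX m2 i2.
apply: filterS2 b1 b2 => w c1 c2.
have ReM (r : K) z : complex.Re (r%:C * z) = r * complex.Re z.
  by case: z => x y /=; ring.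
have ImM (r : K) z : complex.Im (r%:C * z) = r * complex.Im z.
  by case: z => x y /=; ring.
have ImS n (F : 'I_n -> K[i]) : complex.Im (\sum_i F i) = \sum_i complex.Im (F i).
  by elim/big_rec2 : _ => // i x y _ <-; case: (F i) y => [? ?] [? ?].
apply: ccvg_ReIm.
- by under eq_fun do rewrite ReM Re_sum.
- by under eq_fun do rewrite ImM ImS.
Qed.

Lemma cexp_coord_stationary t u :
  cexp P (fun w => hdot (X t w) u) = cexp P (fun w => hdot (X 0 w) u).
Proof.
have [m1 m2] := cmeasurable_coord 0 u 0.
have s1 := stationary_integral_real pX sX t m1.
have s2 := stationary_integral_real pX sX t m2.
rewrite /cexp /Rintegral; congr (fine _ +i* fine _).
- transitivity (\int[P]_w (complex.Re (hdot (Defs.shift t (X ^~ w) 0) u - 0))%:E)%E.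
    by apply: eq_integral => w _; rewrite /Defs.shift add0r subr0.
  by rewrite s1; apply: eq_integral => w _; rewrite subr0.
- transitivity (\int[P]_w (complex.Im (hdot (Defs.shift t (X ^~ w) 0) u - 0))%:E)%E.
    by apply: eq_integral => w _; rewrite /Defs.shift add0r subr0.
  by rewrite s2; apply: eq_integral => w _; rewrite subr0.
Qed.

Lemma coord_average t u m : m = cexp P (fun w => hdot (X 0 w) u) ->
  {ae P, forall w, ccvg (fun n => n%:R^-1%:C * \sum_(i < n) (hdot (X (i%:Z + t) w) u - m)) 0}.
Proof.
move=> mE; have c := cmeasurable_coord t u 0.
have bound (x : int -> H) : normc (hdot (x t) u - 0) <= rn u ^+ 2 + 1 * (rn (x t) ^+ 2 + rn (x t) ^+ 2).
  rewrite subr0; apply: le_trans (cauchy_schwarz _ _) _.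
  by have := sqr_ge0 (rn u - rn (x t)); have := sqr_ge0 (rn (x t)); have := sqr_ge0 (rn u); lra.
have b := complex_birkhoff c bound; apply: filterS b => w h.
have e : cexp P (fun w => hdot (X t w) u - 0) = m.
  by rewrite mE -(cexp_coord_stationary t u); congr cexp; apply/funext => w'; rewrite subr0.
rewrite e in h; have z := ccvgD h (ccvgN (ccvg_cst m)); rewrite subrr in z.
apply: ccvg_near z.
exists 1%N => // n /= n0.
transitivity (n%:R^-1%:C * \sum_(i < n) hdot (X (i%:Z + t) w) u - m).
  by congr (_ * _ - _); apply: eq_bigr => i _; rewrite /Defs.shift subr0 addrC.
rewrite sumrB sumr_const card_ord mulrBr; congr (_ - _).
rewrite -[m *+ n]mulr_natl mulrA -(rmorph_nat (real_complex K)) -rmorphM mulVf ?rmorph1 ?mul1r//.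
by rewrite pnatr_eq0; lia.
Qed.

(** Subtracting the true means changes neither side; Birkhoff's theorem then applies to the product
    and to each factor at every delay. The data start at time 1, whence p + 1 and q + 1. *)
Lemma scalar_covariance_limit p q u v :
  {ae P, forall w, ccvg
    (fun n => hdot (gram n p q (centered n (fun k => X k%:Z w)) v) u)
    (ccov P (fun w => hdot (X p.+1%:Z w) u) (fun w => hdot (X q.+1%:Z w) v))}.
Proof.
pose mu := cexp P (fun w => hdot (X 0 w) u); pose mv := cexp P (fun w => hdot (X 0 w) v).
have cg := cmeasurableMJ (cmeasurable_coord p.+1%:Z u mu) (cmeasurable_coord q.+1%:Z v mv).
have bound (x : int -> H) : normc ((hdot (x p.+1%:Z) u - mu) * conjc (hdot (x q.+1%:Z) v - mv)) <=
    (normc mu ^+ 2 + normc mv ^+ 2) + (rn u ^+ 2 + rn v ^+ 2) *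
      (rn (x p.+1%:Z) ^+ 2 + rn (x q.+1%:Z) ^+ 2).
  rewrite Normc.normcM normcJ_.
  have h y z m : normc (hdot y z - m) <= rn y * rn z + normc m.
    by apply: le_trans (normcD_le _ _) _; rewrite normcN lerD2r cauchy_schwarz.
  apply: (@le_trans _ _ ((rn (x p.+1%:Z) * rn u + normc mu) * (rn (x q.+1%:Z) * rn v + normc mv))).
    by apply: ler_pM; [exact: normc_ge0|exact: normc_ge0|exact: h|exact: h].
  set y := rn (x _); set z := rn (x _).
  have poly (a b c e m1 m2 : K) : (a * b + m1) * (c * e + m2) <=
     (m1 ^+ 2 + m2 ^+ 2) + (b ^+ 2 + e ^+ 2) * (a ^+ 2 + c ^+ 2).
    have := sqr_ge0 (a * b + m1 - (c * e + m2)); have := sqr_ge0 (a * b - m1).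
    have := sqr_ge0 (c * e - m2); have := sqr_ge0 (a * e); have := sqr_ge0 (c * b).
    by nra.
  exact: poly.
have e1 := complex_birkhoff cg bound.
have e2 : {ae P, forall w p, ccvg (fun n => n%:R^-1%:C * \sum_(i < n) (hdot (X (i%:Z + p.+1%:Z) w) u - mu)) 0}.
  by apply: ae_foralln => p'; exact: coord_average.
have e3 : {ae P, forall w p, ccvg (fun n => n%:R^-1%:C * \sum_(i < n) (hdot (X (i%:Z + p.+1%:Z) w) v - mv)) 0}.
  by apply: ae_foralln => p'; exact: coord_average.
apply: filterS3 e1 e2 e3 => w c1 c2 c3.
pose A k := hdot (X k%:Z w) u - mu; pose B k := hdot (X k%:Z w) v - mv.
have sh (i k : nat) : i%:Z + k.+1%:Z = (i.+1 + k)%N%:Z by lia.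
have := @centered_product_limit _ A B (ccov P (fun w => hdot (X p.+1%:Z w) u) (fun w => hdot (X q.+1%:Z w) v)) p q.
have -> : ccov P (fun w => hdot (X p.+1%:Z w) u) (fun w => hdot (X q.+1%:Z w) v) =
    cexp P (fun w => (hdot (X p.+1%:Z w) u - mu) * conjc (hdot (X q.+1%:Z w) v - mv)).
  by rewrite /ccov !cexp_coord_stationary.
move=> /(_ _ _ _) L; apply: ccvg_near (L _ _ _).
- exists 1%N => // n /= n0.
  have nn : n%:R^-1%:C * n%:R = 1 :> K[i].
    by rewrite -(rmorph_nat (real_complex K)) -rmorphM mulVf ?rmorph1// pnatr_eq0; lia.
  have cen k z m : hdot (centered n (fun k => X k%:Z w) k) z =
      (hdot (X k%:Z w) z - m) - n%:R^-1%:C * \sum_(j < n) (hdot (X j.+1%:Z w) z - m).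
    rewrite /centered hdotBl hdotZl hdot_suml big_add1 big_mkord sumrB sumr_const card_ord.
    rewrite mulrBr -[m *+ n]mulr_natl mulrA nn mul1r fmorphV rmorph_nat.
    by ring.
  rewrite /gram fctE op_sumE hdotZl hdot_suml; congr (_ * _); apply: eq_bigr => i _.
  by rewrite /tensor hdotZl mulrC [hdot v _]hdotC (cen _ u mu) (cen _ v mv).
- apply: ccvg_near c1; apply: nearW => n; congr (_ * _); apply: eq_bigr => i _.
  by rewrite /A /B -!sh /Defs.shift ![_ + i%:Z]addrC.
- move=> p'; apply: ccvg_near (c2 p'); apply: nearW => n; congr (_ * _).
  by apply: eq_bigr => i _; rewrite /A -sh.
- move=> p'; apply: ccvg_near (c3 p'); apply: nearW => n; congr (_ * _).
  by apply: eq_bigr => i _; rewrite /B -sh.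
Qed.

End covariance_limits.
Lemma cst_cvg0 (K : realType) (x : K) : 0 <= x -> (fun _ : nat => x) @ \oo --> (0 : K) -> x = 0.
Proof.
move=> x0 h; apply/eqP; rewrite eq_le x0 andbT; apply/ler_addgt0Pr => e e0.
have /cvgrPdist_le /(_ e e0) [N _ /(_ N (leqnn N))] := h.
by rewrite sub0r normrN add0r ger0_norm.
Qed.

(** * Almost sure trace norm limits of autocovariances *)

Section covariance_operator_limit.
Context {K : realType} {H : hilbertType K}.
Context {d : measure_display} {Omega : measurableType d}.
Variables (P : probability Omega K) (X : int -> Omega -> H).
Hypotheses (pX : is_process X) (sX : stationary P X) (eX : ergodic P X).
Hypothesis X2 : forall t, square_integrable P (X t).
Notation rn := (dot_norm hdot).
Notation paths := (g_sigma_algebraType (@cylinders K H)).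

Definition data (w : Omega) (k : nat) : H := X k%:Z w.

Definition second_moment (A : H -> H) : K := fine (\int[P]_w (rn (A (X 0 w)) ^+ 2)%:E)%E.

Lemma contraction_sub (A : H -> H) : lin A -> (forall y, rn (A y) <= rn y) ->
  forall y z, rn (A y - A z) <= rn (y - z).
Proof. by move=> lA hA y z; rewrite -linB. Qed.

(** A is linear, hence commutes with centering, which does not increase the energy; what remains is
    a Birkhoff average at time 1, moved to time 0 by stationarity. *)
Lemma average_energy (A : H -> H) e : lin A -> (forall y, rn (A y) <= rn y) -> 0 < e ->
  {ae P, forall w, \forall n \near \oo,
    n%:R^-1 * \sum_(1 <= k < n.+1) rn (A (centered n (data w) k)) ^+ 2 <= second_moment A + e}.
Proof.
move=> lA hA e0; have hA' := contraction_sub lA hA.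
have mg := measurable_rn_comp 1 hA'; have mg0 := measurable_rn_comp 0 hA'.
have bound (x : int -> H) : `|rn (A (x 1)) ^+ 2| <= 0 + 1 * (rn (x 1) ^+ 2 + rn (x 1) ^+ 2).
  rewrite ger0_norm ?sqr_ge0// add0r mul1r; apply: (@le_trans _ _ (rn (x 1) ^+ 2)).
    by rewrite ler_pXn2r ?nnegrE ?rn_ge0.
  by rewrite lerDl sqr_ge0.
have b := process_birkhoff pX sX eX mg (quadratic_integrable pX X2 mg bound).
have E : (\int[P]_w (rn (A (X 1 w)) ^+ 2)%:E = \int[P]_w (rn (A (X 0 w)) ^+ 2)%:E)%E.
  exact: (stationary_integral_real pX sX 1 mg0).
rewrite E -/(second_moment A) in b; apply: filterS b => w /cvgrPdist_le /(_ e e0).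
apply: filterS => n hn.
have cE k : A (centered n (data w) k) = centered n (A \o data w) k.
  by rewrite /centered linB// linZ// lin_sum.
under eq_bigr do rewrite cE.
apply: (@le_trans _ _ (n%:R^-1 * \sum_(1 <= k < n.+1) rn ((A \o data w) k) ^+ 2)).
  by rewrite ler_wpM2l ?invr_ge0// sum_centered.
rewrite big_add1 big_mkord.
rewrite (eq_bigr (fun i : 'I_n => rn (A (Defs.shift i%:Z (X ^~ w) 1)) ^+ 2)); last first.
  by move=> i _; rewrite /Defs.shift /data /= -PoszD add1n.
by move: hn; rewrite ler_norml => /andP[h1 h2]; lra.
Qed.

Lemma ae_ex (Q : Omega -> Prop) : {ae P, forall w, Q w} -> exists w, Q w.
Proof.
move=> [N [mN N0 hN]]; apply: contrapT => nex.
have NT : N = setT.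
  by apply/seteqP; split=> // w _; apply: hN => /= q; apply: nex; exists w.
have := probability_setT P; rewrite -NT N0 => /eqP.
by rewrite eq_sym onee_eq0.
Qed.

Variable phi : nat -> H.
Hypothesis ophi : orthonormal_seq phi.
Hypothesis span0 : {ae P, forall w, closed_span (range phi) (X 0 w)}.

Definition head_compl N (y : H) := y - head_proj phi N y.

Lemma lin_head_compl N : lin (head_compl N).
Proof.
move=> a x y; rewrite /head_compl /head_proj (lin_proj (mkseq phi N)).
by rewrite scalerBr opprD addrACA.
Qed.

Lemma rn_head_compl N y : rn (head_compl N y) <= rn y.
Proof. exact: rn_compl_proj (ons_head ophi N). Qed.

Lemma head_compl_cvg y : closed_span (range phi) y ->
  (fun N => rn (head_compl N y)) @ \oo --> (0 : K).
Proof.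
move=> hy; apply/cvgrPdist_le => e e0.
have os : orthonormal_set (range phi).
  by move=> _ _ [j _ <-] [k _ <-]; rewrite ophi (inj_eq (phi_inj ophi)).
have [r [or rphi re]] := closed_span_approx os hy e0.
have [N hN] : exists N, {subset r <= mkseq phi N}.
  elim: r rphi {or re} => [|v r IH] h; first by exists 0%N.
  have [N hN] := IH (fun u ur => h u (mem_behead (s := v :: r) ur)).
  have [j _ jv] := h v (mem_head _ _).
  exists (N + j.+1)%N => u; rewrite inE => /orP[/eqP ->|/hN].
    by rewrite -jv; apply/mapP; exists j => //; rewrite mem_iota; lia.
  by apply: head_subset; exact: leq_addr.
exists N => // n /= Nn; rewrite sub0r normrN ger0_norm ?rn_ge0//; apply: le_trans re.
apply: rn_compl_proj_sub; first exact: ons_head.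
by move=> u /hN; exact: head_subset.
Qed.

Lemma tail_cvg : (fun N => second_moment (head_compl N)) @ \oo --> (0 : K).
Proof.
have h N := contraction_sub (lin_head_compl N) (rn_head_compl N).
have mf N : measurable_fun setT (fun w => (rn (head_compl N (X 0 w)) ^+ 2)%:E).
  apply/measurable_EFinP.
  exact: (measurableT_comp (measurable_rn_comp 0 (h N)) (measurable_path pX)).
have ig := square_integrable_fun pX X2 0.
have cf : {ae P, forall w, setT w ->
    (fun N => (rn (head_compl N (X 0 w)) ^+ 2)%:E) @ \oo --> (cst 0%E w : \bar K)}.
  apply: filterS span0 => w hw _.
  have c := head_compl_cvg hw; have cc := cvgM c c; rewrite mulr0 in cc.
  have sq : (fun N => rn (head_compl N (X 0 w)) ^+ 2) @ \oo --> (0 : K).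
    rewrite (_ : (fun N => _) = (fun N => rn (head_compl N (X 0 w))) * (fun N => rn (head_compl N (X 0 w)))); first exact: cc.
    by apply/funext => N; rewrite expr2.
  have : (fun N => (rn (head_compl N (X 0 w)) ^+ 2)%:E) @ \oo --> (0 : K)%:E.
    by apply/fine_cvgP; split; [exact: nearW|exact: sq].
  by [].
have dom : {ae P, forall w N, setT w -> (`|(rn (head_compl N (X 0 w)) ^+ 2)%:E| <= (rn (X 0 w) ^+ 2)%:E)%E}.
  apply: aeW => w N _; rewrite /= lee_fin ger0_norm ?sqr_ge0//.
  by rewrite ler_pXn2r ?nnegrE ?rn_ge0// rn_head_compl.
have m0 : measurable_fun setT (cst 0%E : Omega -> \bar K) by exact: measurable_cst.
have [_ _] := dominated_convergence measurableT mf m0 cf ig dom.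
by rewrite integral0 => hc; exact: (fine_cvg hc).
Qed.

(** Truncations with the entries c are deterministic and, by one good sample path, Cauchy in trace
    norm; their limit C is then approached along every good path and equals the covariance operator
    by comparison of inner products. *)
Lemma covariance_limit p q :
  {ae P, forall w e, 0 < e -> \forall n \near \oo,
    tnle (gram n p q (centered n (data w)) - cov_op P (X p.+1%:Z) (X q.+1%:Z)) e}.
Proof.
pose c i j := ccov P (fun w => hdot (X p.+1%:Z w) (phi i)) (fun w => hdot (X q.+1%:Z w) (phi j)).
pose M := second_moment id + 1.
(* The summand 1 / (N + 1) keeps tau positive and leaves room above the Birkhoff limit. *)
pose tau N := second_moment (head_compl N) + N.+1%:R^-1.
have sm0 A : 0 <= second_moment A.
  by apply: fine_ge0; apply: integral_ge0 => w _; rewrite lee_fin sqr_ge0.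
have tau0 N : 0 < tau N by rewrite /tau ltr_wpDl ?invr_gt0.
have E1 : {ae P, forall w i j, ccvg (fun n => hdot (gram n p q (centered n (data w)) (phi j)) (phi i)) (c i j)}.
  apply: ae_foralln => i; apply: ae_foralln => j.
  exact: (scalar_covariance_limit pX sX eX X2 p q (phi i) (phi j)).
have E2 : {ae P, forall w, \forall n \near \oo,
    n%:R^-1 * \sum_(1 <= k < n.+1) rn (centered n (data w) k) ^+ 2 <= M}.
  exact: (@average_energy id 1 (fun _ _ _ => erefl) (fun=> lexx _) ltr01).
have E3 : {ae P, forall w N, \forall n \near \oo,
    n%:R^-1 * \sum_(1 <= k < n.+1) rn (head_compl N (centered n (data w) k)) ^+ 2 <= tau N}.
  apply: ae_foralln => N; apply: average_energy; first exact: lin_head_compl.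
    exact: rn_head_compl.
  by rewrite invr_gt0.
pose good w := [/\ (forall i j, (fun n => normc (c i j - hdot (gram n p q (centered n (data w)) (phi j)) (phi i))) @ \oo --> (0 : K)),
   (\forall n \near \oo, n%:R^-1 * \sum_(1 <= k < n.+1) rn (centered n (data w) k) ^+ 2 <= M) &
   forall N, \forall n \near \oo,
     n%:R^-1 * \sum_(1 <= k < n.+1) rn (centered n (data w) k - head_proj phi N (centered n (data w) k)) ^+ 2 <= tau N].
have G : {ae P, forall w, good w}.
  apply: filterS3 E1 E2 E3 => w h1 h2 h3; split=> // i j.
  by have := h1 i j; rewrite /ccvg; under eq_fun do rewrite -normcN opprB.
pose T N := matrix_op phi c N; pose err N := tail_error M tau N.
have err0 : err @ \oo --> (0 : K).
  have t0 : tau @ \oo --> (0 : K).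
    by rewrite -[0](addr0 (0 : K)); apply: cvgD; [exact: tail_cvg|exact: cvg_harmonic].
  have s0 : (fun N => Num.sqrt (tau N)) @ \oo --> (0 : K).
    by rewrite -[0](@sqrtr0 K); apply: continuous_cvg t0; exact: sqrt_continuous.
  have z : (fun N => (M + 1) * Num.sqrt (tau N)) @ \oo --> (M + 1) * 0.
    by apply: cvgM s0; exact: cvg_cst.
  by rewrite mulr0 in z; exact: z.
have [w0 [g1 g2 g3]] := ae_ex G.
have cau m n : (m <= n)%N -> tnle (T n - T m) (err m).
  by move=> mn; apply: (matrix_op_cauchy ophi g1 g2 g3).
have Tb N : tnle (T N) (\sum_(i < N) \sum_(j < N) normc (c i j - 0)).
  rewrite -[T N]subr0 -(_ : matrix_op phi (fun _ _ => 0) N = 0); first exact: matrix_op_diff.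
  by rewrite /matrix_op big1// => i _; rewrite big1// => j _; rewrite scale0r.
have [C hC] := tnle_complete Tb err0 cau.
have lim w : good w -> forall e, 0 < e ->
    \forall n \near \oo, tnle (gram n p q (centered n (data w)) - C) e.
  move=> [k1 k2 k3] e e0; have e4 : 0 < e / 4 by rewrite divr_gt0.
  have /cvgrPdist_le /(_ _ e4) [N _ /(_ N (leqnn N))] := err0.
  rewrite sub0r normrN => hN; have {}hN := le_trans (ler_norm _) hN.
  have := gram_near ophi k1 k2 k3 tau0 (hC N) e4; apply: filterS => n hn.
  by apply: tnle_le hn _; rewrite -/(err N); lra.
have bC : bnd C (err 0%N + \sum_(i < 0) \sum_(j < 0) normc (c i j - 0)).
  by apply: tnle_bnd; rewrite -[C](subrK (T 0%N)); exact: tnleD.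
suff -> : cov_op P (X p.+1%:Z) (X q.+1%:Z) = C by apply: filterS G.
(* On a path where the trace norm limit and the scalar limit both hold, <C v, u> and the covariance
   are limits of the same sequence. *)
have spec u v : hdot (C v) u =
    ccov P (fun w => hdot (X p.+1%:Z w) u) (fun w => hdot (X q.+1%:Z w) v).
  have sl := scalar_covariance_limit pX sX eX X2 p q u v.
  have [w [gw cw]] := ae_ex (filterI G sl).
  have h : ccvg (fun n => hdot (gram n p q (centered n (data w)) v) u) (hdot (C v) u).
    rewrite /ccvg; apply/cvgrPdist_le => e e0.
    pose c0 := rn v * rn u + 1.
    have c0p : 0 < c0 by rewrite ltr_wpDl// mulr_ge0 ?rn_ge0.
    have e1 : 0 < e / c0 by rewrite divr_gt0.
    have := lim w gw _ e1; apply: filterS => n hn.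
    rewrite sub0r normrN ger0_norm ?normc_ge0// -hdotBl.
    apply: le_trans (cauchy_schwarz _ _) _.
    apply: (@le_trans _ _ (e / c0 * rn v * rn u)).
      by rewrite ler_wpM2r ?rn_ge0//; exact: (tnle_bnd hn).2.
    rewrite -mulrA mulrAC ler_pdivrMr// ler_pM2l//.
    by rewrite /c0 lerDl.
  have z := ccvgD h (ccvgN cw); rewrite /ccvg in z.
  have z' : (fun n : nat => normc (hdot (C v) u - ccov P (fun w => hdot (X p.+1%:Z w) u) (fun w => hdot (X q.+1%:Z w) v))) @ \oo --> (0 : K).
    move: z; under eq_fun do rewrite subrr sub0r normcN.
    by [].
  exact: (subr0_eq (Normc.eq0_normc (cst_cvg0 (normc_ge0 _) z'))).
(* Inner products determine the operator, so the choice behind [cov_op] can only return C. *)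
apply: xget_unique => [|C' [_ hC']].
  split=> //; apply/bounded_opP; eexists; last exact: bC.
  by rewrite big_ord0 addr0; exact: tnle_ge0 (hC 0%N).
by apply/funext => v; apply: hdot_inj => u; rewrite hC' spec.
Qed.

Hypothesis cov_shift : forall t h, cov_op P (X (t + h)) (X t) = cov_op P (X h) (X 0).

(** A lag h >= 0 is written h - 0 and a negative one 0 - |h|, so that [autocov_gram] applies; weak
    stationarity moves the covariance to times starting at 1. *)
Theorem autocovariance_limit :
  {ae P, forall w (h : int) e, 0 < e -> \forall n \near \oo,
    tnle (autocov n (centered n (data w)) h - cov_op P (X h) (X 0)) e}.
Proof.
have E1 : {ae P, forall w p e, 0 < e -> \forall n \near \oo,
    tnle (gram n p 0 (centered n (data w)) - cov_op P (X p.+1%:Z) (X 1)) e}.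
  by apply: ae_foralln => p; exact: covariance_limit.
have E2 : {ae P, forall w q e, 0 < e -> \forall n \near \oo,
    tnle (gram n 0 q (centered n (data w)) - cov_op P (X 1) (X q.+1%:Z)) e}.
  by apply: ae_foralln => q; exact: covariance_limit.
apply: filterS2 E1 E2 => w h1 h2 [p|q] e e0.
- have -> : cov_op P (X p) (X 0) = cov_op P (X p.+1%:Z) (X 1).
    by rewrite -(cov_shift 1 p) -PoszD add1n.
  apply: filterS (h1 p e e0) => n; rewrite -autocov_gram ?muln0//.
  by rewrite subr0.
(* [Negz q] is - (q + 1), so the later of the two times is 1 + (q + 1). *)
- have -> : cov_op P (X (Negz q)) (X 0) = cov_op P (X 1) (X q.+2%:Z).
    have e1 : q.+2%:Z + Negz q = 1 by rewrite NegzE -addn1 PoszD addrAC subrr.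
    by have := cov_shift q.+2%:Z (Negz q); rewrite e1 => ->.
  apply: filterS (h2 q.+1 e e0) => n; rewrite -autocov_gram ?mul0n//.
  by rewrite sub0r NegzE.
Qed.

Lemma energy_bound : exists2 M : K, 0 <= M & {ae P, forall w, \forall n \near \oo,
    n%:R^-1 * \sum_(1 <= k < n.+1) rn (centered n (data w) k) ^+ 2 <= M}.
Proof.
exists (second_moment id + 1).
  apply: addr_ge0 => //; apply: fine_ge0.
  by apply: integral_ge0 => w _; rewrite lee_fin sqr_ge0.
exact: (@average_energy id 1 (fun _ _ _ => erefl) (fun=> lexx _) ltr01).
Qed.

End covariance_operator_limit.
(** * Trigonometric approximation and uniform convergence *)

Section fejer_weights.
Context {K : realType}.
Implicit Types (l x : torus K).

Lemma real_complex_sum I (r : seq I) (F : I -> K) :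
  (\sum_(i <- r) F i)%:C = \sum_(i <- r) (F i)%:C :> K[i].
Proof. exact: rmorph_sum. Qed.

Definition fejer_phase l x (k : nat) : K[i] := torus_exp k%:Z l * torus_exp (- k%:Z) x.

(** Fejer's kernel at l - x divided by m; with this normalisation its values at the m nodes form a
    partition of unity. *)
Definition fejer m l x : K :=
  (m%:R ^+ 2)^-1 * normc (\sum_(k < m) fejer_phase l x k) ^+ 2.

Lemma fejer_ge0 m l x : 0 <= fejer m l x.
Proof. by rewrite mulr_ge0 ?invr_ge0 ?sqr_ge0. Qed.

Lemma fejer_phaseS l x k : fejer_phase l x k.+1 = fejer_phase l x 1 * fejer_phase l x k.
Proof.
rewrite /fejer_phase -addn1 PoszD opprD !torus_expD; ring.
Qed.

Lemma fejer_phase_sum l x m : (fejer_phase l x 1 - 1) * \sum_(k < m) fejer_phase l x k =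
  fejer_phase l x m - 1.
Proof.
elim: m => [|m IH].
  by rewrite big_ord0 mulr0 /fejer_phase !torus_exp0 mulr1 subrr.
by rewrite big_ord_recr /= mulrDr IH (fejer_phaseS l x m); ring.
Qed.

Lemma normc_fejer_phase l x k : normc (fejer_phase l x k) = 1.
Proof. by rewrite /fejer_phase Normc.normcM !normc_torus_exp mulr1. Qed.

(** Multiplying the geometric sum by z - 1, with z the first phase, leaves z^m - 1, of modulus at
    most 2; and [chord2] is |z - 1|^2. *)
Lemma fejer_chord2 m l x : (0 < m)%N -> fejer m l x * chord2 l x <= 4 / m%:R ^+ 2.
Proof.
move=> m0.
have -> : chord2 l x = normc (fejer_phase l x 1 - 1) ^+ 2.
  rewrite -chord2_normc; congr (_ ^+ 2).
  have -> : torus_exp 1 l - torus_exp 1 x = torus_exp 1 x * (fejer_phase l x 1 - 1).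
    rewrite mulrBr mulr1 /fejer_phase mulrCA -torus_expD subrr torus_exp0 mulr1.
    by [].
  by rewrite Normc.normcM normc_torus_exp mul1r.
rewrite /fejer -mulrA -exprMn -Normc.normcM mulrC [_ * (_ - 1)]mulrC fejer_phase_sum.
rewrite ler_wpM2r ?invr_ge0 ?sqr_ge0//.
have : normc (fejer_phase l x m - 1) <= 2.
  apply: le_trans (normcD_le _ _) _.
  by rewrite normcN normc_fejer_phase Normc.normc1.
have := normc_ge0 (fejer_phase l x m - 1); nra.
Qed.

Lemma fejerE m l x : (fejer m l x)%:C = \sum_(k < m) \sum_(k' < m)
  ((m%:R ^+ 2)^-1)%:C * (torus_exp (k%:Z - k'%:Z) l * torus_exp (k'%:Z - k%:Z) x).
Proof.
have sq (z : K[i]) : (normc z ^+ 2)%:C = z * conjc z.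
  rewrite normc_sqr; case: z => a b.
  by apply/eqP; rewrite eq_complex /=; apply/andP; split; apply/eqP; ring.
have rM (a b : K) : (a * b)%:C = a%:C * b%:C by rewrite rmorphM.
have cS (F : 'I_m -> K[i]) : conjc (\sum_k F k) = \sum_k conjc (F k) by exact: rmorph_sum.
rewrite /fejer rM sq cS mulr_suml mulr_sumr; apply: eq_bigr => k _.
rewrite !mulr_sumr; apply: eq_bigr => k' _; congr (_ * _).
have conjM (a b : K[i]) : conjc (a * b) = conjc a * conjc b by exact: rmorphM.
by rewrite /fejer_phase conjM -!torus_expN opprK !torus_expD; ring.
Qed.

(** The frequencies k' - k in the kernel are below m in modulus, so quadrature at m nodes is exact
    and keeps only the m diagonal terms, each 1 / m. *)
Lemma fejer_sum m l : (0 < m)%N -> \sum_(j < m) fejer m l (torus_node_pi m j) = 1.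
Proof.
move=> m0; apply: complexI; rewrite real_complex_sum rmorph1.
under eq_bigr do rewrite fejerE.
rewrite exchange_big /=; under eq_bigr do rewrite exchange_big /=.
have mn : (m%:R : K) != 0 by rewrite pnatr_eq0 -lt0n.
transitivity (\sum_(k < m) (m%:R^-1)%:C : K[i]).
  apply: eq_bigr => k _.
  transitivity (\sum_(k' < m) (m%:R^-1)%:C * (torus_exp (k%:Z - k'%:Z) l * (k'%:Z - k%:Z == 0)%:R) : K[i]).
    apply: eq_bigr => k' _.
    rewrite -(@discrete_orthogonality _ (k'%:Z - k%:Z) m); last by have := ltn_ord k; have := ltn_ord k'; lia.
    rewrite expr2 invfM rmorphM !mulr_sumr; apply: eq_bigr => j _; ring.
  rewrite (bigD1 k)//= subrr torus_exp0 eqxx mulr1 mulr1 big1 ?addr0// => k' kk'.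
  rewrite subr_eq0 eqz_nat; have -> : (nat_of_ord k' == k) = false by apply/negbTE.
  by rewrite !mulr0.
by rewrite -real_complex_sum sumr_const card_ord -[_ *+ m]mulr_natl mulfV.
Qed.

End fejer_weights.

Section trigonometric_approximation.
Context {K : realType} {H : hilbertType K}.

Definition trig_op (I : Type) (r : seq I) (h : I -> int) (A : I -> H -> H) (l : torus K) : H -> H :=
  \sum_(i <- r) torus_exp (h i) l *: A i.

Lemma ucont_trig I (r : seq I) h (A : I -> H -> H) M : 0 <= M -> (forall i, bnd (A i) M) ->
  ucont (trig_op r h A).
Proof.
move=> M0 hA; apply: (@ucont_sum _ _ _ r (fun i l => torus_exp (h i) l *: A i)) => i.
by apply: ucont_exp; exact: ucont_cst M0 (hA i).
Qed.

(** The approximant averages the values L (theta, x_j) at the nodes with the weights [fejer]. The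
    modulus of [in_C_uniform_torus] makes the error at most e / 2 + C m (4 / m^2). Index set,
    frequencies and M do not depend on theta, which later gives uniformity. *)
Lemma trig_approximation {E : topologicalType} (L : E * torus K -> H -> H) (e : K) :
  compact [set: E] -> in_C opnorm L -> 0 < e ->
  exists (I : finType) (h : I -> int) (A : E -> I -> H -> H) (M : K),
    [/\ 0 <= M, forall th i, bnd (A th i) M &
        forall th l, bnd (L (th, l) - trig_op (index_enum I) h (A th) l) e].
Proof.
move=> cE iL e0; have cET : compact [set: E * torus K].
  by rewrite -setXTT; apply: compact_setX => //; exact: torus_compact.
have [M [M0 hM]] := in_C_bounded cET iL.
have e20 : 0 < e / 2 by rewrite divr_gt0.
have [C [C0 hC]] := in_C_uniform_torus cE iL e20.
(* For m >= 8 C / e the second part of the error, 4 C / m, is at most e / 2. *)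
have [m' hm'] := nat_ge (8 * C / e); pose m := m'.+1.
have mp : (0 : K) < m%:R by rewrite ltr0n.
have Cm : 4 * C / m%:R <= e / 2.
  have : 8 * C / e <= m%:R by apply: le_trans hm' _; rewrite ler_nat.
  by rewrite !ler_pdivrMr//; lra.
pose I := ('I_m * ('I_m * 'I_m))%type.
pose h (i : I) : int := i.2.1%:Z - i.2.2%:Z.
pose A th (i : I) : H -> H :=
  (((m%:R ^+ 2)^-1)%:C * torus_exp (i.2.2%:Z - i.2.1%:Z) (torus_node_pi m i.1)) *: L (th, torus_node_pi m i.1).
exists I, h, A, M; split=> // [th i|th l].
  apply: bnd_le (bndZ _ (hM _)) _.
  rewrite Normc.normcM normc_torus_exp mulr1 normc_real ger0_norm ?invr_ge0 ?sqr_ge0//.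
  rewrite ler_piMl// invf_le1 ?exprn_gt0//.
  by rewrite exprn_ege1// ler1n.
have tE : trig_op (index_enum _) h (A th) l =
    \sum_(j < m) (fejer m l (torus_node_pi m j))%:C *: L (th, torus_node_pi m j).
  rewrite /trig_op -(pair_big xpredT xpredT (fun j (k : 'I_m * 'I_m) => torus_exp (h (j, k)) l *: A th (j, k))) /=.
  apply: eq_bigr => j _; rewrite fejerE.
  rewrite -(pair_big xpredT xpredT (fun k k' => torus_exp (h (j, (k, k'))) l *: A th (j, (k, k')))) /=.
  rewrite scaler_suml; apply: eq_bigr => k _; rewrite scaler_suml; apply: eq_bigr => k' _.
  by rewrite /A /h /= scalerA; congr (_ *: _); ring.
have LE : L (th, l) = \sum_(j < m) (fejer m l (torus_node_pi m j))%:C *: L (th, l).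
  by rewrite -scaler_suml -real_complex_sum fejer_sum// rmorph1 scale1r.
rewrite tE {1}LE -sumrB; under eq_bigr do rewrite -scalerBr.
have B : bnd (\sum_(j < m) (fejer m l (torus_node_pi m j))%:C *: (L (th, l) - L (th, torus_node_pi m j)))
    (\sum_(j < m) normc (fejer m l (torus_node_pi m j))%:C * (e / 2 + C * chord2 l (torus_node_pi m j))).
  by apply: bnd_sum => j _; apply: bndZ; exact: hC.
apply: bnd_le B _.
apply: (@le_trans _ _ (\sum_(j < m) (fejer m l (torus_node_pi m j) * (e / 2) + C * (4 / m%:R ^+ 2)))).
  apply: ler_sum => j _; rewrite normc_real ger0_norm ?fejer_ge0// mulrDr lerD2l mulrCA.
  by rewrite ler_wpM2l// fejer_chord2.
rewrite big_split /= -mulr_suml fejer_sum// mul1r sumr_const card_ord -[_ *+ m]mulr_natl.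
have -> : m%:R * (C * (4 / m%:R ^+ 2)) = 4 * C / m%:R :> K by field; rewrite gt_eqF.
by move: Cm; lra.
Qed.

End trigonometric_approximation.

(** * Perturbation of quadratic functionals *)

Section quadratic_forms.
Context {K : realType} {H : hilbertType K}.
Implicit Types (mu : {measure set (torusB K) -> \bar K}).
Local Notation NN := (@trace_norm_extended K H).
Local Notation approx mu := (approx_integral mu (@trace_norm K H)).

Lemma ucontB (L L' : torus K -> H -> H) : ucont L -> ucont L' -> ucont (fun l => L l - L' l).
Proof.
move=> [[B [B0 hB]] h] [[B' [B'0 hB']] h']; split.
  by exists (B + B'); split=> [|l]; [exact: addr_ge0|exact: bndB].
move=> e e0; have e20 : 0 < e / 2 by rewrite divr_gt0.
have [M0 h1] := h _ e20; have [M1 h2] := h' _ e20.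
exists (maxn M0 M1) => M; rewrite geq_max => /andP[MM0 MM1] l.
rewrite opprD addrACA -opprD [e]splitr.
by apply: bndB; [exact: h1|exact: h2].
Qed.

(** L F R^H - L' F R'^H = (L - L') F R^H + L' F (R - R')^H, and each summand is estimated by the
    form. *)
Lemma form_diff mu (F : torusB K -> H -> H) k L L' R R' J J' a e :
  (mu setT < +oo)%E -> integrable_form mu F k -> (forall l, lin (F l)) ->
  ucont L -> ucont L' -> ucont R -> ucont R' -> 0 <= a -> 0 <= e ->
  (forall l, bnd (L' l) a) -> (forall l, bnd (R l) a) ->
  (forall l, bnd (L l - L' l) e) -> (forall l, bnd (R l - R' l) e) ->
  approx mu (fun l => L l \o F l \o adjoint (R l)) J ->
  approx mu (fun l => L' l \o F l \o adjoint (R' l)) J' ->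
  tnle (J - J') (2 * a * e * k).
Proof.
move=> mufin iF lF uL uL' uR uR' a0 e0 L'a Ra LL RR aJ aJ'.
have [J1 [a1 b1]] := iF _ _ (ucontB uL uL') uR.
have [J2 [a2 b2]] := iF _ _ uL' (ucontB uR uR').
have -> : J - J' = J1 + J2.
  apply: (approx_integral_uniq mufin NN (approx_integralB mufin aJ aJ')).
  have := approx_integralD mufin NN a1 a2; congr approx_integral; apply/funext => l.
  have [[BR' [BR'0 hBR']] _] := uR'.
  rewrite (adjointB (Ra l) (hBR' l)); apply/funext => z; rewrite !fctE /=.
  by rewrite (linB _ _ (lF l)) (linB _ _ (L'a l).1) subrKA.
have t1 := (trace_normP _ _).1 (b1 e a e0 a0 LL Ra).
have t2 := (trace_normP _ _).1 (b2 a e a0 e0 L'a RR).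
by apply: tnle_le (tnleD t1 t2) _; rewrite le_eqVlt; apply/orP; left; apply/eqP; ring.
Qed.

(** Taking adjoints conjugates the exponentials, so only Fourier coefficients at differences of
    frequencies enter. *)
Lemma trig_form mu (F : torusB K -> H -> H) (c : int -> H -> H) (M : K)
    I (r : seq I) h (A : I -> H -> H) I' (r' : seq I') h' (B : I' -> H -> H) :
  (mu setT < +oo)%E -> 0 <= M -> (forall i, bnd (A i) M) -> (forall i, bnd (B i) M) ->
  (forall k, approx mu (fun l => torus_exp k l *: F l) (c k)) ->
  (forall l, lin (F l)) ->
  approx mu (fun l => trig_op r h A l \o F l \o adjoint (trig_op r' h' B l))
    (\sum_(i <- r) \sum_(j <- r') (A i \o c (h i - h' j) \o adjoint (B j))).
Proof.
move=> mufin M0 hA hB hc lF.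
have := approx_integral_sum mufin r
  (fun i => approx_integral_sum mufin r'
     (fun j => approx_integral_sandwich mufin M0 M0 (hA i) (hB j) (hc (h i - h' j)))).
congr approx_integral; apply/funext => l.
have adj : adjoint (trig_op r' h' B l) = \sum_(j <- r') torus_exp (- h' j) l *: adjoint (B j).
  have bT : bnd (trig_op r' h' B l) (\sum_(j <- r') M).
    by apply: bnd_sum => j _; have := bndZ (torus_exp (h' j) l) (hB j); rewrite normc_torus_exp mul1r.
  apply: (adjoint_uniq bT) => x y; rewrite /trig_op !op_sumE hdot_suml hdot_sumr.
  apply: eq_bigr => j _; rewrite !fctE hdotZl hdotZr torus_expN conjcK.
  by rewrite (adjointP (hB j)).
apply/funext => z; rewrite adj /trig_op /= !op_sumE; apply: eq_bigr => i _.
rewrite !op_sumE lin_sum// !fctE (lin_sum _ _ _ (hA i).1) scaler_sumr.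
apply: eq_bigr => j _ /=; rewrite !fctE torus_expD.
by rewrite (linZ _ _ (hA i).1) (linZ _ _ (lF l)) (linZ _ _ (hA i).1) scalerA.
Qed.

(** Each integral is replaced by its trigonometric version at the cost 2 a e k1 or 2 a e k2; between
    the two versions only finitely many Fourier coefficients differ, each by at most t. *)
Lemma form_limit mu1 mu2 (F1 F2 : torusB K -> H -> H) (c1 c2 : int -> H -> H) (k1 k2 M a e t : K)
    L R J1 J2 I (r : seq I) h (A : I -> H -> H) I' (r' : seq I') h' (B : I' -> H -> H) :
  (mu1 setT < +oo)%E -> (mu2 setT < +oo)%E ->
  integrable_form mu1 F1 k1 -> integrable_form mu2 F2 k2 ->
  (forall l, lin (F1 l)) -> (forall l, lin (F2 l)) ->
  (forall k, approx mu1 (fun l => torus_exp k l *: F1 l) (c1 k)) ->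
  (forall k, approx mu2 (fun l => torus_exp k l *: F2 l) (c2 k)) ->
  0 <= M -> 0 <= a -> 0 <= e -> ucont L -> ucont R ->
  (forall i, bnd (A i) M) -> (forall i, bnd (B i) M) ->
  (forall l, bnd (trig_op r h A l) a) -> (forall l, bnd (R l) a) ->
  (forall l, bnd (L l - trig_op r h A l) e) -> (forall l, bnd (R l - trig_op r' h' B l) e) ->
  (forall i j, tnle (c1 (h i - h' j) - c2 (h i - h' j)) t) ->
  approx mu1 (fun l => L l \o F1 l \o adjoint (R l)) J1 ->
  approx mu2 (fun l => L l \o F2 l \o adjoint (R l)) J2 ->
  tnle (J1 - J2) (2 * a * e * (k1 + k2) + \sum_(i <- r) \sum_(j <- r') t * M * M).
Proof.
move=> f1 f2 i1 i2 l1 l2 h1 h2 M0 a0 e0 uL uR hA hB hT hR LA RB ht a1 a2.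
have uA := ucont_trig r h M0 hA; have uB := ucont_trig r' h' M0 hB.
have d1 := form_diff f1 i1 l1 uL uA uR uB a0 e0 hT hR LA RB a1
  (trig_form r h r' h' f1 M0 hA hB h1 l1).
have d2 := form_diff f2 i2 l2 uL uA uR uB a0 e0 hT hR LA RB a2
  (trig_form r h r' h' f2 M0 hA hB h2 l2).
set S1 := \sum_(i <- r) _ in d1; set S2 := \sum_(i <- r) _ in d2.
have d3 : tnle (S1 - S2) (\sum_(i <- r) \sum_(j <- r') t * M * M).
  rewrite /S1 /S2 -sumrB; apply: tnle_sum => i; rewrite -sumrB; apply: tnle_sum => j.
  rewrite (_ : _ - _ = A i \o (c1 (h i - h' j) - c2 (h i - h' j)) \o adjoint (B j)).
    have ts := tnle_sandwich M0 M0 (hA i) (hB j) (ht i j).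
    by rewrite -mulrA mulrC; exact: ts.
  by apply/funext => z; rewrite !fctE /= (linB _ _ (hA i).1).
rewrite (_ : J1 - J2 = (J1 - S1) + (S1 - S2) - (J2 - S2)).
  by apply: tnle_le (tnleB (tnleD d1 d3) d2) _; lra.
by rewrite opprB !subrKA.
Qed.

(** The functions may differ only where the integrable h is infinite. There a small multiple of h is
    still +oo and dominates any error, while its integral is at most e. *)
Lemma approx_ae_eq mu (F G : torusB K -> H -> H) (h : torusB K -> \bar K) J :
  (mu setT < +oo)%E -> measurable_fun setT h -> (forall x, 0 <= h x)%E ->
  (\int[mu]_x h x < +oo)%E -> (forall x, (h x < +oo)%E -> F x = G x) ->
  approx mu F J -> approx mu G J.
Proof.
move=> mufin mh h0 hfin FG aF; apply: (approx_integral_limit NN) => e e0.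
have ifin : (\int[mu]_x h x)%E \is a fin_num by rewrite ge0_fin_numE// integral_ge0.
set b := fine (\int[mu]_x h x)%E; have b0 : 0 <= b by apply: fine_ge0; exact: integral_ge0.
pose t := e / (b + 1); have t0 : 0 < t by rewrite divr_gt0// ltr_wpDl.
exists F, J, (fun x => t%:E * h x)%E; split=> //.
- split; first exact: measurable_funeM.
  by move=> x; rewrite mule_ge0// lee_fin ltW.
- move=> x; have [hx|hx] := ltP (h x) +oo%E.
    by rewrite FG// subrr trace_norm0 mule_ge0// lee_fin ltW.
  have -> : h x = +oo%E by apply/eqP; rewrite -leye_eq.
  by rewrite gt0_muley ?leey// lte_fin.
- rewrite ge0_integralZl_EFin//; last exact: ltW.
  rewrite -(fineK ifin) -/b -EFinM lee_fin /t mulrAC ler_pdivrMr ?ltr_wpDl//.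
  by rewrite ler_pM2l// lerDl.
- by rewrite subrr trace_norm0 lee_fin ltW.
Qed.

(* A density is only almost everywhere trace class; it may be redefined to
   vanish where it fails to be linear. *)
Definition linear_part (T : H -> H) : H -> H := if `[< lin T >] then T else fun=> 0.

Lemma lin_linear_part T : lin (linear_part T).
Proof.
rewrite /linear_part; case: asboolP => // _ a x y.
by rewrite scaler0 addr0.
Qed.

Lemma approx_linear_part mu (f : torusB K -> H -> H) I (Phi : torusB K -> (H -> H) -> H -> H) :
  (mu setT < +oo)%E -> approx mu f I -> forall J,
  approx mu (fun l => Phi l (f l)) J -> approx mu (fun l => Phi l (linear_part (f l))) J.
Proof.
move=> mufin af J; have [h [mh h0 fh hfin]] := approx_integral_dom mufin NN af.
apply: (approx_ae_eq mufin mh h0 hfin) => x hx; congr (Phi x _).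
have := le_lt_trans (fh x) hx => tf; rewrite /linear_part asboolT//.
have tfin : trace_norm (f x) \is a fin_num by rewrite ge0_fin_numE// trace_norm_ge0.
have le_tf : (trace_norm (f x) <= (fine (trace_norm (f x)))%:E)%E by rewrite fineK.
exact: ((trace_normP _ _).1 le_tf).1.
Qed.

End quadratic_forms.
Section uniform_convergence.
Context {K : realType} {H : hilbertType K} {Theta : metricType K}.
Variables (L R : Theta * torus K -> H -> H).
Hypotheses (cT : compact [set: Theta]) (iL : in_C opnorm L) (iR : in_C opnorm R).
Local Notation approx mu := (approx_integral mu (@trace_norm K H)).
Local Notation NN := (@trace_norm_extended K H).

Let uL th : ucont (fun l => L (th, l)). Proof. exact: in_C_ucont. Qed.
Let uR th : ucont (fun l => R (th, l)). Proof. exact: in_C_ucont. Qed.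

(** Compactness of the torus makes the change of L and R near theta uniform in l, and [form_diff]
    converts it into a trace norm bound. *)
Lemma form_in_C (mu : {measure set (torusB K) -> \bar K}) (F : torusB K -> H -> H) k
    (Q : Theta -> H -> H) : (mu setT < +oo)%E -> 0 <= k ->
  integrable_form mu F k -> (forall l, lin (F l)) ->
  (forall th, approx mu (fun l => L (th, l) \o F l \o adjoint (R (th, l))) (Q th)) ->
  in_C (@trace_norm K H) Q.
Proof.
move=> mufin k0 iF lF aQ.
have cET : compact [set: Theta * torus K].
  by rewrite -setXTT; apply: compact_setX => //; exact: torus_compact.
have [a1 [a10 ha1]] := in_C_bounded cET iL; have [a2 [a20 ha2]] := in_C_bounded cET iR.
pose a := a1 + a2; have a0 : 0 <= a by exact: addr_ge0.
have hL p : bnd (L p) a by apply: bnd_le (ha1 p) _; rewrite lerDl.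
have hR p : bnd (R p) a by apply: bnd_le (ha2 p) _; rewrite lerDr.
split=> [th|th e e0].
  have [J [aJ bJ]] := iF _ _ (uL th) (uR th).
  rewrite (approx_integral_uniq mufin NN (aQ th) aJ).
  by apply: le_lt_trans (bJ a a a0 a0 (fun l => hL _) (fun l => hR _)) _; rewrite ltry.
pose c := 2 * a * k + 1; have c0 : 0 < c by rewrite ltr_wpDl// !mulr_ge0.
have d0 : 0 < e / 2 / c by rewrite !divr_gt0.
have nL := in_C_uniform_near th iL d0; have nR := in_C_uniform_near th iR d0.
apply: filterS2 nL nR => th' h1 h2.
have t := form_diff mufin iF lF (uL th') (uL th) (uR th') (uR th) a0 (ltW d0)
  (fun l => hL _) (fun l => hR _) h1 h2 (aQ th') (aQ th).
apply: le_lt_trans ((trace_normP _ _).2 t) _; rewrite lte_fin.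
have : 2 * a * k * (e / 2 / c) <= e / 2.
  rewrite mulrA ler_pdivrMr// mulrC ler_pM2l ?divr_gt0//.
  by rewrite /c lerDl.
by move: e0; set x := _ / c; nra.
Qed.

Lemma forms_limit (mun : nat -> {measure set (torusB K) -> \bar K})
    (mu : {measure set (torusB K) -> \bar K})
    (Fn : nat -> torusB K -> H -> H) (F : torusB K -> H -> H)
    (kn : nat -> K) (k M : K) (cn : nat -> int -> H -> H) (c : int -> H -> H)
    (Qn : nat -> Theta -> H -> H) (Q : Theta -> H -> H) :
  (forall n, (mun n setT < +oo)%E) -> (mu setT < +oo)%E ->
  (forall n, integrable_form (mun n) (Fn n) (kn n)) -> integrable_form mu F k ->
  (forall n l, lin (Fn n l)) -> (forall l, lin (F l)) ->
  0 <= k -> 0 <= M -> (\forall n \near \oo, kn n <= M) ->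
  (forall n h, approx (mun n) (fun l => torus_exp h l *: Fn n l) (cn n h)) ->
  (forall h, approx mu (fun l => torus_exp h l *: F l) (c h)) ->
  (forall h e, 0 < e -> \forall n \near \oo, tnle (cn n h - c h) e) ->
  (forall n th, approx (mun n) (fun l => L (th, l) \o Fn n l \o adjoint (R (th, l))) (Qn n th)) ->
  (forall th, approx mu (fun l => L (th, l) \o F l \o adjoint (R (th, l))) (Q th)) ->
  forall e, 0 < e -> \forall n \near \oo, forall th, (trace_norm (Qn n th - Q th)%R < e%:E)%E.
Proof.
move=> fn f0 iFn iF lFn lF k0 M0 knM h hc hn aQn aQ e e0.
have cET : compact [set: Theta * torus K].
  by rewrite -setXTT; apply: compact_setX => //; exact: torus_compact.
have [a1 [a10 ha1]] := in_C_bounded cET iL; have [a2 [a20 ha2]] := in_C_bounded cET iR.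
pose a := a1 + a2 + 1; have a0 : 0 <= a by rewrite !addr_ge0.
pose s := M + k; have s0 : 0 <= s by exact: addr_ge0.
pose g := 2 * a * s + 1; have g0 : 0 < g by rewrite ltr_wpDl// !mulr_ge0.
(* d <= 1 makes a, with its extra 1, a bound for the trigonometric approximants of L; d g <= e / 4
   controls the approximation error, and the later t the finite combination. *)
pose d := Num.min 1 (e / 4 / g).
have d0 : 0 < d by rewrite lt_min ltr01 !divr_gt0.
have [I [hI [A [MA [MA0 hA LA]]]]] := trig_approximation cT iL d0.
have [I' [hI' [B [MB [MB0 hB RB]]]]] := trig_approximation cT iR d0.
pose m := MA + MB; have m0 : 0 <= m by rewrite addr_ge0.
have hA' th i : bnd (A th i) m by apply: bnd_le (hA th i) _; rewrite lerDl.
have hB' th i : bnd (B th i) m by apply: bnd_le (hB th i) _; rewrite lerDr.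
have hR p : bnd (R p) a by apply: bnd_le (ha2 p) _; rewrite /a; lra.
have hT th l : bnd (trig_op (index_enum I) hI (A th) l) a.
  have := bndB (ha1 (th, l)) (LA th l); rewrite subKr => h1; apply: bnd_le h1 _.
  have d1 : d <= 1 by rewrite ge_min lexx.
  by rewrite /a; lra.
pose C : K := \sum_(i <- index_enum I) \sum_(j <- index_enum I') m * m.
have C0 : 0 <= C by apply: sumr_ge0 => i _; apply: sumr_ge0 => j _; exact: mulr_ge0.
pose t := e / 4 / (C + 1); have t0 : 0 < t by rewrite !divr_gt0// ltr_wpDl.
have near_c : \forall n \near \oo, forall i j, tnle (cn n (hI i - hI' j) - c (hI i - hI' j)) t.
  by apply: filter_forall => i; apply: filter_forall => j; exact: (hn _ _ t0).
apply: filterS2 knM near_c => n kM nc th.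
have q := form_limit (fn n) f0 (iFn n) iF (lFn n) lF (h n) hc m0 a0 (ltW d0) (uL th) (uR th)
  (hA' th) (hB' th) (hT th) (fun l => hR _) (LA th) (RB th) nc (aQn n th) (aQ th).
apply: le_lt_trans ((trace_normP _ _).2 q) _; rewrite lte_fin.
have b1 : 2 * a * d * (kn n + k) <= e / 4.
  apply: (@le_trans _ _ (2 * a * d * s)).
    by rewrite ler_wpM2l ?lerD2r// !mulr_ge0// ltW.
  have dg : d <= e / 4 / g by rewrite ge_min lexx orbT.
  have dg' : d * g <= e / 4 by rewrite -ler_pdivlMr.
  apply: le_trans dg'; rewrite mulrAC mulrC ler_pM2l//.
  by rewrite /g lerDl.
have b2 : \sum_(i <- index_enum I) \sum_(j <- index_enum I') t * m * m <= e / 4.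
  rewrite (_ : \sum_(i <- _) _ = t * C); last first.
    rewrite /C mulr_sumr; apply: eq_bigr => i _; rewrite mulr_sumr.
    by apply: eq_bigr => j _; rewrite mulrA.
  rewrite /t mulrAC ler_pdivrMr ?ltr_wpDl// ler_pM2l ?divr_gt0//.
  by rewrite lerDl.
by move: b1 b2; lra.
Qed.

End uniform_convergence.

Theorem theorem4p3 (K : realType) (H : hilbertType K)
    (d : measure_display) (Omega : measurableType d) (P : probability Omega K)
    (X : int -> Omega -> H)
    (nu : set (torusB K) -> H -> H) (f : torusB K -> H -> H)
    (Theta : metricType K) (L R : Theta * torus K -> H -> H)
    (s : nat -> K) (phi : nat -> H) :
  infinite_dimensional H -> separable H ->
  is_process X -> stationary P X -> ergodic P X -> weakly_stationary P X ->
  spectral_measure P X nu f ->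
  compact [set: Theta] ->
  in_C opnorm L -> in_C opnorm R ->
  (forall k, 1 <= s k) -> orthonormal_seq phi ->
  {homo s : j k / (j <= k)%N >-> j <= k} -> s @ \oo --> +oo ->
  {ae P, forall w, weighted_space s phi (X 0 w)} ->
  (\int[P]_w ((dot_norm (weighted_dot s phi) (X 0 w)) ^+ 2)%:E < +oo)%E ->
  in_C (weighted_opnorm s phi) L -> in_C (weighted_opnorm s phi) R ->
  {ae P, forall w,
    unif_cvg_in_C trace_norm
      (fun n => Q_periodogram L R n (fun k => X k%:Z w))
      (Q_spectral L R nu f)}.
Proof.
move=> _ _ pX sX eX [X2 _ covX] [tcm dens spec] cT iL iR _ ophi _ _ wX _ _ _.
have span0 : {ae P, forall w, closed_span (range phi) (X 0 w)}.
  by apply: filterS wX => w [].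
have NN := @trace_norm_extended K H.
pose mu := norm_measure_of tcm; have mufin : (mu setT < +oo)%E := norm_measureT tcm.
have af (A : set (torusB K)) : measurable A ->
    approx_integral mu (@trace_norm K H) (fun l => (\1_A l : K[i]) *: f l) (nu A).
  by move=> mA; apply: (is_bochner_approx (mu := mu) NN); exact: dens.
have [k k0 iF] := density_form mufin af.
have aT : approx_integral mu trace_norm f (nu setT).
  have := af setT measurableT; congr approx_integral; apply/funext => l.
  by rewrite indicT scale1r.
have uL th : ucont (fun l => L (th, l)) by exact: in_C_ucont.
have uR th : ucont (fun l => R (th, l)) by exact: in_C_ucont.
have aQ th : approx_integral mu trace_norm
    (fun l => L (th, l) \o f l \o adjoint (R (th, l))) (Q_spectral L R nu f th).
  have [J [aJ _]] := iF _ _ (uL th) (uR th).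
  by rewrite (_ : Q_spectral L R nu f th = J)//; exact: (bochner_integralE mufin NN aJ).
have lin_id : adjoint (fun x : H => x) = fun x => x by apply: (adjoint_uniq bnd_id).
have uid : ucont (fun _ : torus K => (fun x : H => x)) by exact: ucont_cst ler01 bnd_id.
(* The h-th Fourier coefficient of nu is the quadratic functional with L = e^{i h l} and R the
   identity. *)
have ac (h : int) : approx_integral mu trace_norm (fun l => torus_exp h l *: f l) (cov_op P (X h) (X 0)).
  have [J [aJ _]] := iF _ _ (ucont_exp h uid) uid.
  have aJ' : approx_integral mu trace_norm (fun l => torus_exp h l *: f l) J.
    by move: aJ; congr approx_integral; apply/funext => l; rewrite lin_id; apply/funext.
  by rewrite spec (_ : bochner_integral _ _ _ = J)//; exact: (bochner_integralE mufin NN aJ').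
(* [form_diff] and [trig_form] ask for linearity at every l; the integrals of f remain valid for
   F. *)
pose F l := linear_part (f l).
have iF' : integrable_form mu F k.
  move=> A B uA uB; have [J [aJ bJ]] := iF A B uA uB; exists J; split=> //.
  exact: (@approx_linear_part _ _ mu f (nu setT) (fun l T => A l \o T \o adjoint (B l)) mufin aT _ aJ).
have aQ' th : approx_integral mu trace_norm
    (fun l => L (th, l) \o F l \o adjoint (R (th, l))) (Q_spectral L R nu f th).
  exact: (@approx_linear_part _ _ mu f (nu setT) (fun l T => L (th, l) \o T \o adjoint (R (th, l))) mufin aT _ (aQ th)).
have ac' (h : int) : approx_integral mu trace_norm (fun l => torus_exp h l *: F l) (cov_op P (X h) (X 0)).
  exact: (@approx_linear_part _ _ mu f (nu setT) (fun l T => torus_exp h l *: T) mufin aT _ (ac h)).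
have lF l : lin (F l) by exact: lin_linear_part.
have cov_shift t h : cov_op P (X (t + h)) (X t) = cov_op P (X h) (X 0) by exact: covX.
have [M M0 eM] := energy_bound pX sX eX X2.
have cv := autocovariance_limit pX sX eX X2 ophi span0 cov_shift.
(* From here w is fixed outside one null set and the argument is deterministic: one event bounds the
   energies by M, the other gives convergence of all Fourier coefficients. *)
apply: filterS2 eM cv => w nM ncov.
pose Y n := centered n (data X w); pose I n := periodogram n (Y n).
pose kn n := n%:R^-1 * \sum_(1 <= j < n.+1) (dot_norm hdot (Y n j)) ^+ 2.
have kn0 n : 0 <= kn n by rewrite mulr_ge0 ?invr_ge0 ?sumr_ge0// => j _; exact: sqr_ge0.
have lebfin := @leb_torusT K.
have iI n : integrable_form (@leb_torus K) (I n) (kn n) by exact: periodogram_form.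
have lI n l : lin (I n l) by exact: (tnle_tensor _ _).1.
pose Qn n := Q_periodogram L R n (fun k => X k%:Z w).
have aQn n th : approx_integral (@leb_torus K) trace_norm
    (fun l => L (th, l) \o I n l \o adjoint (R (th, l))) (Qn n th).
  have [J [aJ _]] := iI n _ _ (uL th) (uR th).
  by rewrite (_ : Qn n th = J)//; exact: (bochner_integralE lebfin NN aJ).
split=> [n||e e0].
- exact: (form_in_C cT iL iR lebfin (kn0 n) (iI n) (lI n) (aQn n)).
- exact: (form_in_C cT iL iR mufin k0 iF' lF aQ').
- exact: (forms_limit cT iL iR (fun=> lebfin) mufin iI iF' lI lF k0 M0 nM
    (fun n h => periodogram_fourier n (Y n) h) ac' ncov aQn aQ' e0).
Qed.
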